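(* Let $G$ be the simply connected simple complex algebraic group of type $E_6$ and let $H\subset G$ be the maximal reductive subgroup of type $A_5\times A_1$. Then $G/P_1$ and $G/P_6$ are spherical $H$-varieties. The varieties $G/P_2,\ldots,G/P_5$ are not $H$-spherical.
   Context: The ground field is $\mathbb{C}$. Fix a maximal torus $T$ and a Borel subgroup $B\supset T$ of $G$, with simple roots $\alpha_1,\ldots,\alpha_6$ and fundamental weights $\omega_1,\ldots,\omega_6$ in Bourbaki numbering. $P_i\supset B$ is the maximal parabolic subgroup associated to $\omega_i$ (the stabilizer of the highest weight line in the irreducible $G$-module of highest weight $\omega_i$). The subgroup $H$ is the connected subsystem subgroup containing $T$ with simple roots $\alpha_1,\alpha_3,\alpha_4,\alpha_5,\alpha_6$ (the $A_5$ factor) and $\alpha_1+2\alpha_2+2\alpha_3+3\alpha_4+2\alpha_5+\alpha_6$ (the highest root of $G$; the $A_1$ factor). $H$ acts on $G/P_i$ by left multiplication. $G/P_i$ is $H$-spherical (a spherical $H$-variety) if a Borel subgroup of $H$ has an open orbit in it. *)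

(* Defs.v *)
From mathcomp Require Import all_boot all_order all_algebra.
From mathcomp Require Import mpoly.
From mathcomp Require Import boolp classical_sets reals complex.

Set Implicit Arguments.
Unset Strict Implicit.
Unset Printing Implicit Defensive.

Import Order.TTheory GRing.Theory Num.Theory.
Local Open Scope classical_set_scope.
Local Open Scope ring_scope.

Definition zclosed (K : fieldType) (n : nat) (A : set 'M[K]_n) : Prop :=
  exists I : set {mpoly K[n * n]},
    A = [set M | forall p, I p -> p.@[fun k => mxvec M 0 k] = 0].

Definition zclosed_in (K : fieldType) (n : nat) (X A : set 'M[K]_n) : Prop :=
  exists2 Z, zclosed Z & A = X `&` Z.

Definition zopen_in (K : fieldType) (n : nat) (X A : set 'M[K]_n) : Prop :=
  exists2 Z, zclosed Z & A = X `\` Z.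

Definition zconnected (K : fieldType) (n : nat) (A : set 'M[K]_n) : Prop :=
  forall A1 A2 : set 'M[K]_n, zclosed_in A A1 -> zclosed_in A A2 ->
    A = A1 `|` A2 -> A1 `&` A2 = set0 -> A1 = set0 \/ A2 = set0.

(* The coordinate ring of GL_n is generated by the matrix entries and 1/det. *)
Definition regular_on (K : fieldType) (n : nat) (G : set 'M[K]_n)
    (f : 'M[K]_n -> K) : Prop :=
  exists (p : {mpoly K[n * n]}) (k : nat), forall g, G g ->
    f g = p.@[fun j => mxvec g 0 j] / \det g ^+ k.

Definition subgroup (K : fieldType) (n : nat) (A : set 'M[K]_n) : Prop :=
  [/\ forall g, A g -> g \in unitmx,
      A 1%:M,
      forall g h, A g -> A h -> A (g *m h) &
      forall g, A g -> A (invmx g)].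

Definition generated (K : fieldType) (n : nat) (S : set 'M[K]_n) :
    set 'M[K]_n := smallest (@subgroup K n) S.

Definition derived (K : fieldType) (n : nat) (A : set 'M[K]_n) : set 'M[K]_n :=
  generated [set g *m h *m invmx g *m invmx h | g in A & h in A].

Definition solvable_grp (K : fieldType) (n : nat) (A : set 'M[K]_n) : Prop :=
  exists k : nat, iter k (@derived K n) A = [set 1%:M].

Definition closed_conn_solvable (K : fieldType) (n : nat)
    (H B : set 'M[K]_n) : Prop :=
  [/\ subgroup B, zclosed_in H B, zconnected B & solvable_grp B].

Definition borel_subgroup (K : fieldType) (n : nat) (H B : set 'M[K]_n) :
    Prop :=
  closed_conn_solvable H B /\
  forall B', closed_conn_solvable H B' -> B `<=` B' -> B' = B.

Definition lcoset (K : fieldType) (n : nat) (P : set 'M[K]_n) (g : 'M[K]_n) :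
    set 'M[K]_n := [set g *m p | p in P].

(* A set of cosets is open in G / P when it is open for the quotient of the
   Zariski topology of G. *)
Definition open_in_quotient (K : fieldType) (n : nat) (G P : set 'M[K]_n)
    (O : set (set 'M[K]_n)) : Prop :=
  O `<=` [set lcoset P g | g in G] /\
  zopen_in G [set g | G g /\ O (lcoset P g)].

Definition orbit_left (K : fieldType) (n : nat) (B : set 'M[K]_n)
    (x : set 'M[K]_n) : set (set 'M[K]_n) :=
  [set [set b *m g | g in x] | b in B].

Definition spherical (K : fieldType) (n : nat) (G H P : set 'M[K]_n) : Prop :=
  exists2 B, borel_subgroup H B &
  exists2 x, [set lcoset P g | g in G] x &
    open_in_quotient G P (orbit_left B x).

(* The element j of 'I_6 carries Bourbaki's label j + 1; [node] turns a label
   between 1 and 6 into an element of 'I_6. *)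
Definition node (k : nat) : 'I_6 := inord k.-1.

(* Edges 1-3, 3-4, 4-5, 5-6, 2-4 in Bourbaki's labels. *)
Definition E6_edges : seq (nat * nat) :=
  [:: (0, 2); (2, 3); (3, 4); (4, 5); (1, 3)]%N.

Definition E6_cartan (i j : nat) : int :=
  if i == j then 2
  else if ((i, j) \in E6_edges) || ((j, i) \in E6_edges) then -1 else 0.

(* Weights are written in the basis of fundamental weights: the entry of index
   j of mu is <mu, alpha_j^vee>. *)
Definition sub_simple_root (mu : seq int) (i : nat) : seq int :=
  mkseq (fun j => mu`_j - E6_cartan i j) 6.

(* The weights of the minuscule module of highest weight omega_1, i.e. the Weyl
   orbit of omega_1: all of them are reached from omega_1 by at most 16 simple
   reflections mu |-> mu - alpha_i with <mu, alpha_i^vee> = 1. *)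
Definition E6_weights : seq (seq int) :=
  iter 16 (fun s => undup (s ++
      [seq sub_simple_root mu i | mu <- s, i <- [seq i <- iota 0 6 | mu`_i == 1]]))
    [:: [:: 1; 0; 0; 0; 0; 0]].

Lemma size_E6_weights : size E6_weights = 27.
Proof. by vm_compute. Qed.

Lemma E6_weights_weyl_stable : all (fun mu => all (fun i : nat =>
    iter `|mu`_i| (fun nu => if 0 <= mu`_i then sub_simple_root nu i
       else mkseq (fun j => nu`_j + E6_cartan i j) 6) mu \in E6_weights)
  (iota 0 6)) E6_weights.
Proof. by vm_compute. Qed.

Definition wt (a : 'I_27) : seq int := nth [::] E6_weights a.

(* The simply connected group of type E_6 is realised as the Chevalley group of
   the 27-dimensional minuscule module V(omega_1).  This module has a basis
   (v_mu) of weight vectors on which the Chevalley generators act by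
   e_i v_mu = v_(mu + alpha_i) and f_i v_mu = v_(mu - alpha_i), where v_nu = 0
   if nu is not a weight; f_i is the transpose of e_i and both square to 0.
   Since the weights of V(omega_1) span the whole weight lattice, the group
   generated by the exp(t e_i) and exp(t f_i) is the simply connected one. *)
Definition e_ (K : fieldType) (i : 'I_6) : 'M[K]_27 :=
  \matrix_(a, b) (wt b == sub_simple_root (wt a) i)%:R.

Definition x_pos (K : fieldType) (i : 'I_6) (t : K) : 'M[K]_27 :=
  1%:M + t *: e_ K i.

Definition x_neg (K : fieldType) (i : 'I_6) (t : K) : 'M[K]_27 :=
  1%:M + t *: (e_ K i)^T.

Definition E6_group (K : fieldType) : set 'M[K]_27 :=
  generated [set g | exists (i : 'I_6) (t : K), g = x_pos i t \/ g = x_neg i t].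

(* \prod_j alpha_j^vee(t_j) *)
Definition torus_elt (K : fieldType) (t : 'I_6 -> K) : 'M[K]_27 :=
  diag_mx (\row_a \prod_j t j ^ ((wt a)`_j)).

Definition E6_torus (K : fieldType) : set 'M[K]_27 :=
  [set torus_elt t | t in [set t : 'I_6 -> K | forall j, t j != 0]].

(* \sum_k c_k alpha_k as a character, evaluated at torus_elt t *)
Definition root_char (K : fieldType) (c : 'I_6 -> int) (t : 'I_6 -> K) : K :=
  \prod_j t j ^ (\sum_k c k * E6_cartan k j).

(* The root subgroup U_beta, beta = \sum_k c_k alpha_k: the image of the
   morphisms u : (K, +) -> G with t u(s) t^-1 = u(beta(t) s) for t in T. *)
Definition root_subgroup (K : fieldType) (c : 'I_6 -> int) : set 'M[K]_27 :=
  [set g | exists2 u : K -> 'M[K]_27,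
    [/\ forall s, @E6_group K (u s),
        forall s s', u (s + s') = u s *m u s',
        exists q : 'M[{poly K}]_27, forall s a b, u s a b = (q a b).[s] &
        forall t s, (forall j, t j != 0) ->
          torus_elt t *m u s *m invmx (torus_elt t) = u (root_char c t * s)] &
    exists s, g = u s].

Definition is_rational_rep (K : fieldType) (n m : nat) (G : set 'M[K]_n)
    (rho : 'M[K]_n -> 'M[K]_m) : Prop :=
  [/\ rho 1%:M = 1%:M,
      forall g h, G g -> G h -> rho (g *m h) = rho g *m rho h &
      forall a b, regular_on G (fun g => rho g a b)].

Definition is_irreducible (K : fieldType) (n m : nat) (G : set 'M[K]_n)
    (rho : 'M[K]_n -> 'M[K]_m) : Prop :=
  (0 < m)%N /\
  forall W : {vspace 'cV[K]_m},
    (forall g w, G g -> w \in W -> rho g *m w \in W) ->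
    W = 0%VS \/ W = fullv.

(* The Borel subgroup B is generated by T and the x_pos i t. *)
Definition is_highest_weight_vector (K : fieldType) (m : nat) (i : 'I_6)
    (rho : 'M[K]_27 -> 'M[K]_m) (v : 'cV[K]_m) : Prop :=
  [/\ v != 0,
      forall j t, rho (x_pos j t) *m v = v &
      forall t, (forall j, t j != 0) -> rho (torus_elt t) *m v = t i *: v].

Definition line_stabilizer (K : fieldType) (n m : nat) (G : set 'M[K]_n)
    (rho : 'M[K]_n -> 'M[K]_m) (v : 'cV[K]_m) : set 'M[K]_n :=
  [set g | G g /\ exists c : K, rho g *m v = c *: v].

(* The irreducible module of highest weight omega_i and its highest weight line
   are unique up to isomorphism, so i determines P. *)
Definition is_max_parabolic (K : fieldType) (i : 'I_6) (P : set 'M[K]_27) :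
    Prop :=
  exists (m : nat) (rho : 'M[K]_27 -> 'M[K]_m) (v : 'cV[K]_m),
    [/\ is_rational_rep (@E6_group K) rho,
        is_irreducible (@E6_group K) rho,
        is_highest_weight_vector i rho v &
        P = line_stabilizer (@E6_group K) rho v].

Definition simple_root (i : 'I_6) : 'I_6 -> int := fun k => (k == i)%:R.

Definition highest_root : 'I_6 -> int :=
  fun k => [:: 1; 2; 2; 3; 2; 1]`_k.

Definition A5A1_simple_roots : set ('I_6 -> int) :=
  [set c | c = highest_root \/ exists2 i, i != node 2 & c = simple_root i].

Definition A5A1_group (K : fieldType) : set 'M[K]_27 :=
  generated (@E6_torus K `|`
    \bigcup_(c in A5A1_simple_roots)
      (@root_subgroup K c `|` @root_subgroup K (fun k => - c k))).

Definition A5A1_spherical (K : fieldType) (P : set 'M[K]_27) : Prop :=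
  spherical (@E6_group K) (@A5A1_group K) P.

(* Main.v *)
(* Some B-orbit on G/P is open iff some double coset B g P is open in G.  The
   root subgroups are determined by their weights and by the invariant cubic form
   of the minuscule module V, and P_i by the Bruhat decomposition, so all groups
   are generated by the torus and explicit one-parameter groups 1 + s e_beta.

   G/P_1 is the projectivized cone of the x in V with x # x = 0; on the open set
   where three B-semi-invariants do not vanish, B brings x to a normal form with
   four nonzero coordinates, on which T acts transitively.

   When B g P is open, two regular functions on G which are semi-invariant under
   B x P with the same characters are proportional, as G is irreducible.  For P_2,
   P_3 and P_4 take a B-equivariant, P-semi-invariant map A from G to End V, the
   Casimir tensor W of the A_1 factor and a B-eigenvector m among the root vectors
   outside Lie H (Lie-Kolchin): with L = tr(- A), the functions
   W(L, L o ad m)^2 and W(L, L) L(m)^2 have the same characters.  (For P_3 the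
   place of m is taken by eigenvectors in the two H-summands of V.)  Letting the
   torus act, m degenerates to a single root vector, and then the values at two explicit
   integral points of G are not proportional.

   P_5 and P_6 are the images of P_3 and P_1 under an outer automorphism of G that
   preserves H. *)
Require Import Defs.
From HB Require Import structures.
From mathcomp Require Import all_boot all_order all_algebra.
From mathcomp Require Import mpoly.
From mathcomp Require Import ring ssrZ zify.
From mathcomp Require Import boolp classical_sets reals complex.

Set Implicit Arguments.
Unset Strict Implicit.
Unset Printing Implicit Defensive.

Import Order.TTheory GRing.Theory Num.Theory.
Local Open Scope classical_set_scope.
Local Open Scope ring_scope.

(** A Borel subgroup of H has dimension 6 + 16 = 22. For P_3, P_4 and P_5 a dimension count would
    suffice, the quotients having dimensions 25, 29 and 25; but G/P_2 has dimension 21, so that only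
    finer invariants can exclude an open orbit. The comparison of semi-invariants handles all these
    cases alike. The obstacle is that B is known only as some maximal closed connected solvable
    subgroup, so its eigenvectors cannot be written down. The H-invariance of W removes it: a
    relation a_1 W(L, L o ad m)^2 + a_2 W(L, L) L(m)^2 = 0 on G, with fixed coefficients, passes
    from m to its translates under H and, being polynomial in m, to rescaled limits of those. A
    one-parameter subgroup of T with distinct weights leads to one of finitely many root vectors,
    each of which can be tested. The squares are there to equalize degrees: both terms have degree 4
    in L and degree 2 in m. Two further objects are given only by characterizations, the stabilizer
    of a highest weight line and a maximal solvable subgroup. Both contain the positive root groups
    and T, and such overgroups are determined by the opposite simple root groups that they
    contain. *)

(** * Algebras of functions and matrix-valued maps *)

Section FunctionAlgebra.
Variables (K : fieldType) (T : Type) (Q : (T -> K) -> Prop).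

(** The instances are [polyfun] on matrices and [laurent] and [poly_fun] in one parameter. Treating
    them together allows every matrix expression to be shown regular once, and allows polynomial
    functions to be restricted to curves. *)
Definition funalg : Prop :=
  [/\ forall c, Q (fun=> c),
      forall f g, Q f -> Q g -> Q (fun x => f x + g x) &
      forall f g, Q f -> Q g -> Q (fun x => f x * g x)].

Definition mxfun m n (F : T -> 'M[K]_(m, n)) : Prop :=
  forall a b, Q (fun x => F x a b).

Hypothesis hQ : funalg.

Lemma fa_const c : Q (fun=> c). Proof. by case: hQ. Qed.

Lemma fa_add f g : Q f -> Q g -> Q (fun x => f x + g x).
Proof. by case: hQ => _ + _; apply. Qed.

Lemma fa_mul f g : Q f -> Q g -> Q (fun x => f x * g x).
Proof. by case: hQ => _ _; apply. Qed.

Lemma fa_ext f g : Q f -> f =1 g -> Q g.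
Proof. by move=> + /funext <-. Qed.

Lemma fa_opp f : Q f -> Q (fun x => - f x).
Proof.
move=> Qf; apply: fa_ext (fa_mul (fa_const (-1)) Qf) _ => x.
by rewrite mulN1r.
Qed.

Lemma fa_sub f g : Q f -> Q g -> Q (fun x => f x - g x).
Proof. by move=> Qf Qg; apply: fa_add Qf (fa_opp Qg). Qed.

Lemma fa_sum I (r : seq I) (P : pred I) (F : I -> T -> K) :
  (forall i, Q (F i)) -> Q (fun x => \sum_(i <- r | P i) F i x).
Proof.
move=> QF; elim: r => [|i r IH].
  by apply: fa_ext (fa_const 0) _ => x; rewrite big_nil.
have [Pi|nPi] := boolP (P i).
  by apply: fa_ext (fa_add (QF i) IH) _ => x; rewrite big_cons Pi.
by apply: fa_ext IH _ => x; rewrite big_cons (negbTE nPi).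
Qed.

Lemma fa_prod I (r : seq I) (P : pred I) (F : I -> T -> K) :
  (forall i, Q (F i)) -> Q (fun x => \prod_(i <- r | P i) F i x).
Proof.
move=> QF; elim: r => [|i r IH].
  by apply: fa_ext (fa_const 1) _ => x; rewrite big_nil.
have [Pi|nPi] := boolP (P i).
  by apply: fa_ext (fa_mul (QF i) IH) _ => x; rewrite big_cons Pi.
by apply: fa_ext IH _ => x; rewrite big_cons (negbTE nPi).
Qed.

Lemma fa_exp f k : Q f -> Q (fun x => f x ^+ k).
Proof.
move=> Qf; elim: k => [|k IH]; first by apply: fa_ext (fa_const 1) _.
by apply: fa_ext (fa_mul Qf IH) _ => x; rewrite exprS.
Qed.

Lemma fa_meval k (p : {mpoly K[k]}) (v : 'I_k -> T -> K) :
  (forall i, Q (v i)) -> Q (fun x => p.@[fun i => v i x]).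
Proof.
move=> Qv; apply: (@fa_ext (fun x => \sum_(m <- msupp p)
  p@_m * \prod_(i < k) v i x ^+ m i)); last by move=> x; rewrite mevalE.
by apply: fa_sum => m; apply: fa_mul (fa_const _) _; apply: fa_prod => i;
   apply: fa_exp.
Qed.

Lemma mxfun_const m n (M : 'M[K]_(m, n)) : mxfun (fun=> M).
Proof. by move=> a b; apply: fa_const. Qed.

Lemma mxfun_add m n (F G : T -> 'M[K]_(m, n)) :
  mxfun F -> mxfun G -> mxfun (fun x => F x + G x).
Proof.
move=> QF QG a b; apply: fa_ext (fa_add (QF a b) (QG a b)) _ => x.
by rewrite mxE.
Qed.

Lemma mxfun_scale m n f (F : T -> 'M[K]_(m, n)) :
  Q f -> mxfun F -> mxfun (fun x => f x *: F x).
Proof.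
by move=> Qf QF a b; apply: fa_ext (fa_mul Qf (QF a b)) _ => x; rewrite mxE.
Qed.

Lemma mxfun_mul m n p (F : T -> 'M[K]_(m, n)) (G : T -> 'M[K]_(n, p)) :
  mxfun F -> mxfun G -> mxfun (fun x => F x *m G x).
Proof.
move=> QF QG a b; pose s x := \sum_j F x a j * G x j b.
apply: (@fa_ext s); last by move=> x; rewrite mxE.
by apply: fa_sum => j; apply: fa_mul.
Qed.

Lemma mxfun_tr m n (F : T -> 'M[K]_(m, n)) :
  mxfun F -> mxfun (fun x => (F x)^T).
Proof. by move=> QF a b; apply: fa_ext (QF b a) _ => x; rewrite mxE. Qed.

Lemma fa_det n (F : T -> 'M[K]_n) : mxfun F -> Q (fun x => \det (F x)).
Proof.
move=> QF; apply: fa_sum => s; apply: fa_mul; first exact: fa_const.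
by apply: fa_prod => i; apply: QF.
Qed.

Lemma fa_trace n (F : T -> 'M[K]_n) : mxfun F -> Q (fun x => \tr (F x)).
Proof. by move=> QF; apply: fa_sum => i; apply: QF. Qed.

Lemma mxfun_adj n (F : T -> 'M[K]_n) : mxfun F -> mxfun (fun x => \adj (F x)).
Proof.
move=> QF a b; pose c x := (-1) ^+ (b + a) * \det (row' b (col' a (F x))).
apply: (@fa_ext c); last by move=> x; rewrite mxE.
apply: fa_mul; first exact: fa_const.
by apply: fa_det => i j; apply: fa_ext (QF _ _) _ => x; rewrite !mxE.
Qed.

End FunctionAlgebra.

(** * Zariski topology: separation, irreducibility, connectedness *)

Section ZariskiTopology.
Variable K : fieldType.
Implicit Type n : nat.

Definition polyfun n (f : 'M[K]_n -> K) : Prop :=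
  exists p : {mpoly K[n * n]}, forall M, f M = p.@[fun k => mxvec M 0 k].

Lemma polyfun_alg n : funalg (@polyfun n).
Proof.
split.
- by move=> c; exists c%:MP => M; rewrite mevalC.
- by move=> f g [p hp] [q hq]; exists (p + q) => M; rewrite mevalD hp hq.
- by move=> f g [p hp] [q hq]; exists (p * q) => M; rewrite mevalM hp hq.
Qed.

Lemma polyfun_id n : mxfun (@polyfun n) (fun M => M).
Proof.
by move=> a b; exists ('X_(mxvec_index a b)) => M; rewrite mevalXU mxvecE.
Qed.

Lemma polyfun_meval (T : Type) (Q : (T -> K) -> Prop) n
    (F : T -> 'M[K]_n) (f : 'M[K]_n -> K) :
  funalg Q -> polyfun f -> mxfun Q F -> Q (fun x => f (F x)).
Proof.
move=> hQ [p hp] QF.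
apply: (@fa_ext _ _ _ (fun x => p.@[fun k => mxvec (F x) 0 k])) => [|x].
  apply: fa_meval => // k; case/mxvec_indexP: k => a b.
  by apply: fa_ext (QF a b) _ => x; rewrite mxvecE.
by rewrite hp.
Qed.

Lemma polymap_comp (T : Type) (Q : (T -> K) -> Prop) n m k
    (F : T -> 'M[K]_n) (G : 'M[K]_n -> 'M[K]_(m, k)) :
  funalg Q -> mxfun (@polyfun n) G -> mxfun Q F -> mxfun Q (fun x => G (F x)).
Proof. by move=> hQ hG hF a b; apply: polyfun_meval (hG a b) hF. Qed.

Lemma zclosed_zeros n J (f : J -> 'M[K]_n -> K) :
  (forall j, polyfun (f j)) -> zclosed [set M | forall j, f j M = 0].
Proof.
move=> hf; exists [set p | exists j, forall M,
  f j M = p.@[fun k => mxvec M 0 k]].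
apply/seteqP; split => M /=.
  by move=> h p [j hj]; rewrite -hj h.
by move=> h j; case: (hf j) => p hp; rewrite hp; apply: h; exists j.
Qed.

Lemma zclosed_sep n (A : set 'M[K]_n) M : zclosed A -> ~ A M ->
  exists f, [/\ polyfun f, f M != 0 & forall N, A N -> f N = 0].
Proof.
move=> [I ->] /= /existsNP [p /not_implyP [Ip pM]].
exists (fun M => p.@[fun k => mxvec M 0 k]); split => //; first by exists p.
  exact/eqP.
by move=> N; apply.
Qed.

Lemma zclosed_preim n m (F : 'M[K]_n -> 'M[K]_m) (A : set 'M[K]_m) :
  mxfun (@polyfun n) F -> zclosed A -> zclosed (F @^-1` A).
Proof.
move=> hF [I ->].
have -> : F @^-1` [set M | forall p, I p -> p.@[fun k => mxvec M 0 k] = 0] =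
    [set M | forall j : {p | I p}, (sval j).@[fun k => mxvec (F M) 0 k] = 0].
  by apply/seteqP; split=> M /= h => [[p Ip]|p Ip] /=;
     [apply: h | apply: (h (exist _ p Ip))].
apply: zclosed_zeros => -[p Ip] /=.
apply: (polyfun_meval (polyfun_alg n) _ hF (f := fun M =>
  p.@[fun k => mxvec M 0 k])).
by exists p.
Qed.

Lemma zclosed_in1 n (A : set 'M[K]_n) f : polyfun f ->
  zclosed_in A [set M | A M /\ f M = 0].
Proof.
move=> hf; exists [set M | forall _ : unit, f M = 0].
  exact: zclosed_zeros.
by apply/seteqP; split=> M /= [AM]; [move=> ->|move/(_ tt)].
Qed.

Section Subgroups.
Variable n : nat.
Implicit Types (A B S : set 'M[K]_n).

Lemma subgroup_unit A g : subgroup A -> A g -> g \in unitmx.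
Proof. by case=> h _ _ _; apply: h. Qed.
Lemma subgroup1 A : subgroup A -> A 1%:M. Proof. by case. Qed.
Lemma subgroupM A g h : subgroup A -> A g -> A h -> A (g *m h).
Proof. by case=> _ _ hM _; apply: hM. Qed.
Lemma subgroupV A g : subgroup A -> A g -> A (invmx g).
Proof. by case=> _ _ _; apply. Qed.

Lemma subgroupMl A g h : subgroup A -> A g -> A (g *m h) -> A h.
Proof.
move=> sA Ag Agh; rewrite -[h](mulKmx (subgroup_unit sA Ag)).
by apply: subgroupM Agh => //; apply: subgroupV.
Qed.

Lemma subgroupMr A g h : subgroup A -> A h -> A (g *m h) -> A g.
Proof.
move=> sA Ah Agh; rewrite -[g](mulmxK (subgroup_unit sA Ah)).
by apply: subgroupM => //; apply: subgroupV.
Qed.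

Lemma subgroup_setI A B : subgroup A -> subgroup B -> subgroup (A `&` B).
Proof.
move=> sA sB; split.
- by move=> g [/(subgroup_unit sA)].
- by split; apply: subgroup1.
- by move=> g h [Ag Bg] [Ah Bh]; split; apply: subgroupM.
- by move=> g [Ag Bg]; split; apply: subgroupV.
Qed.

Lemma invmxM g h : g \in unitmx -> h \in unitmx ->
  invmx (g *m h) = invmx h *m invmx g :> 'M[K]_n.
Proof.
move=> ug uh; have ugh : g *m h \in unitmx by rewrite unitmx_mul ug.
rewrite -[RHS](mulmxK ugh) !mulmxA -[_ *m invmx g *m g]mulmxA mulVmx // mulmx1.
by rewrite mulVmx // mul1mx.
Qed.

Lemma subgroup_unitmx : subgroup [set g : 'M[K]_n | g \in unitmx].
Proof.
split=> //=; first exact: unitmx1.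
  by move=> g h ug uh; rewrite unitmx_mul ug.
by move=> g ug; rewrite unitmx_inv.
Qed.

Lemma subgroup_generated S : (forall g, S g -> g \in unitmx) ->
  subgroup (generated S).
Proof.
move=> uS; split.
- by move=> g Sg; apply: (Sg [set g | g \in unitmx]); split;
     [exact: subgroup_unitmx|].
- by move=> A [sA _]; apply: subgroup1.
- by move=> g h Sg Sh A hA; apply: (subgroupM hA.1); [apply: (Sg A)|apply: (Sh A)].
- by move=> g Sg A hA; apply: (subgroupV hA.1); apply: (Sg A).
Qed.

Lemma sub_generated S : S `<=` generated S. Proof. exact: sub_smallest. Qed.

Lemma generated_sub S A : subgroup A -> S `<=` A -> generated S `<=` A.
Proof. by move=> sA SA; apply: smallest_sub. Qed.

Lemma generated_gen_sub S S' : (forall g, S' g -> g \in unitmx) ->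
  S `<=` generated S' -> generated S `<=` generated S'.
Proof. by move=> uS'; apply: generated_sub; exact: subgroup_generated. Qed.

End Subgroups.

(** Any two nonempty relatively open subsets of A meet; it is enough to say so for the principal
    open sets p != 0 and q != 0. *)
Definition zirred n (A : set 'M[K]_n) : Prop :=
  forall p q a b, polyfun p -> polyfun q -> A a -> A b -> p a != 0 ->
    q b != 0 -> exists2 c, A c & p c != 0 /\ q c != 0.

Lemma zirred_connected n (A : set 'M[K]_n) : zirred A -> zconnected A.
Proof.
move=> irrA A1 A2 [Z1 cZ1 e1] [Z2 cZ2 e2] eA e0.
apply: contrapT => /not_orP [/eqP/set0P [a A1a] /eqP/set0P [b A2b]].
have Aa : A a by rewrite eA; left.
have Ab : A b by rewrite eA; right.
have nZ2 : ~ Z2 a.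
  move=> Z2a; have : (A1 `&` A2) a by split=> //; rewrite e2; split.
  by rewrite e0.
have nZ1 : ~ Z1 b.
  move=> Z1b; have : (A1 `&` A2) b by split=> //; rewrite e1; split.
  by rewrite e0.
have [f [hf fa f0]] := zclosed_sep cZ2 nZ2.
have [g [hg gb g0]] := zclosed_sep cZ1 nZ1.
have [c Ac [fc gc]] := irrA _ _ _ _ hf hg Aa Ab fa gb.
move: Ac; rewrite eA e1 e2 => -[[_ /g0/eqP]|[_ /f0/eqP]]; exact/negP.
Qed.

(** Let the group be split into two disjoint closed parts. Since a generator g is joined to 1 by a
    polynomial image of a connected set inside the group, a and a g lie in the same part for every
    a. Hence g preserves both parts under right multiplication, and the elements with this property
    form a subgroup. *)
Lemma zconnected_generated n (S : set 'M[K]_n) :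
  (forall g, S g -> g \in unitmx) ->
  (forall g, S g -> exists k (B : set 'M[K]_k) (F : 'M[K]_k -> 'M[K]_n),
    [/\ zconnected B, mxfun (@polyfun k) F, forall h, B h -> generated S (F h),
        exists2 h, B h & F h = 1%:M & exists2 h, B h & F h = g]) ->
  zconnected (generated S).
Proof.
move=> uS hS A1 A2 c1 c2 eA e0.
have sG := subgroup_generated uS.
have dis g : A1 g -> A2 g -> False.
  by move=> ? ?; have : (A1 `&` A2) g by []; rewrite e0.
pose St := [set g | [/\ generated S g, forall a, A1 a -> A1 (a *m g) &
  forall a, A2 a -> A2 (a *m g)]].
have A1G : A1 `<=` generated S by rewrite eA => g; left.
have A2G : A2 `<=` generated S by rewrite eA => g; right.
have sSt : subgroup St.
  split.
  - by move=> g [/(subgroup_unit sG)].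
  - by split=> [|a|a]; rewrite ?mulmx1 //; exact: (subgroup1 sG).
  - move=> g h [Gg g1 g2] [Gh h1 h2]; split=> [|a Aa|a Aa].
    + exact: (subgroupM sG).
    + by rewrite mulmxA; apply/h1/g1.
    + by rewrite mulmxA; apply/h2/g2.
  - move=> g [Gg g1 g2]; have ug := subgroup_unit sG Gg.
    have Gv := subgroupV sG Gg.
    split=> // a Aa.
      have : generated S (a *m invmx g) by apply: (subgroupM sG) => //; apply: A1G.
      rewrite {1}eA => -[//|/g2]; rewrite mulmxKV // => A2a.
      by case: (dis a).
    have : generated S (a *m invmx g) by apply: (subgroupM sG) => //; apply: A2G.
    rewrite {1}eA => -[/g1|//]; rewrite mulmxKV // => A1a.
    by case: (dis a).
have half (D1 D2 : set 'M[K]_n) : zclosed_in (generated S) D1 ->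
    zclosed_in (generated S) D2 -> generated S = D1 `|` D2 ->
    (forall g, D1 g -> D2 g -> False) ->
    forall g a, S g -> D1 a -> D1 (a *m g).
  move=> [Z1 cZ1 eD1] [Z2 cZ2 eD2] eD dD g a Sg Da.
  have Ga : generated S a by rewrite eD; left.
  have [k [B [F [cB hF BF [h0 Bh0 F0] [h1 Bh1 F1]]]]] := hS g Sg.
  have haF : mxfun (@polyfun k) (fun h => a *m F h).
    by apply: mxfun_mul hF; first exact: polyfun_alg;
       apply: mxfun_const; apply: polyfun_alg.
  pose B1 := [set h | B h /\ D1 (a *m F h)].
  pose B2 := [set h | B h /\ D2 (a *m F h)].
  have GF h : B h -> generated S (a *m F h).
    by move=> Bh; apply: (subgroupM sG) => //; apply: BF.
  have [] := cB B1 B2.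
  - exists [set h | Z1 (a *m F h)]; first exact: (zclosed_preim haF cZ1).
    apply/seteqP; split=> h /= [Bh].
      by rewrite eD1 => -[].
    by move=> Zh; split=> //; rewrite eD1; split=> //; apply: GF.
  - exists [set h | Z2 (a *m F h)]; first exact: (zclosed_preim haF cZ2).
    apply/seteqP; split=> h /= [Bh].
      by rewrite eD2 => -[].
    by move=> Zh; split=> //; rewrite eD2; split=> //; apply: GF.
  - apply/seteqP; split=> h /=; last by case=> -[].
    by move=> Bh; have := GF h Bh; rewrite {1}eD => -[|]; [left|right].
  - by apply/seteqP; split=> h //= -[[_ d1] [_ d2]]; apply: (dD _ d1 d2).
  - move=> B10; have : B1 h0 by split; rewrite ?F0 ?mulmx1.
    by rewrite B10.
  move=> B20; have := GF h1 Bh1; rewrite F1 {1}eD => -[//|D2g].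
  have : B2 h1 by split; rewrite ?F1.
  by rewrite B20.
have SSt : S `<=` St.
  move=> g Sg; split; first exact: sub_generated.
    by move=> a; apply: (half A1 A2).
  move=> a; apply: (half A2 A1) => //; first by rewrite setUC.
  by move=> h ? ?; apply: (dis h).
apply: contrapT => /not_orP [/eqP/set0P [a A1a] /eqP/set0P [b A2b]].
have Ga := A1G _ A1a; have Gb := A2G _ A2b.
have [_ + _] : St (invmx a *m b).
  by apply: (generated_sub sSt SSt); apply: (subgroupM sG) => //; apply: (subgroupV sG).
move=> /(_ a A1a); rewrite mulmxA mulmxV ?(subgroup_unit sG Ga) // mul1mx.
by move=> A1b; case: (dis b).
Qed.

(** The values of [f] on A are among the finitely many roots of [q]. Dividing [q] by the full power
    of X - f a separates the fibre over f a from the other fibres, by closed conditions on both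
    sides. *)
Lemma zconnected_const n (A : set 'M[K]_n) f (q : {poly K}) : zconnected A ->
  polyfun f -> q != 0 -> (forall a, A a -> q.[f a] = 0) ->
  forall a b, A a -> A b -> f a = f b.
Proof.
move=> cA hf q0 fq a b Aa Ab.
have [k [q' q'a eq]] := multiplicity_XsubC q (f a).
have {}q'a : q'.[f a] != 0 by move: q'a; rewrite q0.
have hA := polyfun_alg n.
have h1 : polyfun (fun M => f M - f a) by apply: fa_sub => //; apply: fa_const.
have h2 : polyfun (fun M => q'.[f M]).
  apply: (@fa_ext _ _ _ (fun M => \sum_(i < size q') q'`_i * f M ^+ i)).
    apply: fa_sum => // i; apply: fa_mul => //; first exact: fa_const.
    exact: fa_exp.
  by move=> M; rewrite horner_coef.
have [] := cA _ _ (zclosed_in1 A h1) (zclosed_in1 A h2).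
- apply/seteqP; split=> M /=; last by case=> -[].
  move=> AM; have := fq M AM.
  rewrite eq hornerM horner_exp !hornerE => /eqP; rewrite mulf_eq0.
  case/orP=> /eqP h; [by right|left; split=> //].
  by apply/eqP; move/eqP: h; rewrite expf_eq0 => /andP [].
- apply/seteqP; split=> M //= [[_ /eqP]]; rewrite subr_eq0 => /eqP -> [_ /eqP].
  exact/negP.
- move=> e; have : [set M | A M /\ f M - f a = 0] a by split; rewrite ?subrr.
  by rewrite e.
move=> e; have := fq b Ab.
rewrite eq hornerM horner_exp !hornerE => /eqP; rewrite mulf_eq0.
case/orP=> [/eqP h|].
  by have : [set M | A M /\ q'.[f M] = 0] b by []; rewrite e.
by rewrite expf_eq0 subr_eq0 => /andP [_ /eqP].
Qed.

End ZariskiTopology.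

(** * Laurent curves and irreducibility of generated groups *)

Section Laurent.
Variable K : closedFieldType.

Definition laurent (f : K -> K) : Prop :=
  exists (q : {poly K}) k, forall s, s != 0 -> f s = q.[s] / s ^+ k.

Lemma laurent_alg : funalg laurent.
Proof.
split.
- by move=> c; exists c%:P, 0 => s _; rewrite hornerC divr1.
- move=> f g [p [k hp]] [q [l hq]].
  exists (p * 'X^l + q * 'X^k), (k + l)%N => s s0.
  rewrite hp // hq // !hornerE ?hornerXn exprD.
  by field; rewrite !expf_neq0.
- move=> f g [p [k hp]] [q [l hq]]; exists (p * q), (k + l)%N => s s0.
  by rewrite hp // hq // hornerM exprD; field; rewrite !expf_neq0.
Qed.

Lemma laurent_id : laurent (fun s => s).
Proof. by exists 'X, 0 => s _; rewrite hornerX divr1. Qed.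

Lemma laurent_exprz (z : int) : laurent (fun s => s ^ z).
Proof.
case: z => k; first by exists 'X^k, 0 => s _; rewrite hornerXn divr1.
by exists 1, k.+1 => s _; rewrite hornerC div1r.
Qed.

Lemma laurent_neq0 f g s t : laurent f -> laurent g -> s != 0 -> t != 0 ->
  f s != 0 -> g t != 0 -> exists u, [/\ u != 0, f u != 0 & g u != 0].
Proof.
move=> [p [k hp]] [q [l hq]] s0 t0; rewrite hp // hq //.
rewrite !mulf_eq0 !negb_or => /andP [ps _] /andP [qt _].
have : p * q * 'X != 0.
  rewrite !mulf_eq0 polyX_eq0 orbF negb_or; apply/andP; split.
    by apply: contraNneq ps => ->; rewrite horner0.
  by apply: contraNneq qt => ->; rewrite horner0.
case/closed_nonrootP => u; rewrite rootE !hornerE !mulf_eq0 !negb_or.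
move=> /andP [/andP [pu qu] u0]; exists u; rewrite hp // hq //.
by rewrite !mulf_eq0 !negb_or pu qu !invr_eq0 !expf_neq0.
Qed.

(** A regular function on the projective line is constant; [p] and [q] are its expressions in the
    two charts. Clearing denominators with k = size q shows that p X^k has degree at most k. *)
Lemma poly_inv_const (p q : {poly K}) :
  (forall s, s != 0 -> p.[s] = q.[s^-1]) -> forall s, p.[s] = p.[0].
Proof.
move=> pq; pose k := size q.
pose r := \sum_(i < k) q`_i *: 'X^(k - i).
have e : p * 'X^k = r.
  apply/eqP; rewrite -subr_eq0; apply/negPn/negP.
  move=> nz; have : (p * 'X^k - r) * 'X != 0 by rewrite mulf_neq0 ?polyX_eq0.
  case/closed_nonrootP => s; rewrite rootE !hornerE mulf_eq0 negb_or.
  case/andP=> + s0; rewrite ?hornerXn pq // /r horner_sum horner_coef mulr_suml.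
  rewrite -sumrB big1 ?eqxx // => i _; rewrite hornerZ hornerXn.
  have -> : s ^+ k = s ^+ (k - i) * s ^+ i by rewrite -exprD subnK // ltnW.
  by rewrite exprVn mulrACA mulVf ?mulr1 ?subrr // expf_neq0.
have : (size (p * 'X^k)%R <= k.+1)%N.
  rewrite e /r (leq_trans (size_sum _ _ _)) //; apply/bigmax_leqP => i _.
  by rewrite (leq_trans (size_scale_leq _ _)) // size_polyXn ltnS leq_subr.
have [->|p0] := eqVneq p 0; first by move=> _ s; rewrite !horner0.
rewrite size_mulXn // -addn1 leq_add2l => /size1_polyC -> s.
by rewrite !hornerC.
Qed.

(** A pole at s = 0 is allowed so that one-parameter subgroups of the torus are included; the base
    point is s = 1. *)
Definition laurent_curve n (A : set 'M[K]_n) (F : K -> 'M[K]_n) : Prop :=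
  [/\ mxfun laurent F, F 1 = 1%:M & forall s, s != 0 -> A (F s)].

(** Along a curve from a to a g, two polynomial functions that are nonzero at a and at a g
    respectively become nonzero Laurent polynomials, so some parameter avoids the zeros of both. The
    elements g for which this conclusion holds at every a form a subgroup. *)
Lemma zirred_generated n (S : set 'M[K]_n) :
  (forall g, S g -> g \in unitmx) ->
  (forall g, S g -> exists F, laurent_curve (generated S) F /\
    exists2 s, s != 0 & F s = g) ->
  zirred (generated S).
Proof.
move=> uS hS; have sG := subgroup_generated uS; have hA := polyfun_alg K n.
pose St := [set g | generated S g /\ forall p q a, polyfun p -> polyfun q ->
  generated S a -> p a != 0 -> q (a *m g) != 0 ->
  exists2 c, generated S c & p c != 0 /\ q c != 0].
have sSt : subgroup St.
  split.
  - by move=> g [/(subgroup_unit sG)].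
  - split=> [|p q a _ _ Ga pa]; first exact: (subgroup1 sG).
    by rewrite mulmx1 => qa; exists a.
  - move=> g h [Gg hg] [Gh hh]; split; first exact: (subgroupM sG).
    move=> p q a hp hq Ga pa; rewrite mulmxA => qa.
    have hq' : polyfun (fun x => q (x *m h)).
      apply: polyfun_meval hq _ => //; apply: mxfun_mul => //.
        exact: polyfun_id.
      exact: mxfun_const.
    have [c Gc [pc qc]] := hg p _ a hp hq' Ga pa qa.
    exact: (hh p q c hp hq Gc pc qc).
  - move=> g [Gg hg]; have Gv := subgroupV sG Gg; split=> // p q a hp hq Ga pa.
    move=> qa; have Gav := subgroupM sG Ga Gv.
    have [|c Gc [qc pc]] := hg q p _ hq hp Gav qa; last by exists c.
    by rewrite mulmxKV // (subgroup_unit sG Gg).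
have SSt : S `<=` St.
  move=> g Sg; split; first exact: sub_generated.
  move=> p q a hp hq Ga pa qag.
  have [F [[lF F1 GF] [s s0 Fs]]] := hS g Sg.
  have haF : mxfun laurent (fun x => a *m F x).
    by apply: mxfun_mul => //; [exact: laurent_alg|];
       apply: mxfun_const; exact: laurent_alg.
  have lp := polyfun_meval laurent_alg hp haF.
  have lq := polyfun_meval laurent_alg hq haF.
  have [||u [u0 pu qu]] := laurent_neq0 (s := 1) (t := s) lp lq (oner_neq0 _) s0.
  - by rewrite F1 mulmx1.
  - by rewrite Fs.
  by exists (a *m F u) => //; apply: (subgroupM sG) => //; apply: GF.
move=> p q a b hp hq Ga Gb pa qb.
have [_] : St (invmx a *m b).
  by apply: (generated_sub sSt SSt); apply: (subgroupM sG) => //; apply: (subgroupV sG).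
move=> /(_ p q a hp hq Ga pa); apply.
by rewrite mulmxA mulmxV ?(subgroup_unit sG Ga) // mul1mx.
Qed.

End Laurent.

(** * The Lie-Kolchin theorem *)

Section LieKolchin.
Variable K : closedFieldType.

(** Determinant 1 turns inversion into the adjugate, a polynomial map, so that polynomial functions
    suffice and no power of 1/det has to be carried along. Subgroups of E_6 have this property by
    [det_E6]. *)
Definition special n (B : set 'M[K]_n) : Prop := forall g, B g -> \det g = 1.

Lemma invmx_adj n (g : 'M[K]_n) : \det g = 1 -> invmx g = \adj g.
Proof.
by move=> dg; rewrite /invmx unitmxE dg unitr1 invr1 scale1r.
Qed.

Section Derived.
Variables (n : nat) (B : set 'M[K]_n).
Hypotheses (sB : subgroup B) (dB : special B).

Let commutators := [set g *m h *m invmx g *m invmx h | g in B & h in B].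

Let uC g : commutators g -> g \in unitmx.
Proof.
move=> [a Ba [b Bb <-]]; have ua := subgroup_unit sB Ba.
by have ub := subgroup_unit sB Bb; rewrite !unitmx_mul !unitmx_inv ua ub.
Qed.

Lemma derived_subgroup : subgroup (derived B).
Proof. exact: subgroup_generated. Qed.

Lemma commutator_derived g h : B g -> B h ->
  derived B (g *m h *m invmx g *m invmx h).
Proof. by move=> Bg Bh; apply: sub_generated; exists g => //; exists h. Qed.

Lemma derived_ind (A : set 'M[K]_n) : subgroup A ->
  (forall g h, B g -> B h -> A (g *m h *m invmx g *m invmx h)) ->
  derived B `<=` A.
Proof.
by move=> sA hA; apply: generated_sub => // _ [g Bg [h Bh <-]]; apply: hA.
Qed.

Lemma derived_sub : derived B `<=` B.
Proof.
apply: derived_ind => // g h Bg Bh; have BV := subgroupV sB.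
by apply: (subgroupM sB); [apply: (subgroupM sB)|];
   [apply: (subgroupM sB)| |]; rewrite ?BV //; apply: BV.
Qed.

Lemma derived_conj b d : B b -> derived B d -> derived B (b *m d *m invmx b).
Proof.
move=> Bb Dd; have Bd := derived_sub Dd.
have := subgroupM derived_subgroup (commutator_derived Bb Bd) Dd.
by rewrite mulmxKV // (subgroup_unit sB).
Qed.

(** For fixed g the commutators of g with x form a polynomial image of B, and x = 1 gives the
    identity. *)
Lemma derived_connected : zconnected B -> zconnected (derived B).
Proof.
move=> cB; apply: zconnected_generated => // _ [g Bg [h Bh <-]].
exists n, B, (fun x => g *m x *m \adj g *m \adj x); split => //.
- have hA := polyfun_alg K n; have hid := @polyfun_id K n.
  have hc (M : 'M[K]_n) := mxfun_const hA M.
  exact: (mxfun_mul hA (mxfun_mul hA (mxfun_mul hA (hc g) hid) (hc _))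
    (mxfun_adj hA hid)).
- move=> x Bx; rewrite -(invmx_adj (dB Bg)) -(invmx_adj (dB Bx)).
  exact: commutator_derived.
- exists 1%:M; first exact: subgroup1.
  rewrite -(invmx_adj (dB Bg)) -(invmx_adj (det1 K n)) invmx1 !mulmx1.
  by rewrite mulmxV ?(subgroup_unit sB).
- by exists h => //; rewrite -(invmx_adj (dB Bg)) -(invmx_adj (dB Bh)).
Qed.

End Derived.

Definition polyrep n m (B : set 'M[K]_n) (rho : 'M[K]_n -> 'M[K]_m) : Prop :=
  [/\ mxfun (@polyfun K n) rho, rho 1%:M = 1%:M &
      forall g h, B g -> B h -> rho (g *m h) = rho g *m rho h].

Lemma polyrep_sub n m (A B : set 'M[K]_n) (rho : 'M[K]_n -> 'M[K]_m) :
  A `<=` B -> polyrep B rho -> polyrep A rho.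
Proof. by move=> AB [h1 h2 h3]; split=> // g h /AB Bg /AB Bh; apply: h3. Qed.

Definition rep_stable n m k (B : set 'M[K]_n) (rho : 'M[K]_n -> 'M[K]_m)
  (S : 'M[K]_(k, m)) : Prop := forall b, B b -> (S *m rho b <= S)%MS.

Lemma polyrep_restrict n m k (B : set 'M[K]_n) (rho : 'M[K]_n -> 'M[K]_m)
    (S : 'M[K]_(k, m)) : polyrep B rho -> rep_stable B rho S ->
  let R := row_base S in
  polyrep B (fun g => R *m rho g *m pinvmx R) /\
  forall b, B b -> R *m rho b *m pinvmx R *m R = R *m rho b.
Proof.
move=> [hp r1 rM] st R.
have RK b : B b -> R *m rho b *m pinvmx R *m R = R *m rho b.
  move=> Bb; apply: mulmxKpV.
  by rewrite /R eq_row_base (eqmxMr _ (eq_row_base S)) st.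
have RI : R *m pinvmx R = 1%:M.
  apply: (row_free_inj (row_base_free S)).
  by rewrite mul1mx mulmxKpV.
split=> //; split.
- have hA := polyfun_alg K n.
  exact: (mxfun_mul hA (mxfun_mul hA (mxfun_const hA _) hp) (mxfun_const hA _)).
- by rewrite r1 mulmx1.
- by move=> g h Bg Bh; rewrite rM // [RHS]mulmxA [X in _ = X *m _]mulmxA RK //
    !mulmxA.
Qed.

Lemma polyrep_unit n m (B : set 'M[K]_n) (rho : 'M[K]_n -> 'M[K]_m) b :
  subgroup B -> polyrep B rho -> B b -> rho b *m rho (invmx b) = 1%:M.
Proof.
move=> sB [_ r1 rM] Bb; rewrite -rM ?mulmxV ?(subgroup_unit sB) //.
exact: (subgroupV sB).
Qed.

Definition rep_eigen n m (B : set 'M[K]_n) (rho : 'M[K]_n -> 'M[K]_m)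
  (v : 'rV[K]_m) : Prop :=
  v != 0 /\ forall b, B b -> exists c, v *m rho b = c *: v.

Lemma restrict_eigen n m k (B : set 'M[K]_n) (rho : 'M[K]_n -> 'M[K]_m)
    (S : 'M[K]_(k, m)) v : polyrep B rho -> rep_stable B rho S ->
  rep_eigen B (fun g => row_base S *m rho g *m pinvmx (row_base S)) v ->
  rep_eigen B rho (v *m row_base S).
Proof.
move=> hr st [v0 ev]; have [_ RK] := polyrep_restrict hr st; split.
  apply: contraNneq v0 => e; apply/eqP/(row_free_inj (row_base_free S)).
  by rewrite mul0mx.
move=> b Bb; have [c ec] := ev b Bb; exists c.
by rewrite -mulmxA -RK // mulmxA ec scalemxAl.
Qed.

Lemma exists_max_rank m (good : 'M[K]_m -> Prop) S0 : good S0 ->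
  exists2 S, good S & forall S', good S' -> (\rank S' <= \rank S)%N.
Proof.
move=> g0.
have [k [[S [gS kS]] mx]] : exists k, (exists S, good S /\ \rank S = k) /\
    forall S', good S' -> (\rank S' <= k)%N.
  have h : forall j, (exists k, (exists S, good S /\ \rank S = k) /\
      forall S', good S' -> (\rank S' <= k)%N) \/
      exists S, good S /\ (j <= \rank S)%N.
    elim=> [|j [IH|[S [gS jS]]]]; [by right; exists S0|by left|].
    have [[S' [gS' jS']]|nS'] := EM (exists S', good S' /\ (j < \rank S')%N).
      by right; exists S'.
    left; exists (\rank S); split; first by exists S.
    move=> S' gS'; rewrite leqNgt; apply/negP => lt; apply: nS'.
    by exists S'; split=> //; apply: leq_ltn_trans lt.
  case: (h m.+1) => // -[S [gS]]; rewrite ltnNge rank_leq_row //.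
by exists S => // S' gS'; rewrite kS mx.
Qed.

Section IrreducibleStep.
Variables (n m : nat) (B : set 'M[K]_n) (rho : 'M[K]_n -> 'M[K]_m).
Hypotheses (sB : subgroup B) (dB : special B) (cB : zconnected B).
Hypothesis hr : polyrep B rho.
Hypothesis irr : forall S : 'M[K]_m, S != 0 -> rep_stable B rho S ->
  row_full S.
Variable v0 : 'rV[K]_m.
Hypothesis ev0 : rep_eigen (derived B) rho v0.

Let v00 : v0 != 0 := ev0.1.
Let j : 'I_m := xchoose (elimT (rV0Pn _) v00).
Let chi (d : 'M[K]_n) : K := (v0 *m rho d) 0 j / v0 0 j.

Let v0j : v0 0 j != 0. Proof. exact: xchooseP (elimT (rV0Pn _) v00). Qed.

Let chiP d : derived B d -> v0 *m rho d = chi d *: v0.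
Proof.
move=> Dd; have [c ec] := ev0.2 d Dd.
by rewrite /chi ec mxE mulfK.
Qed.

Let chi_poly (F : 'M[K]_n -> 'M[K]_n) :
  mxfun (@polyfun K n) F -> polyfun (fun x => chi (F x)).
Proof.
move=> hF; have hA := polyfun_alg K n; have [hp _ _] := hr.
apply: fa_mul => //; last exact: fa_const.
by apply: (mxfun_mul hA (mxfun_const hA v0)); apply: polymap_comp hF.
Qed.

Let D_B : derived B `<=` B := derived_sub sB.

(** As b varies, the left side is a polynomial function whose values are eigenvalues of [rho d],
    since v0 rho(b) is an eigenvector for it. There are finitely many, so connectedness makes the
    function constant. *)
Let chi_conj b d : B b -> derived B d -> chi (b *m d *m invmx b) = chi d.
Proof.
move=> Bb Dd; have hA := polyfun_alg K n; have [_ _ rM] := hr.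
pose f b := chi (b *m d *m \adj b).
have hf : polyfun f.
  apply: chi_poly; apply: mxfun_mul => //; last first.
    by apply: mxfun_adj => //; apply: polyfun_id.
  by apply: mxfun_mul => //; [apply: polyfun_id|apply: mxfun_const].
have q0 : char_poly (rho d) != 0 by apply/monic_neq0/char_poly_monic.
have fB x : B x -> f x = chi (x *m d *m invmx x).
  by move=> Bx; rewrite invmx_adj ?dB.
have fq x : B x -> (char_poly (rho d)).[f x] = 0.
  move=> Bx; apply/eqP; rewrite -rootE -eigenvalue_root_char.
  apply/eigenvalueP; exists (v0 *m rho x).
    rewrite -mulmxA -rM //; last exact: D_B.
    have Dx := derived_conj sB Bx Dd.
    rewrite -[x *m d](mulmxKV (subgroup_unit sB Bx)) rM //; last exact: D_B.
    by rewrite mulmxA (chiP Dx) -scalemxAl fB.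
  apply: contraNneq v00 => e.
  by rewrite -[v0]mulmx1 -(polyrep_unit sB hr Bx) mulmxA e mul0mx.
have := zconnected_const cB hf q0 fq Bb (subgroup1 sB).
by rewrite !fB //; [rewrite invmx1 mulmx1 mul1mx|exact: subgroup1].
Qed.

(** The common eigenspace of the derived group for the character [chi] is stable under B because
    [chi] is invariant under conjugation; by irreducibility it is the whole space. It is obtained as
    a subspace of maximal rank. *)
Let rho_scalar d : derived B d -> rho d = (chi d)%:M.
Proof.
move=> Dd; have [_ _ rM] := hr.
pose good (S : 'M[K]_m) := forall d, derived B d -> S *m rho d = chi d *: S.
have [S gS mxS] : exists2 S, good S &
    forall S', good S' -> (\rank S' <= \rank S)%N.
  apply: (@exists_max_rank _ good (0 : 'M_m)) => x _.
  by rewrite mul0mx scaler0.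
have goodsub p (S' : 'M[K]_(p, m)) (A : 'M[K]_(p, m)) :
    (forall d, derived B d -> A *m rho d = chi d *: A) -> (A <= S)%MS.
  move=> gA; have gSA : good (S + A)%MS.
    move=> x Dx; have /submxP [C ->] : ((S + A)%MS <= col_mx S A)%MS.
      by rewrite addsmxE.
    by rewrite -mulmxA mul_col_mx gS // gA // -scale_col_mx scalemxAr.
  have := mxS _ gSA; have le : (S <= S + A)%MS by apply: addsmxSl.
  rewrite (geq_leqif (mxrank_leqif_sup le)) => le'.
  by apply: submx_trans le'; apply: addsmxSr.
have S0 : S != 0.
  apply: contraNneq v00 => e; rewrite -submx0 -e.
  by apply: goodsub => // x Dx; apply: chiP.
have stS : rep_stable B rho S.
  move=> b Bb; apply: goodsub => // x Dx.
  have Dx' := derived_conj sB Bb Dx.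
  rewrite -mulmxA -rM //; last exact: D_B.
  rewrite -[b *m x](mulmxKV (subgroup_unit sB Bb)) rM //; last exact: D_B.
  by rewrite mulmxA gS // chi_conj // scalemxAl.
have /row_fullP [C CS] := irr S0 stS.
by rewrite -[rho d]mul1mx -CS -mulmxA gS // -scalemxAr CS scalemx1.
Qed.

(** Commutators have determinant 1, so the scalar [chi d] is an m-th root of unity. The derived
    group is connected, hence [chi] is constant with value chi(1) = 1. *)
Let rho_derived d : (0 < m)%N -> derived B d -> rho d = 1%:M.
Proof.
move=> m0 Dd; have [_ r1 rM] := hr; have hA := polyfun_alg K n.
have chim x : derived B x -> chi x ^+ m = 1.
  move=> Dx; rewrite -det_scalar -rho_scalar //.
  pose A := [set g | B g /\ \det (rho g) = 1].
  have detV g : B g -> \det (rho g) * \det (rho (invmx g)) = 1.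
    by move=> Bg; rewrite -det_mulmx (polyrep_unit sB hr) // det1.
  have : A x; last by case.
  apply: (derived_ind _ _ Dx); first split.
  - by move=> g [/(subgroup_unit sB)].
  - by split; [exact: subgroup1|rewrite r1 det1].
  - move=> g h [Bg g1] [Bh h1]; split; first exact: subgroupM.
    by rewrite rM // det_mulmx g1 h1 mulr1.
  - move=> g [Bg g1]; split; first exact: subgroupV.
    by have := detV g Bg; rewrite g1 mul1r.
  - move=> g h Bg Bh; have Bg' := subgroupV sB Bg; have Bh' := subgroupV sB Bh.
    have Bgh := subgroupM sB Bg Bh; have Bghg := subgroupM sB Bgh Bg'.
    split; first exact: subgroupM.
    rewrite !rM // !det_mulmx -mulrA mulrACA.
    by rewrite !detV // mulr1.
pose q : {poly K} := 'X^m - 1.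
have q0 : q != 0.
  by rewrite -size_poly_eq0 size_XnsubC.
have hid := @polyfun_id K n.
have := zconnected_const (derived_connected sB dB cB) (chi_poly hid) q0 _ Dd
  (subgroup1 (derived_subgroup sB)).
rewrite rho_scalar // => ->.
  by rewrite /chi r1 mulmx1 divff.
by move=> x Dx; rewrite !hornerE chim // subrr.
Qed.

(** With the derived group acting trivially, [rho] has commuting values. An eigenspace of one
    [rho b] is then stable under B, hence everything, and each [rho b] is a scalar. *)
Lemma irreducible_eigen : (0 < m)%N -> exists v, rep_eigen B rho v.
Proof.
move=> m0; have [_ r1 rM] := hr; exists v0; split=> // b Bb.
have /closed_rootP [c] : size (char_poly (rho b)) != 1 by
  rewrite size_char_poly eqSS -lt0n.
rewrite -eigenvalue_root_char => /eigenvalueP [w wc w0].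
have /irr : eigenspace (rho b) c != 0.
  apply: contraNneq w0 => e; rewrite -submx0 -e.
  exact/eigenspaceP.
case/(_ _)/row_fullP => [x Bx|C CS].
  apply/eigenspaceP; have Bxb := subgroupM sB Bx Bb.
  have e : rho b *m rho x = rho x *m rho b.
    rewrite -!rM //; have Bbx := subgroupM sB Bb Bx.
    have Dc := commutator_derived Bb Bx.
    have -> : b *m x = (b *m x *m invmx b *m invmx x) *m (x *m b).
      have ub := subgroup_unit sB Bb; have ux := subgroup_unit sB Bx.
      by rewrite mulmxA mulmxKV // mulmxKV.
    by rewrite rM ?(rho_derived m0 Dc) ?mul1mx //; apply: D_B.
  rewrite -mulmxA -e mulmxA scalemxAl; congr (_ *m _).
  by apply/eigenspaceP.
exists c; rewrite -[rho b]mul1mx -CS -(mulmxA C).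
have /eigenspaceP -> := submx_refl (eigenspace (rho b) c).
by rewrite -scalemxAr CS -scalemxAr mulmx1.
Qed.

End IrreducibleStep.

(** Double induction, on the derived length and on the dimension of the module. A proper invariant
    subspace lowers the dimension; in the irreducible case the derived group has an eigenvector by
    induction. *)
Lemma lie_kolchin_full k n (B : set 'M[K]_n) : subgroup B -> special B ->
  zconnected B -> iter k (@derived K n) B = [set 1%:M] ->
  forall m (rho : 'M[K]_n -> 'M[K]_m), polyrep B rho -> (0 < m)%N ->
  exists v, rep_eigen B rho v.
Proof.
elim: k B => [|k IHk] B sB dB cB solB m rho hr m0.
  exists (const_mx 1); split.
    by apply/eqP => /matrixP /(_ 0 (Ordinal m0)) /eqP; rewrite !mxE oner_eq0.
  move=> b; rewrite (solB : B = _) => ->; exists 1.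
  by have [_ -> _] := hr; rewrite mulmx1 scale1r.
elim/ltn_ind: m rho hr m0 => m IHm rho hr m0.
have [[S [S0 Sm stS]]|irr] := EM (exists S : 'M[K]_m,
    [/\ S != 0, (\rank S < m)%N & rep_stable B rho S]).
  have [hr' _] := polyrep_restrict hr stS.
  have [|v ev] := IHm _ Sm _ hr'; first by rewrite lt0n mxrank_eq0.
  by exists (v *m row_base S); apply: restrict_eigen.
rewrite iterSr in solB.
have [v0 ev0] := IHk _ (derived_subgroup sB) (fun g Dg => dB g (derived_sub sB Dg))
  (derived_connected sB dB cB) solB m rho (polyrep_sub (derived_sub sB) hr) m0.
apply: (irreducible_eigen sB dB cB hr _ ev0 m0) => S S0 stS.
rewrite /row_full eqn_leq rank_leq_row leqNgt; apply/negP => Sm.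
by apply: irr; exists S.
Qed.

Theorem lie_kolchin n (B : set 'M[K]_n) m (rho : 'M[K]_n -> 'M[K]_m) k
    (S : 'M[K]_(k, m)) : subgroup B -> special B -> zconnected B ->
  solvable_grp B -> polyrep B rho -> S != 0 -> rep_stable B rho S ->
  exists2 v, rep_eigen B rho v & (v <= S)%MS.
Proof.
move=> sB dB cB [l solB] hr S0 stS.
have [hr' _] := polyrep_restrict hr stS.
have [|v ev] := lie_kolchin_full sB dB cB solB hr'.
  by rewrite lt0n mxrank_eq0.
exists (v *m row_base S); first exact: restrict_eigen.
by apply: mulmx_sub; rewrite eq_row_base.
Qed.

End LieKolchin.

(** * Root data and parabolic subgroups *)

Section GeneratedInduction.
Variables (K : fieldType) (n : nat) (S D : set 'M[K]_n).
Hypotheses (uS : forall g, S g -> g \in unitmx)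
  (SV : forall g, S g -> S (invmx g)) (D1 : D 1%:M).

Lemma generated_right_ind : (forall d g, D d -> S g -> D (d *m g)) ->
  generated S `<=` D.
Proof.
move=> DS g Sg.
pose A := [set g | g \in unitmx /\ forall d, D d -> D (d *m g) /\ D (d *m invmx g)].
have : A g; last by case=> _ /(_ _ D1); rewrite mul1mx; case.
apply: (generated_sub _ _ Sg); last first.
  move=> h Sh; split; first exact: uS.
  by move=> d Dd; split; apply: DS => //; apply: SV.
split.
- by move=> h [].
- by split=> [|d Dd]; rewrite ?unitmx1 ?invmx1 ?mulmx1.
- move=> h k [uh hh] [uk hk]; split=> [|d Dd]; first by rewrite unitmx_mul uh.
  rewrite invmxM // !mulmxA; split.
    by case: (hk _ (hh _ Dd).1).
  by case: (hh _ (hk _ Dd).2).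
- move=> h [uh hh]; split=> [|d Dd]; first by rewrite unitmx_inv.
  by rewrite invmxK; case: (hh _ Dd).
Qed.

Lemma generated_left_ind : (forall d g, D d -> S g -> D (g *m d)) ->
  generated S `<=` D.
Proof.
move=> DS g Sg.
pose A := [set g | g \in unitmx /\ forall d, D d -> D (g *m d) /\ D (invmx g *m d)].
have : A g; last by case=> _ /(_ _ D1); rewrite mulmx1; case.
apply: (generated_sub _ _ Sg); last first.
  move=> h Sh; split; first exact: uS.
  by move=> d Dd; split; apply: DS => //; apply: SV.
split.
- by move=> h [].
- by split=> [|d Dd]; rewrite ?unitmx1 ?invmx1 ?mul1mx.
- move=> h k [uh hh] [uk hk]; split=> [|d Dd]; first by rewrite unitmx_mul uh.
  rewrite invmxM // -!mulmxA; split.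
    by case: (hh _ (hk _ Dd).1).
  by case: (hk _ (hh _ Dd).2).
- move=> h [uh hh]; split=> [|d Dd]; first by rewrite unitmx_inv.
  by rewrite invmxK; case: (hh _ Dd).
Qed.

End GeneratedInduction.

Lemma subgroup_conj (K : fieldType) n (A : set 'M[K]_n) m : subgroup A ->
  m \in unitmx -> subgroup [set g | g \in unitmx /\ A (m *m g *m invmx m)].
Proof.
move=> sA um; split.
- by move=> g [].
- by rewrite /= mulmx1 mulmxV // unitmx1; split=> //; exact: (subgroup1 sA).
- move=> g h [ug Ag] [uh Ah]; split; first by rewrite unitmx_mul ug.
  have := subgroupM sA Ag Ah.
  by rewrite !mulmxA mulmxKV // -!mulmxA.
- move=> g [ug Ag]; split; first by rewrite unitmx_inv.
  have := subgroupV sA Ag.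
  by rewrite !invmxM ?unitmx_mul ?ug ?unitmx_inv ?um // invmxK mulmxA.
Qed.

(* A torus and root subgroups indexed by a root system: [rf] are the simple
   reflections, realised by the elements [rn], and [sg] the signs with which
   they permute the root subgroups. *)
Record root_datum (K : fieldType) (n : nat) (I : eqType) (T : set 'M[K]_n)
  (x : I -> K -> 'M[K]_n) (pos simple : pred I) (opp : I -> I)
  (rf : I -> I -> I) (sg : I -> I -> K) : Prop := RootDatum {
  rd_T : subgroup T;
  rd_0 : forall i, x i 0 = 1%:M;
  rd_D : forall i s t, x i (s + t) = x i s *m x i t;
  rd_t : forall i t, T t -> exists c, forall s, t *m x i s = x i (c * s) *m t;
  rd_opp : forall i, opp (opp i) = i;
  rd_pos : forall i, pos i -> ~~ pos (opp i);
  rd_simple : forall g, simple g -> pos g;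
  rd_sg : forall g i, simple g -> pos i || pos (opp i) ->
    sg g i = 1 \/ sg g i = -1;
  rd_sg_opp : forall g i, simple g -> pos i || pos (opp i) ->
    sg g (opp i) = sg g i;
  rd_rf_opp : forall g i, simple g -> pos i || pos (opp i) ->
    rf g (opp i) = opp (rf g i);
  rd_rfK : forall g i, simple g -> pos i || pos (opp i) -> rf g (rf g i) = i;
  rd_rf_simple : forall g, simple g -> rf g g = opp g;
  rd_rf_pos : forall g i, simple g -> pos i -> i != g -> pos (rf g i);
  rd_n : forall g i s, simple g -> pos i || pos (opp i) ->
    let m := x g 1 *m x (opp g) (-1) *m x g 1 in
    m *m x i s = x (rf g i) (sg g i * s) *m m;
  rd_nT : forall g t, simple g -> T t ->
    let m := x g 1 *m x (opp g) (-1) *m x g 1 in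
    exists2 t', T t' & m *m t = t' *m m;
  rd_n2 : forall g, simple g ->
    let m := x g 1 *m x (opp g) (-1) *m x g 1 in T (m *m m);
  rd_comm : forall g i s t, simple g -> pos i -> i != g ->
    exists j c, [/\ pos j, j != g & x g s *m x i t = x i t *m x j c *m x g s];
  rd_sl2 : forall g s, simple g -> s != 0 ->
    let m := x g 1 *m x (opp g) (-1) *m x g 1 in
    exists a t c, T t /\ m *m x g s = x g a *m t *m x (opp g) c }.

Section RootDatum.
Variables (K : fieldType) (n : nat) (I : eqType) (T : set 'M[K]_n)
  (x : I -> K -> 'M[K]_n) (pos simple : pred I) (opp : I -> I)
  (rf : I -> I -> I) (sg : I -> I -> K).

Definition rd_group : set 'M[K]_n := generated (T `|`
  [set g | exists i s, simple i /\ (g = x i s \/ g = x (opp i) s)]).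

Definition rd_borel : set 'M[K]_n :=
  generated (T `|` [set g | exists i s, pos i /\ g = x i s]).

Definition rd_parabolic (J : I -> Prop) : set 'M[K]_n :=
  generated (T `|` [set g | exists i s, pos i /\ g = x i s] `|`
    [set g | exists i s, [/\ simple i, J i & g = x (opp i) s]]).

Hypothesis rd : root_datum T x pos simple opp rf sg.

Let root i := pos i || pos (opp i).

Lemma rd_xV i s : x i s *m x i (- s) = 1%:M.
Proof. by rewrite -(rd_D rd) subrr (rd_0 rd). Qed.

Lemma rd_x_unit i s : x i s \in unitmx.
Proof. by case/mulmx1_unit: (rd_xV i s). Qed.

Lemma rd_invx i s : invmx (x i s) = x i (- s).
Proof. by rewrite -[RHS](mulKmx (rd_x_unit i s)) rd_xV mulmx1. Qed.

Let T_unit t : T t -> t \in unitmx. Proof. exact: subgroup_unit (rd_T rd). Qed.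

Lemma rd_group_unit g : (T `|` [set g | exists i s, simple i /\
   (g = x i s \/ g = x (opp i) s)]) g -> g \in unitmx.
Proof. by case=> [/T_unit //|[i [s [_ [->|->]]]]]; apply: rd_x_unit. Qed.

Lemma rd_borel_unit g :
  (T `|` [set g | exists i s, pos i /\ g = x i s]) g -> g \in unitmx.
Proof. by case=> [/T_unit //|[i [s [_ ->]]]]; apply: rd_x_unit. Qed.

Lemma rd_parabolic_unit J g : (T `|` [set g | exists i s, pos i /\ g = x i s]
  `|` [set g | exists i s, [/\ simple i, J i & g = x (opp i) s]]) g ->
  g \in unitmx.
Proof.
by case=> [/rd_borel_unit //|[i [s [_ _ ->]]]]; apply: rd_x_unit.
Qed.

Lemma rd_group_subgroup : subgroup rd_group.
Proof. by apply: subgroup_generated; apply: rd_group_unit. Qed.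

Lemma rd_borel_subgroup : subgroup rd_borel.
Proof. by apply: subgroup_generated; apply: rd_borel_unit. Qed.

Lemma rd_parabolic_subgroup J : subgroup (rd_parabolic J).
Proof. by apply: subgroup_generated; apply: rd_parabolic_unit. Qed.

Lemma rd_borelT t : T t -> rd_borel t.
Proof. by move=> Tt; apply: sub_generated; left. Qed.

Lemma rd_borelx i s : pos i -> rd_borel (x i s).
Proof. by move=> pi; apply: sub_generated; right; exists i, s. Qed.

Definition rd_refl g : 'M[K]_n := x g 1 *m x (opp g) (-1) *m x g 1.

Definition rd_word (w : seq I) : 'M[K]_n :=
  foldr (fun g m => rd_refl g *m m) 1%:M w.

Lemma rd_refl_unit g : rd_refl g \in unitmx.
Proof. by rewrite !unitmx_mul !rd_x_unit. Qed.

Lemma rd_word_cat u w : rd_word (u ++ w) = rd_word u *m rd_word w.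
Proof. by elim: u => [|g u IH] /=; rewrite ?mul1mx // IH mulmxA. Qed.

Let root_rf g i : simple g -> root i -> root (rf g i).
Proof.
move=> Sg ri; have pg := rd_simple rd Sg; have [e|ne] := eqVneq i g.
  by rewrite e (rd_rf_simple rd) // /root (rd_opp rd) pg orbT.
have [e|ne'] := eqVneq i (opp g).
  rewrite e (rd_rf_opp rd) ?pg //.
  by rewrite (rd_rf_simple rd) // (rd_opp rd) /root pg.
case/orP: (ri) => [pi|pi]; rewrite /root.
  by rewrite (rd_rf_pos rd).
have := rd_rf_pos rd Sg pi; rewrite (rd_rf_opp rd) // => -> //.
  by rewrite orbT.
by apply: contraNneq ne' => <-; rewrite (rd_opp rd).
Qed.

Let root_opp i : root i -> root (opp i).
Proof. by rewrite /root (rd_opp rd) orbC. Qed.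

(** The same sign e serves a root and its opposite. This lets a word be moved past a whole product
    [rd_refl], as is needed in [rd_exchange]. *)
Lemma rd_word_act w i : all simple w -> root i -> exists e,
  [/\ e = 1 \/ e = -1, root (foldr rf i w),
      forall s, rd_word w *m x i s = x (foldr rf i w) (e * s) *m rd_word w &
      forall s, rd_word w *m x (opp i) s =
        x (opp (foldr rf i w)) (e * s) *m rd_word w].
Proof.
elim: w => [|g w IH] /= => [_ ri|/andP [Sg Sw] ri].
  by exists 1; split; rewrite ?mul1r; auto; move=> s; rewrite mul1r mulmx1 mul1mx.
have [e [he rw h1 h2]] := IH Sw ri; set j := foldr rf i w in rw h1 h2 *.
exists (sg g j * e); split; last 2 first.
- by move=> s; rewrite -mulmxA h1 mulmxA (rd_n rd) // -mulmxA mulrA.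
- move=> s; rewrite -mulmxA h2 mulmxA (rd_n rd) //; last exact: root_opp.
  by rewrite (rd_rf_opp rd) // (rd_sg_opp rd) // -mulmxA mulrA.
- case: (rd_sg rd Sg rw) => ->; rewrite ?mul1r ?mulN1r //.
  by case: he => ->; rewrite ?opprK; auto.
- exact: root_rf.
Qed.

Lemma rd_word_actV w i : all simple w -> root i -> exists e,
  [/\ e = 1 \/ e = -1, root (foldl (fun j g => rf g j) i w),
      forall s, x i s *m rd_word w =
        rd_word w *m x (foldl (fun j g => rf g j) i w) (e * s) &
      forall s, x (opp i) s *m rd_word w =
        rd_word w *m x (opp (foldl (fun j g => rf g j) i w)) (e * s)].
Proof.
elim: w i => [|g w IH] i /= => [_ ri|/andP [Sg Sw] ri].
  by exists 1; split; rewrite ?mul1r; auto; move=> s; rewrite mul1r mulmx1 mul1mx.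
have rj := root_rf Sg ri.
have [e [he rw h1 h2]] := IH _ Sw rj; set j := foldl _ _ _ in rw h1 h2 *.
pose c := sg g (rf g i); have hc : c = 1 \/ c = -1 by apply: (rd_sg rd Sg rj).
have cc : c * c = 1 by case: hc => ->; rewrite ?mulrNN mulr1.
exists (e * c); split=> //.
- by case: he => ->; case: hc => ->; rewrite ?mulrNN ?mulr1 ?mul1r; auto.
- move=> s; have := rd_n rd (c * s) Sg rj.
  rewrite /= (rd_rfK rd) // -/c mulrA cc mul1r => E.
  by rewrite mulmxA -E -mulmxA h1 mulmxA mulrA.
- move=> s; have := rd_n rd (c * s) Sg (root_opp rj).
  rewrite /= (rd_rf_opp rd) // (rd_rfK rd) // (rd_sg_opp rd) // -/c.
  by rewrite mulrA cc mul1r => E; rewrite mulmxA -E -mulmxA h2 mulmxA mulrA.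
Qed.

Let B := rd_borel.
Let sB := rd_borel_subgroup.

(* B = B' X_g where B' is generated by T and the other positive root subgroups,
   and B' is moved into B by the reflection in g. *)
Lemma rd_borel_split g b : simple g -> B b -> exists b' s,
  [/\ B b', exists2 b'', B b'' & rd_refl g *m b' = b'' *m rd_refl g &
      b = b' *m x g s].
Proof.
move=> Sg Bb.
pose S' := T `|` [set h | exists i s, [/\ pos i, i != g & h = x i s]].
have uS' h : S' h -> h \in unitmx.
  by case=> [/T_unit //|[i [s [_ _ ->]]]]; apply: rd_x_unit.
have sB' := subgroup_generated uS'.
have : exists b' s, generated S' b' /\ b = b' *m x g s.
  apply: (generated_right_ind (D := [set b | exists b' s, generated S' b' /\
    b = b' *m x g s]) rd_borel_unit _ _ _ Bb).
  - move=> h [Th|[i [s [pi ->]]]]; [left; exact: (subgroupV (rd_T rd))|right].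
    by exists i, (- s); rewrite rd_invx.
  - by exists 1%:M, 0; rewrite (rd_0 rd) mulmx1; split=> //; apply: subgroup1.
  - move=> _ h [b' [s [Bb' ->]]] [Th|[i [r [pi ->]]]].
      have [c ec] := rd_t rd g (subgroupV (rd_T rd) Th).
      exists (b' *m h), (c * s); split.
        by apply: (subgroupM sB') => //; apply: sub_generated; left.
      have uh := T_unit Th.
      have E : x g s *m h = h *m x g (c * s).
        by rewrite -[LHS](mulKVmx uh) (mulmxA (invmx h)) ec mulmxKV.
      by rewrite -!mulmxA E.
    have [->|ne] := eqVneq i g.
      by exists b', (s + r); rewrite (rd_D rd) mulmxA.
    have [j [c [pj nj e]]] := rd_comm rd s r Sg pi ne.
    exists (b' *m (x i r *m x j c)), s; split; last first.
      by rewrite -!mulmxA e -!mulmxA.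
    do 2 apply: (subgroupM sB') => //; apply: sub_generated; right;
      by [exists i, r|exists j, c].
move=> [b' [s [Bb' eb]]]; exists b', s; split=> //.
  apply: (generated_sub sB _ Bb') => h [Th|[i [r [pi _ ->]]]].
    exact: rd_borelT.
  exact: rd_borelx.
have := generated_sub (subgroup_conj sB (rd_refl_unit g)) _ Bb'.
case=> [h S'h|ub' Bc]; last first.
  by exists (rd_refl g *m b' *m invmx (rd_refl g)) => //; rewrite mulmxKV //
    rd_refl_unit.
split; first exact: uS'.
case: S'h => [Th|[i [r [pi ne ->]]]].
  have [t' Tt' e] := rd_nT rd Sg Th; rewrite /rd_refl e mulmxK ?rd_refl_unit //.
  exact: rd_borelT.
rewrite /rd_refl (rd_n rd) ?pi // mulmxK ?rd_refl_unit //.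
by apply: rd_borelx; apply: (rd_rf_pos rd).
Qed.

(** B W B is stable under left multiplication by the generators. For a reflection, only the factor
    x_h(s) of b in front of the word matters: either w turns h into a positive root and x_h(s) moves
    to the right into B, or the rank one identity [rd_sl2] absorbs the reflection and leaves an
    element of the opposite root group, which w moves into B. *)
Lemma bruhat g : rd_group g -> exists b w b',
  [/\ B b, B b', all simple w & g = b *m rd_word w *m b'].
Proof.
pose C := [set g | exists b w b',
  [/\ B b, B b', all simple w & g = b *m rd_word w *m b']].
have CB b c : B b -> C c -> C (b *m c).
  move=> Bb [b1 [w [b2 [B1 B2 Sw ->]]]]; exists (b *m b1), w, b2.
  by split=> //; rewrite ?mulmxA //; apply: (subgroupM sB).
have Cn h c : simple h -> C c -> C (rd_refl h *m c).
  move=> Sh [b1 [w [b2 [B1 B2 Sw ->]]]].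
  have [b' [s [Bb' [b'' Bb'' e] ->]]] := rd_borel_split Sh B1.
  have rh : root h by rewrite /root (rd_simple rd).
  rewrite !mulmxA e.
  have [e' [_ rw h1 h2]] := rd_word_actV Sw rh.
  set j := foldl _ _ _ in rw h1 h2.
  have case1 u b3 : B b3 -> u = b3 ->
      C (b'' *m rd_refl h *m rd_word w *m u *m b2).
    move=> B3 ->; exists b'', (h :: w), (b3 *m b2).
    by split=> //=; rewrite ?Sh // ?mulmxA //; apply: (subgroupM sB).
  case/orP: rw => pj.
    rewrite -(mulmxA _ (x h s)) h1 mulmxA.
    exact: (case1 _ _ (rd_borelx _ pj)).
  have [->|s0] := eqVneq s 0.
    rewrite (rd_0 rd) mulmx1 -[_ *m rd_word w]mulmx1.
    exact: (case1 _ _ (subgroup1 sB)).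
  have [a [t [c0 [Tt e2]]]] := rd_sl2 rd Sh s0.
  rewrite -(mulmxA b'') /rd_refl e2.
  exists (b'' *m (x h a *m t)), w, (x (opp j) (e' * c0) *m b2); split=> //.
  - apply: (subgroupM sB) => //; apply: (subgroupM sB).
      by apply: rd_borelx; apply: (rd_simple rd).
    exact: rd_borelT.
  - by apply: (subgroupM sB) => //; apply: rd_borelx.
  - by rewrite !mulmxA -(mulmxA _ (x (opp h) c0)) h2 !mulmxA.
apply: (generated_left_ind (D := C) rd_group_unit).
- move=> h [Th|[i [s [Si h2]]]]; [left; exact: (subgroupV (rd_T rd))|right].
  by exists i, (- s); split=> //; case: h2 => ->; rewrite rd_invx; auto.
- by exists 1%:M, [::], 1%:M; split; rewrite //= ?mulmx1 //; exact: (subgroup1 sB).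
move=> c h Cc [Th|[i [s [Si [->|->]]]]].
- by apply: (CB) => //; apply: rd_borelT.
- by apply: (CB) => //; apply: rd_borelx; apply: (rd_simple rd).
have ri : root i by rewrite /root (rd_simple rd).
have cc : sg i i * sg i i = 1.
  by case: (rd_sg rd Si ri) => ->; rewrite ?mulrNN mulr1.
(* An opposite root element is a conjugate of a positive one by the reflection n, and n^-1 =
   (n^2)^-1 n with n^2 in T. *)
have -> : x (opp i) s = rd_refl i *m x i (sg i i * s) *m
    (invmx (rd_refl i *m rd_refl i) *m rd_refl i).
  have E : rd_refl i *m x i (sg i i * s) = x (opp i) s *m rd_refl i.
    have := rd_n rd (sg i i * s) Si ri.
    by rewrite /= mulrA cc mul1r (rd_rf_simple rd).
  rewrite E; move: (rd_refl_unit i); move: (rd_refl i) => m um.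
  by rewrite invmxM // !mulmxA mulmxK // mulmxKV.
have assoc (a b v d : 'M[K]_n) : a *m b *m (v *m a) *m d =
  a *m (b *m (v *m (a *m d))) by rewrite !mulmxA.
rewrite assoc; apply: (Cn) => //; apply: (CB).
  by apply: rd_borelx; apply: (rd_simple rd).
apply: (CB); last exact: (Cn).
by apply: rd_borelT; apply: (subgroupV (rd_T rd)); apply: (rd_n2 rd).
Qed.

(** The exchange condition, up to a factor in T. Reading the word from the right, the image of g
    becomes negative at some letter d; at that place it equals d, and the letter cancels against
    g. *)
Lemma rd_exchange w g : all simple w -> simple g -> pos (opp (foldr rf g w)) ->
  exists w' t, [/\ all simple w', T t, (size w' <= size w)%N &
    rd_word w *m rd_refl g = t *m rd_word w'].
Proof.
elim: w => [|d u IH] /= => [_ Sg|/andP [Sd Su] Sg].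
  by move=> pg; have := rd_pos rd (rd_simple rd Sg); rewrite pg.
move=> pj; have rg : root g by rewrite /root (rd_simple rd).
have [e [he rj h1 h2]] := rd_word_act Su rg; set j := foldr rf g u in rj pj h1 h2.
case/orP: (rj) => pos_j; last first.
  have [w' [t [Sw' Tt sw' ew']]] := IH Su Sg pos_j.
  have [t' Tt' et] := rd_nT rd Sd Tt.
  exists (d :: w'), t'; rewrite /= Sd; split=> //.
  rewrite -(mulmxA (rd_refl d)) ew' (mulmxA (rd_refl d)) (mulmxA t').
  by congr (_ *m _).
(* A simple reflection makes no positive root negative except its own. *)
have jd : j = d.
  apply/eqP/negPn/negP => ne; have := rd_pos rd (rd_rf_pos rd Sd pos_j ne).
  by rewrite pj.
have eu : rd_word u *m rd_refl g =
    x d (e * 1) *m x (opp d) (e * -1) *m x d (e * 1) *m rd_word u.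
  by rewrite /rd_refl !mulmxA h1 -(mulmxA _ (rd_word u)) h2 mulmxA
    -(mulmxA _ (rd_word u)) h1 jd !mulmxA.
exists u; case: he => he.
  exists (rd_refl d *m rd_refl d); split=> //; first exact: (rd_n2 rd).
  by rewrite -(mulmxA (rd_refl d) (rd_word u)) eu he !mul1r !mulmxA.
exists 1%:M; split=> //; first exact: (subgroup1 (rd_T rd)).
rewrite -(mulmxA (rd_refl d) (rd_word u)) eu he !mulN1r opprK !mulmxA mul1mx.
have xV i : x i (-1) *m x i 1 = 1%:M.
  by rewrite -(rd_D rd) addNr (rd_0 rd).
have cancel (a b c a' b' e' : 'M[K]_n) : a *m a' = 1%:M -> b *m b' = 1%:M ->
    c *m e' = 1%:M -> c *m b *m a *m a' *m b' *m e' = 1%:M.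
  move=> h3 h4 h5; rewrite -(mulmxA _ a) h3 mulmx1 -(mulmxA _ b) h4 mulmx1.
  by rewrite h5.
rewrite (cancel (x d 1) (x (opp d) (-1)) (x d 1)) ?mul1mx ?xV ?rd_xV //.
Qed.

(** By the Bruhat decomposition only Weyl words lying in P have to be treated. The last letter g of
    such a word is removed: if the rest sends g to a negative root, by the exchange condition;
    otherwise P turns out to contain the opposite root group of g, hence the reflection itself. *)
Theorem overgroup_parabolic (P : set 'M[K]_n) : subgroup P ->
  P `<=` rd_group -> rd_borel `<=` P ->
  P = rd_parabolic (fun g => forall s, P (x (opp g) s)).
Proof.
move=> sP PG BP; set J := fun g => _; have sQ := rd_parabolic_subgroup J.
have BQ : rd_borel `<=` rd_parabolic J.
  apply: generated_gen_sub; first exact: rd_parabolic_unit.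
  by move=> g h; apply: sub_generated; left.
apply/seteqP; split; last first.
  apply: generated_sub => // g [h|[i [s [Si Ji ->]]]]; last exact: Ji.
  by apply: BP; apply: sub_generated.
have wQ k w : (size w <= k)%N -> all simple w -> P (rd_word w) ->
    rd_parabolic J (rd_word w).
  elim: k w => [|k IH] w; first by case: w => // _ _ _; apply: (subgroup1 sQ).
  case/lastP: w => [|w g]; first by move=> _ _ _; apply: (subgroup1 sQ).
  rewrite size_rcons ltnS all_rcons => sw /andP [Sg Sw].
  rewrite -cats1 rd_word_cat /= mulmx1 => Pw.
  have rg : root g by rewrite /root (rd_simple rd).
  have [e [he rj h1 h2]] := rd_word_act Sw rg; set j := foldr rf g w in rj h1 h2.
  case/orP: rj => pj; last first.
    have [w' [t [Sw' Tt sw' ew']]] := rd_exchange Sw Sg pj.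
    have Bt := rd_borelT Tt.
    rewrite ew'; apply: (subgroupM sQ); first exact: BQ.
    apply: IH => //; first exact: leq_trans sw.
    by apply: (subgroupMl sP (BP _ Bt)); rewrite -ew'.
  (* The word sends the opposite of g to a positive root, so it conjugates the opposite root group
     into B. *)
  have Jg : J g.
    move=> s; have := rd_n rd s Sg (root_opp rg).
    rewrite -/(rd_refl g) (rd_rf_opp rd) // (rd_rf_simple rd) // (rd_opp rd).
    set c := sg _ _ * s => ec; apply: (subgroupMl sP Pw).
    rewrite -mulmxA ec mulmxA h1 -mulmxA; apply: (subgroupM sP) => //.
    by apply: BP; apply: rd_borelx.
  have Qx s : rd_parabolic J (x g s).
    by apply: BQ; apply: rd_borelx; apply: (rd_simple rd).
  have Qy s : rd_parabolic J (x (opp g) s).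
    by apply: sub_generated; right; exists g, s.
  have Qg : rd_parabolic J (rd_refl g).
    by do 2?apply: (subgroupM sQ).
  have Pg : P (rd_refl g).
    have Px s : P (x g s).
      by apply: BP; apply: rd_borelx; apply: (rd_simple rd).
    by do 2?apply: (subgroupM sP) => //; apply: Jg.
  apply: (subgroupM sQ) => //; apply: IH => //.
  exact: (subgroupMr sP Pg).
move=> p Pp; have [b [w [b' [Bb Bb' Sw ep]]]] := bruhat (PG _ Pp).
rewrite ep; apply: (subgroupM sQ); last exact: BQ.
apply: (subgroupM sQ); first exact: BQ.
apply: (wQ (size w)) => //.
apply: (subgroupMl sP (BP _ Bb)); apply: (subgroupMr sP (BP _ Bb')).
by rewrite -ep.
Qed.

End RootDatum.

(** * The root vectors of E6 *)

Section SparseMatrices.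

(* Integer matrices as lists of entries (row, column, value); repeated
   positions are added up. *)
Definition spmx := seq (nat * nat * BinNums.Z).

Fixpoint scoef (l : spmx) (a b : nat) : BinNums.Z :=
  if l is (a', b', z) :: l' then
    if (a' == a) && (b' == b) then BinInt.Z.add z (scoef l' a b)
    else scoef l' a b
  else BinNums.Z0.

Definition sscale (c : BinNums.Z) (l : spmx) : spmx :=
  [seq (e.1, BinInt.Z.mul c e.2) | e <- l].

Definition sneg (l : spmx) : spmx := sscale (BinNums.Zneg BinNums.xH) l.

(** The bound n is the inner dimension: entries with a larger column index do not belong to the
    matrix represented and must not contribute. *)
Definition smul (n : nat) (l l' : spmx) : spmx :=
  flatten [seq (if (e.1.2 < n)%N then
    [seq (e.1.1, e'.1.2, BinInt.Z.mul e.2 e'.2) | e' <- l' & e'.1.1 == e.1.2]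
    else [::]) | e <- l].

Definition str (l : spmx) : spmx := [seq (e.1.2, e.1.1, e.2) | e <- l].

Definition sone (n : nat) : spmx := [seq (k, k, BinNums.Zpos BinNums.xH) | k <- iota 0 n].

Definition sunit (a b : nat) : spmx := [:: (a, b, BinNums.Zpos BinNums.xH)].

Definition szero (l : spmx) : bool :=
  all (fun e => BinInt.Z.eqb (scoef l e.1.1 e.1.2) BinNums.Z0) l.

Definition seqv (l l' : spmx) : bool := szero (l ++ sneg l').

Fixpoint sinsert (e : nat * nat * BinNums.Z) (l : spmx) : spmx :=
  if l is e' :: l' then
    if e.1 == e'.1 then (e'.1, BinInt.Z.add e.2 e'.2) :: l' else e' :: sinsert e l'
  else [:: e].

(** A sum in which entries at the same position are combined. Unlike concatenation, it keeps the
    lists short when many root elements are applied in a row. *)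
Definition smerge (l l' : spmx) : spmx := foldr sinsert l l'.

Variable K : comNzRingType.

(** Tables are computed over the binary integers; [zr] carries the resulting identities to K. *)
Definition zr (z : BinNums.Z) : K := (ssrZ.int_of_Z z)%:~R.

Lemma zr0 : zr BinNums.Z0 = 0. Proof. by []. Qed.
Lemma zr1 : zr (BinNums.Zpos BinNums.xH) = 1. Proof. by []. Qed.

Lemma zrD x y : zr (BinInt.Z.add x y) = zr x + zr y.
Proof. by rewrite /zr -[BinInt.Z.add x y]/(x + y) !rmorphD. Qed.

Lemma zrM x y : zr (BinInt.Z.mul x y) = zr x * zr y.
Proof. by rewrite /zr -[BinInt.Z.mul x y]/(x * y) !rmorphM. Qed.

Lemma zrN x : zr (BinInt.Z.opp x) = - zr x.
Proof. by rewrite /zr -[BinInt.Z.opp x]/(- x) !rmorphN. Qed.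

Definition imx m n (l : spmx) : 'M[K]_(m, n) := \matrix_(a, b) zr (scoef l a b).

Lemma imx_nil m n : imx m n [::] = 0.
Proof. by apply/matrixP => a b; rewrite !mxE. Qed.

Lemma scoef_cat l l' a b :
  scoef (l ++ l') a b = BinInt.Z.add (scoef l a b) (scoef l' a b).
Proof.
elim: l => [|[[a' b'] z] l IH] //=.
by case: ifP => _; rewrite IH // BinInt.Z.add_assoc.
Qed.

Lemma imx_cat m n l l' : imx m n (l ++ l') = imx m n l + imx m n l'.
Proof. by apply/matrixP => a b; rewrite !mxE scoef_cat zrD. Qed.

Lemma scoef_scale c l a b : scoef (sscale c l) a b = BinInt.Z.mul c (scoef l a b).
Proof.
elim: l => [|[[a' b'] z] l IH] /=; first by rewrite BinInt.Z.mul_0_r.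
by rewrite IH; case: ifP => // _; rewrite BinInt.Z.mul_add_distr_l.
Qed.

Lemma imx_scale m n c l : imx m n (sscale c l) = zr c *: imx m n l.
Proof. by apply/matrixP => a b; rewrite !mxE scoef_scale zrM. Qed.

Lemma imx_neg m n l : imx m n (sneg l) = - imx m n l.
Proof. by rewrite imx_scale scaleN1r. Qed.

Lemma imx_tr m n l : imx m n (str l) = (imx n m l)^T.
Proof.
apply/matrixP => a b; rewrite !mxE; congr zr.
by elim: l => [|[[a' b'] z] l IH] //=; rewrite IH andbC.
Qed.

Lemma imx_cons m n a b z l : imx m n ((a, b, z) :: l) =
  \matrix_(i, j) (if (a == i :> nat) && (b == j :> nat) then zr z else 0)
    + imx m n l.
Proof.
apply/matrixP => i j; rewrite !mxE /=.
by case: ifP => _; rewrite ?zrD ?add0r.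
Qed.

Lemma imx_mul m n p l l' : imx m p (smul n l l') = imx m n l *m imx n p l'.
Proof.
elim: l => [|[[a b] z] l IH].
  by rewrite !imx_nil mul0mx.
rewrite imx_cons mulmxDl -IH /smul /= imx_cat; congr (_ + _).
apply/matrixP => i j; rewrite !mxE.
case: ifP => [bn|/negbT nb]; last first.
  rewrite big1 // => k _; rewrite !mxE; case: ifP; rewrite ?mul0r //.
  by move=> /andP [_ /eqP bk]; move: nb; rewrite bk ltn_ord.
rewrite (bigD1 (Ordinal bn)) //= big1 => [|k ne]; last first.
  rewrite mxE; case: ifP; rewrite ?mul0r // => /andP [_ /eqP bk].
  by case/eqP: ne; apply/val_inj; rewrite /= bk.
rewrite !mxE /= eqxx andbT addr0.
case: (eqVneq a i) => [->|ne]; last first.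
  rewrite mul0r; elim: l' {IH} => //= -[[c d] y] l'' IH.
  by case: ifP => _ //=; rewrite (negbTE ne).
rewrite -zrM; congr zr; elim: l' {IH} => [|[[c d] y] l'' IH] /=.
  by rewrite BinInt.Z.mul_0_r.
case: (c == b); rewrite /= ?eqxx /= IH //; case: ifP => // _.
by rewrite BinInt.Z.mul_add_distr_l.
Qed.

Lemma scoef_insert e l a b : scoef (sinsert e l) a b = scoef (e :: l) a b.
Proof.
case: e => [[a1 b1] z]; elim: l => [//|[[a2 b2] z2] l IH] /=.
case: eqP => [[-> ->]|_] /=; first by case: ifP => // _; rewrite BinInt.Z.add_assoc.
rewrite IH /=; case: ifP => _; case: ifP => // _.
by rewrite !BinInt.Z.add_assoc [X in BinInt.Z.add X _]BinInt.Z.add_comm.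
Qed.

Lemma imx_merge m n l l' : imx m n (smerge l l') = imx m n l + imx m n l'.
Proof.
elim: l' => [|e l' IH]; first by rewrite imx_nil addr0.
apply/matrixP => i j; rewrite mxE scoef_insert /=.
move/matrixP: IH => /(_ i j); rewrite !mxE.
case: e => [[a b] z] /=; case: ifP => _ e //.
by rewrite !zrD e addrCA.
Qed.

Lemma scoef_notin l a b : (a, b) \notin [seq e.1 | e <- l] -> scoef l a b = BinNums.Z0.
Proof.
elim: l => //= -[[a' b'] z] l IH; rewrite inE negb_or => /andP [ne /IH ->].
by move: ne; rewrite xpair_eqE eq_sym [b == _]eq_sym => /negbTE ->.
Qed.

Lemma szeroP l : szero l -> forall a b, scoef l a b = BinNums.Z0.
Proof.
move=> /allP h a b.
have [/mapP [[[a' b'] z] le [-> ->]]|] := boolP ((a, b) \in [seq e.1 | e <- l]).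
  by move/BinInt.Z.eqb_spec: (h _ le).
exact: scoef_notin.
Qed.

Lemma imx_szero m n l : szero l -> imx m n l = 0.
Proof. by move=> /szeroP h; apply/matrixP => a b; rewrite !mxE h. Qed.

Lemma imx_seqv m n l l' : seqv l l' -> imx m n l = imx m n l'.
Proof.
move=> /(imx_szero m n); rewrite imx_cat imx_neg => /eqP.
by rewrite subr_eq0 => /eqP.
Qed.

Lemma scoef_one n a b : (a < n)%N ->
  scoef (sone n) a b = if a == b then BinNums.Zpos BinNums.xH else BinNums.Z0.
Proof.
have gen m : scoef [seq (k, k, BinNums.Zpos BinNums.xH) | k <- iota m n] a b =
    if (a == b) && (m <= a < m + n)%N then BinNums.Zpos BinNums.xH
    else BinNums.Z0.
  elim: n m => [|n IH] m /=.
    by rewrite addn0 [(a < m)%N]ltnNge andbN andbF.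
  rewrite IH; case: (eqVneq m a) => [->|ma] /=.
    rewrite leqnn -addSnnS leq_addr ltnn /= andbF andbT.
    by case: (a == b).
  by rewrite addSnnS [(m <= a)%N]leq_eqVlt (negbTE ma).
by move=> an; rewrite /sone gen an /= andbT.
Qed.

Lemma imx_one n : imx n n (sone n) = 1%:M.
Proof.
apply/matrixP => a b; rewrite !mxE scoef_one ?ltn_ord // -val_eqE /=.
by case: eqP.
Qed.

Lemma imx_unit m n (a : 'I_m) (b : 'I_n) : imx m n (sunit a b) = delta_mx a b.
Proof.
apply/matrixP => i j; rewrite !mxE /= (eq_sym i) (eq_sym j) -!val_eqE.
by case: ifP.
Qed.

End SparseMatrices.

(** * Tables of roots, root vectors and structure constants *)

Section RootTables.

Definition wtab : seq (seq int) := Eval vm_compute in E6_weights.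

Lemma wtabE : E6_weights = wtab. Proof. by vm_compute. Qed.

Definition stab (i : nat) : spmx :=
  [seq (a, b, BinNums.Zpos BinNums.xH) | a <- iota 0 27,
     b <- [seq b <- iota 0 27 | nth [::] wtab b == sub_simple_root (nth [::] wtab a) i]].

Definition simple_vec (i : nat) : seq int := mkseq (fun j => (j == i)%:Z) 6.

Definition vadd (u v : seq int) : seq int := mkseq (fun j => u`_j + v`_j) 6.
Definition vopp (u : seq int) : seq int := mkseq (fun j => - u`_j) 6.

Definition vpair (u v : seq int) : int :=
  foldr (fun i s => foldr (fun j s' => u`_i * v`_j * E6_cartan i j + s') s
    (iota 0 6)) 0 (iota 0 6).

(** In a simply laced system, adding a simple root to a positive root gives a root exactly when
    their pairing is -1. The highest root has height 11, whence the eleven layers of [pos_table]. *)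
Definition next_roots (L : seq (seq int * spmx)) : seq (seq int * spmx) :=
  foldl (fun acc r => if r.1 \in [seq q.1 | q <- acc] then acc else rcons acc r)
    [::] [seq (vadd (simple_vec i) r.1,
       smul 27 (stab i) r.2 ++ sneg (smul 27 r.2 (stab i))) | r <- L,
       i <- [seq i <- iota 0 6 | vpair r.1 (simple_vec i) == -1]].

(* The positive roots by increasing height, each with a root vector obtained by
   iterated commutators of the e_i. *)
Definition pos_table : seq (seq int * spmx) := Eval vm_compute in
  flatten (traject next_roots [seq (simple_vec i, stab i) | i <- iota 0 6] 11).

Definition rvec (k : nat) : seq int :=
  if (k < 36)%N then (nth ([::], [::]) pos_table k).1
  else vopp (nth ([::], [::]) pos_table (k - 36)).1.

Definition rmat (k : nat) : spmx :=
  if (k < 36)%N then (nth ([::], [::]) pos_table k).2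
  else str (nth ([::], [::]) pos_table (k - 36)).2.

Definition all_roots : seq (seq int) := Eval vm_compute in [seq rvec k | k <- iota 0 72].

(* Roots are numbered from 0 to 71: the positive ones first, simple roots in
   front and the highest root at 35, then their opposites in the same order. *)
Definition ropp (k : nat) : nat :=
  if (k < 36)%N then (k + 36)%N else if (k < 72)%N then (k - 36)%N else k.

Definition rref (g k : nat) : nat :=
  let u := rvec k in let v := rvec g in let c := vpair u v in
  index (mkseq (fun j => u`_j - c * v`_j) 6) all_roots.

Definition rsum (g k : nat) : nat := index (vadd (rvec g) (rvec k)) all_roots.

(** The expansion of exp(e) exp(-f) exp(e), using e e = f f = 0, e f e = e and f e f = f. *)
Definition weyl_mat (g : nat) : spmx :=
  let e := rmat g in let f := rmat (ropp g) in
  sone 27 ++ e ++ sneg f ++ sneg (smul 27 e f) ++ sneg (smul 27 f e).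

Definition zsign (b : bool) : BinNums.Z :=
  if b then BinNums.Zpos BinNums.xH else BinNums.Zneg BinNums.xH.

(** The value -1 only records that +1 fails; that it is then correct is part of [check_weyl].
    Likewise for [csgn] and [check_comm]. *)
Definition rsgn (g k : nat) : BinNums.Z :=
  zsign (seqv (smul 27 (weyl_mat g) (rmat k))
              (smul 27 (rmat (rref g k)) (weyl_mat g))).

Definition commutator (l l' : spmx) : spmx := smul 27 l l' ++ sneg (smul 27 l' l).

Definition csgn (g k : nat) : BinNums.Z :=
  zsign (seqv (commutator (rmat g) (rmat k)) (rmat (rsum g k))).

Definition posG (k : nat) : bool := (k < 36)%N.
(** The roots of H are those with an even coefficient of alpha_2: among positive roots it is 0 for
    A_5 and 2 for the highest root only. *)
Definition posH (k : nat) : bool :=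
  (k < 36)%N && ~~ odd (absz (rvec k)`_1).
Definition simpleG (k : nat) : bool := (k < 6)%N.
Definition simpleH (k : nat) : bool := k \in [:: 0; 2; 3; 4; 5; 35]%N.

(** Weights are given by their pairings with the simple coroots, and in a simply laced system a
    coroot has the same coefficients as its root. *)
Definition coroot_pairing (g a : nat) : int :=
  foldr (fun j s => (rvec g)`_j * (nth [::] wtab a)`_j + s) 0 (iota 0 6).

Let refl_roots := [:: 0; 1; 2; 3; 4; 5; 35]%N.
Let all72 (P : pred nat) := all P (iota 0 72).
Let all7x72 (P : nat -> nat -> bool) := all (fun g => all72 (P g)) refl_roots.

Lemma check_sq : all72 (fun k => szero (smul 27 (rmat k) (rmat k))).
Proof. by vm_compute. Qed.

Lemma check_efe : all72 (fun k =>
  seqv (smul 27 (smul 27 (rmat k) (rmat (ropp k))) (rmat k)) (rmat k)).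
Proof. by vm_compute. Qed.

Lemma check_opp : all72 (fun k => rmat (ropp k) == str (rmat k)).
Proof. by vm_compute. Qed.

Lemma check_weyl : all7x72 (fun g k => [&&
  seqv (smul 27 (weyl_mat g) (rmat k))
       (sscale (rsgn g k) (smul 27 (rmat (rref g k)) (weyl_mat g))),
  BinInt.Z.eqb (rsgn g (ropp k)) (rsgn g k), rref g (ropp k) == ropp (rref g k),
  rref g (rref g k) == k & (rref g k < 72)%N]).
Proof. by vm_compute. Qed.

Lemma check_rref : all (fun g => rref g g == ropp g) refl_roots.
Proof. by vm_compute. Qed.

Lemma check_rref_pos : all7x72 (fun g k =>
  (simpleG g && posG k && (k != g) ==> posG (rref g k)) &&
  (simpleH g && posH k && (k != g) ==> posH (rref g k))).
Proof. by vm_compute. Qed.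

Lemma check_comm : all7x72 (fun g k => let j := rsum g k in
  (k == g) || (k == ropp g) ||
  if (j < 72)%N then [&&
    seqv (commutator (rmat g) (rmat k)) (sscale (csgn g k) (rmat j)),
    szero (smul 27 (rmat k) (rmat j)), szero (smul 27 (rmat j) (rmat g)),
    szero (smul 27 (rmat g) (rmat j)), j != g, posG g && posG k ==> posG j
    & posH g && posH k ==> posH j]
  else szero (commutator (rmat g) (rmat k))).
Proof. by vm_compute. Qed.

Definition row_weight (k b : nat) : seq int :=
  mkseq (fun j => (nth [::] wtab b)`_j +
    foldr (fun l s => (rvec k)`_l * E6_cartan l j + s) 0 (iota 0 6)) 6.

(* The root vectors are supported where the difference of weights is the
   root. *)
Lemma check_support : all72 (fun k => all (fun e =>
    (nth [::] wtab e.1.1 == row_weight k e.1.2) && (e.1.1 < 27)%N &&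
    (e.1.2 < 27)%N) (rmat k)).
Proof. by vm_compute. Qed.

Lemma check_coroot : all72 (fun k =>
  seqv (smul 27 (rmat k) (rmat (ropp k)))
    [seq (a, a, BinNums.Zpos BinNums.xH) | a <- iota 0 27 & coroot_pairing k a == 1]
  && all (fun a => coroot_pairing k a \in [:: 0; 1; -1]) (iota 0 27)).
Proof. by vm_compute. Qed.

Lemma check_rvec_opp :
  all72 (fun k => all (fun j => (rvec (ropp k))`_j == - (rvec k)`_j) (iota 0 6)).
Proof. by vm_compute. Qed.

Lemma check_coroot_opp : all72 (fun k =>
  all (fun a => coroot_pairing (ropp k) a == - coroot_pairing k a) (iota 0 27)).
Proof. by vm_compute. Qed.

End RootTables.

#[global] Opaque rmat rvec rref rsum rsgn csgn weyl_mat wtab all_roots pos_table.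

Lemma all_iotaP (P : pred nat) m n : all P (iota m n) ->
  forall k, (m <= k < m + n)%N -> P k.
Proof. by move=> /allP h k hk; apply: h; rewrite mem_iota. Qed.

Lemma all_iota0P (P : pred nat) n : all P (iota 0 n) ->
  forall k, (k < n)%N -> P k.
Proof. by move=> /all_iotaP h k hk; apply: h. Qed.

Lemma ropp_lt k : (k < 72)%N -> (ropp k < 72)%N.
Proof.
rewrite /ropp => h; rewrite h; case: (ltnP k 36) => h1.
  by rewrite -[72%N]/(36 + 36)%N ltn_add2r.
exact: leq_ltn_trans (leq_subr _ _) h.
Qed.

Lemma roppK k : ropp (ropp k) = k.
Proof.
rewrite /ropp; case: (ltnP k 36) => h1.
  by rewrite ltnNge leq_addl /= -[72%N]/(36 + 36)%N ltn_add2r h1 addnK.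
case: (ltnP k 72) => h2; last by rewrite ltnNge h1 /= ltnNge h2.
by rewrite ltn_subLR // h2 subnK.
Qed.

(** * Rank one computations *)

Section Sl2.
Variables (K : fieldType) (n : nat) (e f : 'M[K]_n).
Hypotheses (ee : e *m e = 0) (ff : f *m f = 0).
Hypotheses (efe : e *m f *m e = e) (fef : f *m e *m f = f).

(** The span of 1, e, f, ef and fe is closed under multiplication, so every rank one identity
    reduces to five scalar identities. *)
Definition sl2_comb (a0 a1 a2 a3 a4 : K) : 'M[K]_n :=
  a0%:M + a1 *: e + a2 *: f + a3 *: (e *m f) + a4 *: (f *m e).

Lemma sl2_comb_mul a0 a1 a2 a3 a4 b0 b1 b2 b3 b4 :
  sl2_comb a0 a1 a2 a3 a4 *m sl2_comb b0 b1 b2 b3 b4 =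
  sl2_comb (a0 * b0) (a0 * b1 + a1 * b0 + a1 * b4 + a3 * b1)
    (a0 * b2 + a2 * b0 + a2 * b3 + a4 * b2)
    (a0 * b3 + a3 * b0 + a1 * b2 + a3 * b3)
    (a0 * b4 + a4 * b0 + a2 * b1 + a4 * b4).
Proof.
rewrite /sl2_comb !(mulmxDl, mulmxDr) !mul_scalar_mx !mul_mx_scalar.
rewrite -!scalemxAl -!scalemxAr !mulmxA ee ff efe fef !mul0mx ?scaler0.
rewrite -(mulmxA _ e e) ee mulmx0 -(mulmxA _ f f) ff mulmx0 !mul0mx ?scaler0.
move: (e *m f) (f *m e) => p q; apply/matrixP => i j; rewrite !mxE.
by case: (i == j); rewrite ?mulr1n ?mulr0n; ring.
Qed.

Lemma sl2_root_e s : 1%:M + s *: e = sl2_comb 1 s 0 0 0.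
Proof. by rewrite /sl2_comb !scale0r !addr0. Qed.

Lemma sl2_root_f s : 1%:M + s *: f = sl2_comb 1 0 s 0 0.
Proof. by rewrite /sl2_comb !scale0r !addr0. Qed.

Lemma sl2_refl u : u != 0 ->
  (1%:M + u *: e) *m (1%:M + (- u^-1) *: f) *m (1%:M + u *: e) =
  sl2_comb 1 u (- u^-1) (-1) (-1).
Proof.
move=> u0; pose simp := (mul0r, mulr0, mul1r, mulr1, add0r, addr0).
have uv : u * - u^-1 = -1 by rewrite mulrN divff.
have vu : - u^-1 * u = -1 by rewrite mulrC.
rewrite !sl2_root_e sl2_root_f sl2_comb_mul !simp uv sl2_comb_mul !simp vu.
by rewrite mulN1r addrK.
Qed.

End Sl2.

HB.lock Definition rvect (K : fieldType) (k : nat) : 'M[K]_27 :=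
  imx K 27 27 (rmat k).

(** * Root groups, torus and coroots on the minuscule module *)

Section RootGroups.
Variable K : fieldType.

Lemma rvectE k : rvect K k = imx K 27 27 (rmat k).
Proof. by rewrite rvect.unlock. Qed.

Definition rootx k (s : K) : 'M[K]_27 := 1%:M + s *: rvect K k.

Lemma rvect_big k : (72 <= k)%N -> rvect K k = 0.
Proof.
move=> h; have -> : rvect K k = imx K 27 27 [::]; last exact: imx_nil.
rewrite rvectE; congr imx; rewrite -[LHS]/(if (k < 36)%N then _ else _).
rewrite ltnNge (leq_trans _ h) //= nth_default //.
by rewrite -[size pos_table]/36%N leq_subRL ?(leq_trans _ h).
Qed.

Lemma rvect_sq k : rvect K k *m rvect K k = 0.
Proof.
have [h|/rvect_big ->] := ltnP k 72; last by rewrite mul0mx.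
by rewrite rvectE -imx_mul imx_szero // (all_iota0P check_sq h).
Qed.

Lemma rvect_opp k : rvect K (ropp k) = (rvect K k)^T.
Proof.
have [h|h] := ltnP k 72; last first.
  have -> : ropp k = k by rewrite /ropp ltnNge (leq_trans _ h) //= ltnNge h.
  by rewrite rvect_big ?trmx0.
by rewrite !rvectE -imx_tr (eqP (all_iota0P check_opp h)).
Qed.

Lemma rvect_efe k : rvect K k *m rvect K (ropp k) *m rvect K k = rvect K k.
Proof.
have [h|h] := ltnP k 72; last by rewrite (rvect_big h) mulmx0.
by rewrite !rvectE -!imx_mul (imx_seqv _ _ _ (all_iota0P check_efe h)).
Qed.

Lemma rootx0 k : rootx k 0 = 1%:M. Proof. by rewrite /rootx scale0r addr0. Qed.

Lemma rootxD k s t : rootx k (s + t) = rootx k s *m rootx k t.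
Proof.
rewrite /rootx mulmxDl !mulmxDr mul1mx !mulmx1 mul1mx.
by rewrite -scalemxAl -scalemxAr rvect_sq !scaler0 addr0 scalerDl [s *: _ + _]addrC
  addrA.
Qed.

Definition sl2c k := sl2_comb (rvect K k) (rvect K (ropp k)).

Lemma sl2c_mul k a0 a1 a2 a3 a4 b0 b1 b2 b3 b4 :
  sl2c k a0 a1 a2 a3 a4 *m sl2c k b0 b1 b2 b3 b4 =
  sl2c k (a0 * b0) (a0 * b1 + a1 * b0 + a1 * b4 + a3 * b1)
    (a0 * b2 + a2 * b0 + a2 * b3 + a4 * b2)
    (a0 * b3 + a3 * b0 + a1 * b2 + a3 * b3)
    (a0 * b4 + a4 * b0 + a2 * b1 + a4 * b4).
Proof.
apply: sl2_comb_mul; rewrite ?rvect_sq ?rvect_efe //.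
by rewrite -{2}[k]roppK rvect_efe.
Qed.

Lemma rootxE k s : rootx k s = sl2c k 1 s 0 0 0.
Proof. exact: sl2_root_e. Qed.

Lemma rootx_oppE k s : rootx (ropp k) s = sl2c k 1 0 s 0 0.
Proof. exact: sl2_root_f. Qed.

Definition rrefl k u := rootx k u *m rootx (ropp k) (- u^-1) *m rootx k u.

Lemma rreflE k u : u != 0 -> rrefl k u = sl2c k 1 u (- u^-1) (-1) (-1).
Proof.
move=> u0; apply: sl2_refl; rewrite ?rvect_sq ?rvect_efe //.
by rewrite -{2}[k]roppK rvect_efe.
Qed.

Lemma rrefl1 k : rootx k 1 *m rootx (ropp k) (-1) *m rootx k 1 = rrefl k 1.
Proof. by rewrite /rrefl invr1. Qed.

Lemma rrefl1E k : rrefl k 1 = sl2c k 1 1 (-1) (-1) (-1).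
Proof. by rewrite rreflE ?oner_neq0 // invr1. Qed.

Lemma weyl_matE k : imx K 27 27 (weyl_mat k) = rrefl k 1.
Proof.
rewrite rrefl1E /sl2c /sl2_comb -[weyl_mat k]/(sone 27 ++ rmat k ++
  sneg (rmat (ropp k)) ++ sneg (smul 27 (rmat k) (rmat (ropp k))) ++
  sneg (smul 27 (rmat (ropp k)) (rmat k))).
by rewrite !rvectE !imx_cat !imx_neg !imx_mul imx_one scale1r !scaleN1r !addrA.
Qed.

Definition rcoef k : 'I_6 -> int := fun j => (rvec k)`_j.

Definition nonzero_fun (t : 'I_6 -> K) : Prop := forall j, t j != 0.

Lemma torus_eltM (t t' : 'I_6 -> K) : nonzero_fun t -> nonzero_fun t' ->
  torus_elt t *m torus_elt t' = torus_elt (fun j => t j * t' j).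
Proof.
move=> t0 t0'; rewrite /torus_elt mulmx_diag; congr diag_mx.
apply/rowP => a; rewrite !mxE -big_split; apply: eq_bigr => j _ /=.
by rewrite expfzMl.
Qed.

Lemma torus_elt1 (t : 'I_6 -> K) : (forall j, t j = 1) -> torus_elt t = 1%:M.
Proof.
move=> t1; rewrite -diag_const_mx; congr diag_mx; apply/rowP => a.
by rewrite !mxE big1 // => j _; rewrite t1 exp1rz.
Qed.

Lemma torus_eltV (t : 'I_6 -> K) : nonzero_fun t ->
  torus_elt t *m torus_elt (fun j => (t j)^-1) = 1%:M.
Proof.
move=> t0; rewrite torus_eltM //; last by move=> j; rewrite invr_eq0.
by apply: torus_elt1 => j; rewrite divff.
Qed.

Lemma torus_elt_unit (t : 'I_6 -> K) : nonzero_fun t -> torus_elt t \in unitmx.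
Proof. by move/torus_eltV/mulmx1_unit => []. Qed.

Lemma torus_elt_inv (t : 'I_6 -> K) : nonzero_fun t ->
  invmx (torus_elt t) = torus_elt (fun j => (t j)^-1).
Proof.
move=> t0; rewrite -[RHS](mulKmx (torus_elt_unit t0)) torus_eltV //.
by rewrite mulmx1.
Qed.

Lemma E6_torus_subgroup : subgroup (@E6_torus K).
Proof.
split.
- by move=> _ [t t0 <-]; apply: torus_elt_unit.
- exists (fun=> 1); first by move=> j; apply: oner_neq0.
  exact: torus_elt1.
- move=> _ _ [t t0 <-] [t' t0' <-]; exists (fun j => t j * t' j).
    by move=> j; rewrite mulf_neq0 ?t0 ?t0'.
  by rewrite torus_eltM.
- move=> _ [t t0 <-]; exists (fun j => (t j)^-1).
    by move=> j; rewrite /= invr_eq0; apply: t0.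
  by rewrite torus_elt_inv.
Qed.

Lemma wtE (a : 'I_27) : wt a = nth [::] wtab a.
Proof. by rewrite /wt wtabE. Qed.

Lemma rvect_support k a b : rvect K k a b != 0 -> forall j : 'I_6,
  (wt a)`_j = (wt b)`_j + \sum_l rcoef k l * E6_cartan l j.
Proof.
have [h|/rvect_big ->] := ltnP k 72; last by rewrite mxE eqxx.
rewrite rvectE mxE => nz j.
have /mapP [e eL E] : (nat_of_ord a, nat_of_ord b) \in [seq e.1 | e <- rmat k].
  by apply: contraNT nz => /scoef_notin ->.
have /andP [/andP [/eqP Ew _] _] := allP (all_iota0P check_support h) _ eL.
move: Ew; rewrite -E /= !wtE => ->.
rewrite nth_mkseq // ?ltn_ord //; congr (_ + _).
by rewrite !big_ord_recl big_ord0.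
Qed.

Lemma torus_eltE (t : 'I_6 -> K) a b :
  torus_elt t a b = (\prod_j t j ^ (wt a)`_j) *+ (a == b).
Proof. by rewrite !mxE; case: eqP => [->|]. Qed.

Lemma torus_mull (t : 'I_6 -> K) m (M : 'M[K]_(27, m)) a b :
  (torus_elt t *m M) a b = (\prod_j t j ^ (wt a)`_j) * M a b.
Proof. by rewrite mul_diag_mx !mxE. Qed.

Lemma torus_mulr (t : 'I_6 -> K) m (M : 'M[K]_(m, 27)) a b :
  (M *m torus_elt t) a b = M a b * (\prod_j t j ^ (wt b)`_j).
Proof. by rewrite mul_mx_diag !mxE. Qed.

Lemma prod_weight_add (t : 'I_6 -> K) (u v w : 'I_6 -> int) : nonzero_fun t ->
  (forall j, w j = u j + v j) ->
  \prod_j t j ^ w j = (\prod_j t j ^ u j) * \prod_j t j ^ v j.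
Proof.
move=> t0 e; rewrite -big_split; apply: eq_bigr => j _ /=.
by rewrite e expfzDr.
Qed.

Lemma torus_rvect k (t : 'I_6 -> K) : nonzero_fun t ->
  torus_elt t *m rvect K k = root_char (rcoef k) t *: (rvect K k *m torus_elt t).
Proof.
move=> t0; apply/matrixP => a b; rewrite torus_mull [in RHS]mxE torus_mulr.
have [->|nz] := eqVneq (rvect K k a b) 0; first by rewrite mul0r !mulr0.
rewrite (prod_weight_add t0 (rvect_support nz)).
by rewrite [RHS]mulrCA mulrC [_ * root_char _ _]mulrC.
Qed.

Lemma root_char_neq0 c (t : 'I_6 -> K) : nonzero_fun t -> root_char c t != 0.
Proof.
by move=> t0; apply/prodf_neq0 => j _; rewrite expfz_neq0 ?t0.
Qed.

Lemma torus_rootx k (t : 'I_6 -> K) s : nonzero_fun t ->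
  torus_elt t *m rootx k s = rootx k (root_char (rcoef k) t * s) *m torus_elt t.
Proof.
move=> t0; rewrite /rootx mulmxDl mulmxDr mulmx1 mul1mx -scalemxAl -scalemxAr.
by rewrite torus_rvect // scalerA mulrC.
Qed.

Lemma rcoef_opp k j : (k < 72)%N -> rcoef (ropp k) j = - rcoef k j.
Proof.
move=> h; apply/eqP.
exact: (all_iota0P (all_iota0P check_rvec_opp h) (ltn_ord j)).
Qed.

Lemma root_char_opp k (t : 'I_6 -> K) : (k < 72)%N -> nonzero_fun t ->
  root_char (rcoef (ropp k)) t = (root_char (rcoef k) t)^-1.
Proof.
move=> h t0; rewrite /root_char -prodfV; apply: eq_bigr => j _.
rewrite invr_expz; congr (_ ^ _); rewrite -sumrN; apply: eq_bigr => l _.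
by rewrite rcoef_opp // mulNr.
Qed.

Definition coroot_elt k (u : K) : 'M[K]_27 := torus_elt (fun j => u ^ rcoef k j).

Lemma coroot_nonzero k u : u != 0 -> nonzero_fun (fun j => u ^ rcoef k j).
Proof. by move=> u0 j; rewrite expfz_neq0. Qed.

Lemma coroot_torus k u : u != 0 -> E6_torus (coroot_elt k u).
Proof. by move=> u0; exists (fun j => u ^ rcoef k j) => //; apply: coroot_nonzero. Qed.

Lemma scoef_diag (P : pred nat) m n a b :
  scoef [seq (c, c, BinNums.Zpos BinNums.xH) | c <- iota m n & P c] a b =
  if [&& a == b, P a & (m <= a < m + n)%N] then BinNums.Zpos BinNums.xH
  else BinNums.Z0.
Proof.
elim: n m => [|n IH] m /=.
  by rewrite addn0 [(a < m)%N]ltnNge andbN !andbF.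
case: (eqVneq m a) => [->|ma].

  case Pa: (P a); rewrite /= ?eqxx IH Pa ltnn /= ?andbF ?andbT //.
  by rewrite leqnn -addSnnS leq_addr /=; case: (a == b).
have -> : (m <= a < m + n.+1)%N = (m.+1 <= a < m.+1 + n)%N.
  by rewrite addSnnS [(m <= a)%N]leq_eqVlt (negbTE ma).
by case: ifP => /= _; rewrite IH // (negbTE ma).
Qed.

Lemma rvect_ef k a b : (k < 72)%N ->
  (rvect K k *m rvect K (ropp k)) a b = ((a == b) && (coroot_pairing k a == 1))%:R.
Proof.
move=> h; rewrite !rvectE -imx_mul; have /andP [E _] := all_iota0P check_coroot h.
rewrite (imx_seqv _ _ _ E) mxE scoef_diag /= ltn_ord andbT.
by rewrite -val_eqE /=; case: (_ && _).
Qed.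

Lemma coroot_pairing_cases k a : (k < 72)%N -> (a < 27)%N ->
  coroot_pairing k a \in [:: 0; 1; -1].
Proof.
move=> h ha; have /andP [_ E] := all_iota0P check_coroot h.
exact: all_iota0P E _ ha.
Qed.

(** The coroot takes only the values 0, 1 and -1 on the weights, and ef and fe are the projections
    to the weights of value 1 and -1. *)
Lemma coroot_eltE k u : (k < 72)%N -> u != 0 ->
  coroot_elt k u = sl2c k 1 0 0 (u - 1) (u^-1 - 1).
Proof.
move=> h u0; rewrite /sl2c /sl2_comb !scale0r !addr0.
have h' := ropp_lt h; have := rvect_ef _ _ h'; rewrite roppK => fe.
apply/matrixP => a b; rewrite torus_eltE.
rewrite mxE [in RHS]mxE [in RHS]mxE [in X in _ = _ + X + _]mxE rvect_ef //.
rewrite [in X in _ = _ + X]mxE fe.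
have -> : \prod_j (u ^ rcoef k j) ^ (wt a)`_j = u ^ coroot_pairing k a.
  rewrite wtE /coroot_pairing /= !expfzDr // expr0z mulr1.
  by rewrite !big_ord_recl big_ord0 mulr1 !exprz_exp.
have /eqP -> := all_iota0P (all_iota0P check_coroot_opp h) (ltn_ord a).
case: (a == b) => /=; last by rewrite !mulr0 !mulr0n !addr0.
have := coroot_pairing_cases h (ltn_ord a); rewrite !inE.
case/or3P => /eqP ->; rewrite ?expr0z ?expr1z ?exprN1 /=; move: (u^-1) => v;
  rewrite !mulr1n ?mulr0 ?mulr1 ?addr0 //; ring.
Qed.

End RootGroups.

#[global] Opaque posH.

Definition refl_root (g : nat) : bool := g \in [:: 0; 1; 2; 3; 4; 5; 35]%N.

Lemma refl_root_lt g : refl_root g -> (g < 36)%N.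
Proof. by rewrite /refl_root !inE; do 6?case/predU1P=> [->//|]; move/eqP->. Qed.

Lemma refl_rootP (P : nat -> nat -> bool) :
  all (fun g => all (P g) (iota 0 72)) [:: 0; 1; 2; 3; 4; 5; 35]%N ->
  forall g k, refl_root g -> (k < 72)%N -> P g k.
Proof. by move=> /allP h g k hg; apply: all_iota0P; apply: h. Qed.

(** * Root data of G and of H *)

Section RootDatumE6.
Variable K : fieldType.

Lemma sl2c_eq k a0 a1 a2 a3 a4 b0 b1 b2 b3 b4 : a0 = b0 -> a1 = b1 ->
  a2 = b2 -> a3 = b3 -> a4 = b4 ->
  sl2c k a0 a1 a2 a3 a4 = sl2c k b0 b1 b2 b3 b4 :> 'M[K]_27.
Proof. by move=> -> -> -> -> ->. Qed.

Lemma rrefl_coroot k u : (k < 72)%N -> u != 0 ->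
  rrefl k u = coroot_elt k u *m rrefl k 1 :> 'M[K]_27.
Proof.
move=> h u0; rewrite rreflE // coroot_eltE // rrefl1E sl2c_mul.
by apply: sl2c_eq; move: (u^-1) => v; ring.
Qed.

Lemma rrefl_sq k : (k < 72)%N ->
  rrefl k 1 *m rrefl k 1 = coroot_elt k (-1) :> 'M[K]_27.
Proof.
have n1 : -1 != 0 :> K by rewrite oppr_eq0 oner_eq0.
move=> h; rewrite coroot_eltE // rrefl1E sl2c_mul invrN1.
by apply: sl2c_eq; ring.
Qed.

Lemma rrefl_rootx k s : (k < 72)%N -> s != 0 ->
  rrefl k 1 *m rootx k s = rootx k (- s^-1) *m coroot_elt k (- s^-1) *m
    rootx (ropp k) s^-1 :> 'M[K]_27.
Proof.
move=> h s0; have s0' : - s^-1 != 0 by rewrite oppr_eq0 invr_eq0.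
rewrite coroot_eltE // rrefl1E !(rootxE k) rootx_oppE !sl2c_mul invrN invrK.
by apply: sl2c_eq; field.
Qed.

Lemma rvect_refl g k : refl_root g -> (k < 72)%N ->
  rrefl g 1 *m rvect K k = zr K (rsgn g k) *: (rvect K (rref g k) *m rrefl g 1) :> 'M[K]_27.
Proof.
move=> hg hk; have /and5P [E _ _ _ _] := refl_rootP check_weyl hg hk.
have := imx_seqv K 27 27 E.
by rewrite imx_scale !imx_mul weyl_matE -!rvectE.
Qed.

(** The commutator formula in a simply laced system; the vanishing of kj and jg removes all terms
    beyond the one in s t. *)
Lemma unipotent_comm n (g k j : 'M[K]_n) N s t :
  g *m k = k *m g + N *: j -> k *m j = 0 -> j *m g = 0 ->
  (1%:M + s *: g) *m (1%:M + t *: k) =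
  (1%:M + t *: k) *m (1%:M + (N * (s * t)) *: j) *m (1%:M + s *: g).
Proof.
move=> gk kj jg; rewrite !(mulmxDl, mulmxDr) !mul1mx !mulmx1.
rewrite -!scalemxAl -!scalemxAr -?scalemxAl kj jg gk.
rewrite !scaler0 ?mul0mx ?scaler0 !addr0.
by move: (k *m g) => M; apply/matrixP => a b; rewrite !mxE; ring.
Qed.

Lemma rvect_mul0 k l : szero (smul 27 (rmat k) (rmat l)) ->
  rvect K k *m rvect K l = 0 :> 'M[K]_27.
Proof. by move=> h; rewrite !rvectE -imx_mul imx_szero. Qed.

Lemma imx_commutator k l : imx K 27 27 (commutator (rmat k) (rmat l)) =
  rvect K k *m rvect K l - rvect K l *m rvect K k.
Proof. by rewrite imx_cat imx_neg !imx_mul !rvectE. Qed.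

Lemma rootx_comm_sum g k s t : refl_root g -> (k < 72)%N -> k != g ->
  k != ropp g -> (rsum g k < 72)%N ->
  rootx g s *m rootx k t = rootx k t *m rootx (rsum g k)
    (zr K (csgn g k) * (s * t)) *m rootx g s :> 'M[K]_27.
Proof.
move=> hg hk kg kg' hj; have := refl_rootP check_comm hg hk.
rewrite (negbTE kg) (negbTE kg') /= hj.
case/and5P=> /(imx_seqv K 27 27); rewrite imx_commutator imx_scale -rvectE => E.
move=> /rvect_mul0 kj /rvect_mul0 jg _ _.
by apply: unipotent_comm => //; apply/eqP; rewrite addrC -subr_eq; apply/eqP.
Qed.

Lemma rootx_comm g k s t : refl_root g -> (k < 72)%N -> k != g -> k != ropp g ->
  exists j c, [/\ rootx g s *m rootx k t = rootx k t *m rootx j c *m rootx g s :> 'M[K]_27,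
    j != g, posG g && posG k -> posG j & posH g && posH k -> posH j].
Proof.
move=> hg hk kg kg'; have := refl_rootP check_comm hg hk.
have := @rootx_comm_sum g k s t hg hk kg kg'.
rewrite (negbTE kg) (negbTE kg') /=; case: ifP => [_ /(_ isT) E|_ _].
  move=> /and5P [_ _ _ _ /and3P [jng pG pH]].
  by exists (rsum g k), (zr K (csgn g k) * (s * t)); split=> //; apply/implyP.
move=> /(imx_szero K 27 27); rewrite imx_commutator => /eqP.
rewrite subr_eq0 => /eqP E.
exists k, 0; split=> //; [|by case/andP|by case/andP].
have := @unipotent_comm 27 (rvect K g) (rvect K k) 0 0 s t.
by rewrite !scaler0 !addr0 mulmx1 rootx0 mulmx1 mulmx0 mul0mx; apply.
Qed.

(** Pulling t to the left through the three root elements turns [rrefl g 1] into [rrefl g c^-1],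
    which differs from it by a coroot element. *)
Lemma rrefl_torus g (t : 'I_6 -> K) : (g < 72)%N -> nonzero_fun t ->
  exists2 t', E6_torus t' & rrefl g 1 *m torus_elt t = t' *m rrefl g 1.
Proof.
move=> hg t0; set c := root_char (rcoef g) t.
have c0 : c != 0 := root_char_neq0 _ t0.
have c0' : c^-1 != 0 by rewrite invr_eq0.
have T := E6_torus_subgroup K.
exists (torus_elt t *m coroot_elt g c^-1).
  apply: (subgroupM T); first by exists t.
  exact: coroot_torus.
rewrite -mulmxA -rrefl_coroot // /rrefl invr1 invrK !mulmxA.
have xg s : torus_elt t *m rootx g (c^-1 * s) = rootx g s *m torus_elt t.
  by rewrite torus_rootx // mulVKf.
have xg' s : torus_elt t *m rootx (ropp g) (c * s) = rootx (ropp g) s *m torus_elt t.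
  by rewrite torus_rootx // root_char_opp // mulKf.
rewrite -[X in rootx g X *m rootx (ropp g) _ *m _](mulr1) -[c^-1]mulr1 xg.
rewrite -(mulmxA (rootx g 1) (torus_elt t)) -[- c](mulrN1) xg' !mulmxA.
by rewrite -(mulmxA _ (torus_elt t)) xg !mulmxA ?mulr1.
Qed.

Lemma root_datum_of (pos simple : pred nat) :
  (forall g, simple g -> refl_root g && pos g) ->
  (forall k, pos k -> (k < 36)%N) ->
  (forall g k, simple g -> pos k -> k != g -> pos (rref g k)) ->
  (forall g k s t, simple g -> pos k -> k != g ->
    exists j c, [/\ pos j, j != g & rootx g s *m rootx k t =
      rootx k t *m rootx j c *m rootx g s :> 'M[K]_27]) ->
  root_datum (@E6_torus K) (@rootx K) pos simple ropp rref
    (fun g k => zr K (rsgn g k)).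
Proof.
move=> hs hp hr hc.
have sref g : simple g -> refl_root g by case/hs/andP.
have slt g : simple g -> (g < 72)%N.
  by move/sref/refl_root_lt => h; apply: ltn_trans h _.
have rlt k : pos k || pos (ropp k) -> (k < 72)%N.
  case/orP => /hp h; first exact: ltn_trans h _.
  by rewrite -[k]roppK; apply: ropp_lt; apply: ltn_trans h _.
have chk g k : simple g -> pos k || pos (ropp k) -> _ :=
  fun Sg rk => refl_rootP check_weyl (sref g Sg) (rlt k rk).
split.
- exact: E6_torus_subgroup.
- exact: rootx0.
- exact: rootxD.
- move=> k _ [t t0 <-]; exists (root_char (rcoef k) t) => s.
  exact: torus_rootx.
- exact: roppK.
- move=> k /hp h; apply/negP => /hp; rewrite /ropp h.
  by rewrite ltnNge leq_addl.
- by move=> g /hs /andP [].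
- move=> g k _ _; rewrite -[rsgn g k]/(zsign _).
  by case: (seqv _ _); [left|right].
- by move=> g k Sg rk; case/and5P: (chk g k Sg rk) => _ /BinInt.Z.eqb_spec ->.
- by move=> g k Sg rk; case/and5P: (chk g k Sg rk) => _ _ /eqP.
- by move=> g k Sg rk; case/and5P: (chk g k Sg rk) => _ _ _ /eqP.
- by move=> g /sref Sg; apply/eqP; apply: (allP check_rref).
- exact: hr.
- move=> g k s Sg rk; rewrite /= rrefl1 /rootx mulmxDr mulmxDl mulmx1 mul1mx.
  rewrite -scalemxAr rvect_refl ?sref ?rlt // -scalemxAl scalerA.
  by rewrite [s * _]mulrC.
- move=> g _ Sg [t t0 <-]; rewrite /= rrefl1; exact: rrefl_torus (slt g Sg) t0.
- move=> g Sg; rewrite /= rrefl1 rrefl_sq ?slt //.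
  by apply: coroot_torus; rewrite oppr_eq0 oner_eq0.
- exact: hc.
- move=> g s Sg s0; rewrite /= rrefl1; exists (- s^-1), (coroot_elt g (- s^-1)), s^-1.
  split; last by rewrite rrefl_rootx ?slt.
  by apply: coroot_torus; rewrite oppr_eq0 invr_eq0.
Qed.

Lemma simpleG_refl g : simpleG g -> refl_root g && posG g.
Proof. by do 6!case: g => [//|g]. Qed.

Lemma simpleH_refl g : simpleH g -> refl_root g && posH g.
Proof.
rewrite /simpleH !inE => h.
have : all (fun g => posH g) [:: 0; 2; 3; 4; 5; 35]%N by vm_compute.
move=> /allP ->; last by rewrite !inE.
by rewrite andbT /refl_root !inE; case/or4P: h => [->|->|->|]; rewrite ?orbT //;
   case/or3P => ->; rewrite ?orbT.
Qed.

Lemma posH_lt k : posH k -> (k < 36)%N.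
Proof. by rewrite -[posH k]/((k < 36)%N && _) => /andP []. Qed.

Lemma posG_neq_opp g k : posG g -> posG k -> k != ropp g.
Proof.
move=> hg hk; apply: contraTneq hk => ->; rewrite /ropp -/(posG g) hg.
by rewrite /posG ltnNge leq_addl.
Qed.

Lemma root_datumG : root_datum (@E6_torus K) (@rootx K) posG simpleG ropp rref
  (fun g k => zr K (rsgn g k)).
Proof.
apply: root_datum_of => //.
- exact: simpleG_refl.
- move=> g k Sg pk kg; have /andP [hg _] := simpleG_refl Sg.
  have hk : (k < 72)%N by apply: ltn_trans pk _.
  by have /andP [/implyP + _] := refl_rootP check_rref_pos hg hk; apply;
     rewrite Sg pk.
- move=> g k s t Sg pk kg; have /andP [hg pg] := simpleG_refl Sg.
  have hk : (k < 72)%N by apply: ltn_trans pk _.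
  have [j [c [E jg pj _]]] := rootx_comm s t hg hk kg (posG_neq_opp pg pk).
  by exists j, c; split=> //; apply: pj; rewrite pg pk.
Qed.

Lemma root_datumH : root_datum (@E6_torus K) (@rootx K) posH simpleH ropp rref
  (fun g k => zr K (rsgn g k)).
Proof.
apply: root_datum_of.
- exact: simpleH_refl.
- exact: posH_lt.
- move=> g k Sg pk kg; have /andP [hg _] := simpleH_refl Sg.
  have hk : (k < 72)%N by apply: ltn_trans (posH_lt pk) _.
  by have /andP [_ /implyP] := refl_rootP check_rref_pos hg hk; apply;
     rewrite Sg pk.
- move=> g k s t Sg pk kg; have /andP [hg pg] := simpleH_refl Sg.
  have hk : (k < 72)%N by apply: ltn_trans (posH_lt pk) _.
  have ng := posG_neq_opp (posH_lt pg) (posH_lt pk).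
  have [j [c [E jg _ pj]]] := rootx_comm s t hg hk kg ng.
  by exists j, c; split=> //; apply: pj; rewrite pg pk.
Qed.

End RootDatumE6.

(** The weights are listed in such an order that raising lowers the index, so positive root vectors
    are strictly upper triangular. Both det = 1 and the solvability of the Borel subgroup rest on
    this. *)
Lemma check_upper :
  all (fun k => all (fun e => (e.1.1 < e.1.2)%N) (rmat k)) (iota 0 36).
Proof. by vm_compute. Qed.

Lemma check_e : all (fun i => all (fun a => all (fun b =>
  BinInt.Z.eqb (scoef (rmat i) a b)
    (if nth [::] wtab b == sub_simple_root (nth [::] wtab a) i
     then BinNums.Zpos BinNums.xH else BinNums.Z0)) (iota 0 27)) (iota 0 27)) (iota 0 6).
Proof. by vm_compute. Qed.

Lemma check_simple_vec :
  all (fun i => all (fun j => (rvec i)`_j == (i == j)%:Z) (iota 0 6)) (iota 0 6).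
Proof. by vm_compute. Qed.

Lemma check_csgn : all (fun g => all (fun k =>
  BinInt.Z.eqb (BinInt.Z.mul (csgn g k) (csgn g k)) (BinNums.Zpos BinNums.xH))
  (iota 0 72)) [:: 0; 1; 2; 3; 4; 5; 35]%N.
Proof. by vm_compute. Qed.

Lemma simple_refl_root g : (g < 6)%N -> refl_root g.
Proof. by do 6?case: g => [//|g]. Qed.

Lemma ropp_pos k : (36 <= k)%N -> (k < 72)%N -> (ropp k < 36)%N.
Proof.
by move=> h h'; rewrite /ropp [(k < 36)%N]ltnNge h h' /= ltn_subLR.
Qed.

(** * Generation of E_6 by simple root groups *)

Section E6Group.
Variable K : fieldType.

Lemma rvect_upper k (a b : 'I_27) : (k < 36)%N -> (b <= a)%N -> rvect K k a b = 0.
Proof.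
move=> hk ba; rewrite rvectE mxE.
rewrite scoef_notin //; apply/mapP => -[e eL E].
have := allP (all_iota0P check_upper hk) _ eL.
by rewrite -E /= ltnNge ba.
Qed.

Lemma rootx_tr k s : (rootx k s)^T = rootx (ropp k) s :> 'M[K]_27.
Proof. by rewrite /rootx linearD /= trmx1 linearZ /= rvect_opp. Qed.

Lemma det_rootx k s : \det (rootx k s : 'M[K]_27) = 1.
Proof.
have pos j : (j < 36)%N -> \det (rootx j s : 'M[K]_27) = 1.
  move=> hj; rewrite -det_tr det_trig.
    apply: big1 => a _; rewrite !mxE eqxx rvect_upper // mulr0 addr0 //.
  apply/is_trig_mxP => a b ab; rewrite !mxE rvect_upper ?(ltnW ab) // mulr0.
  by rewrite addr0 -val_eqE /= gtn_eqF.
have [/pos //|h] := ltnP k 36.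
have [h'|h'] := ltnP k 72.
  rewrite -det_tr rootx_tr; apply: pos.
  exact: ropp_pos.
by rewrite /rootx rvect_big // scaler0 addr0 det1.
Qed.

Lemma rootx_unit k (s : K) : rootx k s \in unitmx.
Proof. by rewrite unitmxE det_rootx unitr1. Qed.

Lemma e_rvect (i : 'I_6) : e_ K i = rvect K i.
Proof.
rewrite rvectE.
apply/matrixP => a b; rewrite !mxE !wtE.
have /BinInt.Z.eqb_spec -> := all_iota0P (all_iota0P (all_iota0P check_e
  (ltn_ord i)) (ltn_ord a)) (ltn_ord b).
by case: eqP.
Qed.

Lemma x_posE (i : 'I_6) t : x_pos i t = rootx i t :> 'M[K]_27.
Proof. by rewrite /x_pos e_rvect. Qed.

Lemma x_negE (i : 'I_6) t : x_neg i t = rootx (ropp i) t :> 'M[K]_27.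
Proof. by rewrite /x_neg e_rvect -rvect_opp. Qed.

Lemma E6_subgroup : subgroup (@E6_group K).
Proof.
apply: subgroup_generated => g [i [t [->|->]]].
  by rewrite x_posE; apply: rootx_unit.
by rewrite x_negE; apply: rootx_unit.
Qed.

Lemma subgroup_tr (A : set 'M[K]_27) : subgroup A -> subgroup [set g | A g^T].
Proof.
move=> sA; split.
- by move=> g /(subgroup_unit sA); rewrite unitmx_tr.
- by rewrite /= trmx1; apply: (subgroup1 sA).
- by move=> g h /= Ag Ah; rewrite trmx_mul; apply: (subgroupM sA).
- by move=> g /= Ag; rewrite trmx_inv; apply: (subgroupV sA).
Qed.

(** A positive root that is not simple is a sum g + k' with g simple and k' positive and earlier in
    the numbering; the commutator formula produces its root elements. The structure constant is a
    sign, so it is cancelled by inserting it once more in the parameter. *)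
Lemma pos_root_gen_of (simple pos : pred nat) (A : set 'M[K]_27) :
  (forall g, simple g -> refl_root g) -> (forall k, pos k -> (k < 36)%N) ->
  all (fun k => [|| ~~ pos k, simple k |
    has (fun g => simple g && has (fun k' => [&& pos k', k' != g, k' != ropp g &
      rsum g k' == k]) (iota 0 k)) (iota 0 36)]) (iota 0 36) ->
  subgroup A -> (forall i s, simple i -> A (rootx i s)) ->
  forall k s, pos k -> A (rootx k s).
Proof.
move=> hs hp chk sA hA; elim/ltn_ind => k IH s pk.
have hk := hp k pk; case/or3P: (all_iota0P chk hk) => [|/hA //|].
  by rewrite pk.
move=> /hasP [g _ /andP [Sg /hasP [k']]].
rewrite mem_iota add0n /= => hk' /and4P [pk' kg kg' /eqP ek].
have k36 := ltn_trans hk' hk; have k72 : (k' < 72)%N by apply: ltn_trans k36 _.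
have hsum : (rsum g k' < 72)%N by rewrite ek; apply: ltn_trans hk _.
have hg := hs g Sg.
have := @rootx_comm_sum K g k' (zr K (csgn g k') * s) 1 hg k72 kg kg' hsum.
have /BinInt.Z.eqb_spec E := refl_rootP check_csgn hg k72.
rewrite mulr1 mulrA -zrM E zr1 mul1r ek => e.
have Ak := IH _ hk' 1 pk'; have Ag t := hA g t Sg.
apply: (subgroupMl sA Ak).
apply: (subgroupMr sA (Ag (zr K (csgn g k') * s))).
by rewrite -e; apply: (subgroupM sA).
Qed.

Lemma pos_root_gen (A : set 'M[K]_27) : subgroup A ->
  (forall i s, (i < 6)%N -> A (rootx i s)) ->
  forall k s, (k < 36)%N -> A (rootx k s).
Proof.
apply: (@pos_root_gen_of simpleG posG); [exact: simple_refl_root|by []|].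
by vm_compute.
Qed.

Lemma pos_root_genH (A : set 'M[K]_27) : subgroup A ->
  (forall i s, simpleH i -> A (rootx i s)) ->
  forall k s, posH k -> A (rootx k s).
Proof.
apply: (@pos_root_gen_of simpleH posH); [|exact: posH_lt|by vm_compute].
by move=> g /simpleH_refl /andP [].
Qed.

Lemma E6_tr g : E6_group g -> @E6_group K g^T.
Proof.
apply: (generated_sub (subgroup_tr E6_subgroup)) => {}g [i [t hg]].
apply: sub_generated; exists i, t; case: hg => ->.
  by right; rewrite x_negE -rootx_tr x_posE.
by left; rewrite x_negE rootx_tr roppK x_posE.
Qed.

Lemma E6_root k s : (k < 72)%N -> @E6_group K (rootx k s).
Proof.
have pos j t : (j < 36)%N -> @E6_group K (rootx j t).
  apply: (pos_root_gen E6_subgroup) => i u hi; apply: sub_generated.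
  by exists (Ordinal hi), u; left; rewrite x_posE.
have [/pos //|h h'] := ltnP k 36.
rewrite -[rootx k s]trmxK rootx_tr; apply: E6_tr; apply: pos.
exact: ropp_pos.
Qed.

Lemma torus_gen (A : set 'M[K]_27) : subgroup A ->
  (forall k u, (k < 6)%N -> u != 0 -> A (coroot_elt k u)) -> @E6_torus K `<=` A.
Proof.
move=> sA hA _ [t t0 <-].
pose tm m : 'I_6 -> K := fun j => if (j < m)%N then t j else 1.
have tm0 m : nonzero_fun (tm m).
  by move=> j; rewrite /tm; case: ifP; rewrite ?oner_neq0 // => _; apply: t0.
suff h m : (m <= 6)%N -> A (torus_elt (tm m)).
  have -> : torus_elt t = torus_elt (tm 6%N); last exact: h.
  by congr torus_elt; apply/funext => j; rewrite /tm ltn_ord.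
elim: m => [|m IH] hm.
  by rewrite torus_elt1 //; apply: (subgroup1 sA).
have -> : torus_elt (tm m.+1) =
    torus_elt (tm m) *m coroot_elt m (t (Ordinal hm)).
  rewrite /coroot_elt torus_eltM //; last exact/coroot_nonzero/t0.
  congr torus_elt; apply/funext => j; rewrite /rcoef.
  have /eqP -> := all_iota0P (all_iota0P check_simple_vec hm) (ltn_ord j).
  rewrite /tm ltnS; case: (ltngtP j m) => [jm|jm|jm].
  - by rewrite expr0z mulr1.
  - by rewrite expr0z mulr1.
  - by rewrite expr1z mul1r; congr t; apply: val_inj.
by apply: (subgroupM sA); [apply: IH (ltnW hm)|apply: hA => //; apply: t0].
Qed.

Lemma coroot_gen (A : set 'M[K]_27) k : subgroup A -> (k < 72)%N ->
  (forall s, A (rootx k s)) -> (forall s, A (rootx (ropp k) s)) ->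
  forall u, u != 0 -> A (coroot_elt k u).
Proof.
move=> sA hk A1 A2 u u0.
have An v : A (rrefl k v).
  by apply: (subgroupM sA) => //; apply: (subgroupM sA).
by apply: (subgroupMr sA (An 1)); rewrite -rrefl_coroot.
Qed.

Lemma E6_has_torus : @E6_torus K `<=` @E6_group K.
Proof.
apply: (torus_gen E6_subgroup) => k u hk; have k72 : (k < 72)%N by apply: ltn_trans hk _.
by apply: (coroot_gen E6_subgroup) => // s; apply: E6_root => //; apply: ropp_lt.
Qed.

Lemma E6_groupE : @E6_group K = rd_group (@E6_torus K) (@rootx K) simpleG ropp.
Proof.
apply/seteqP; split.
  apply: generated_gen_sub; first exact: (rd_group_unit (root_datumG K)).
  move=> g [i [t hg]]; apply: sub_generated; right; exists (nat_of_ord i), t.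
  split; first exact: ltn_ord.
  by case: hg => ->; rewrite ?x_posE ?x_negE; auto.
apply: (generated_sub E6_subgroup) => g [/E6_has_torus //|[i [s [Si hg]]]].
have i72 : (i < 72)%N by apply: ltn_trans Si _.
by case: hg => ->; apply: E6_root => //; apply: ropp_lt.
Qed.

Lemma det_E6 g : E6_group g -> \det (g : 'M[K]_27) = 1.
Proof.
move=> Eg; have : [set g : 'M[K]_27 | \det g = 1] g; last by [].
apply: generated_sub Eg; first split.
- by move=> h /= dh; rewrite unitmxE dh unitr1.
- by rewrite /= det1.
- by move=> h h' /= dh dh'; rewrite det_mulmx dh dh' mulr1.
- by move=> h /= dh; rewrite det_inv dh invr1.
- by move=> h [i [t [->|->]]]; rewrite /= ?x_posE ?x_negE det_rootx.
Qed.

End E6Group.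

(** * The invariant cubic form *)

(* The E_6-invariant cubic form on the minuscule module: the monomials x_a x_b x_c
   with a + b + c of weight zero, according to their sign. *)
Definition cubic_pos : seq (nat * nat * nat) :=
  [:: (0, 12, 26); (0, 17, 24); (0, 21, 22); (1, 13, 25); (1, 18, 23);
   (2, 8, 26); (2, 14, 24); (2, 19, 20); (3, 9, 25); (3, 16, 22); (4, 5, 26);
   (4, 14, 21); (4, 17, 18); (5, 11, 23); (5, 15, 20); (6, 7, 24);
   (6, 13, 19); (7, 10, 22); (8, 9, 21); (8, 15, 16); (9, 12, 18);
   (10, 11, 17); (12, 13, 14)]%N.

Definition cubic_neg : seq (nat * nat * nat) :=
  [:: (0, 15, 25); (0, 19, 23); (1, 10, 26); (1, 16, 24); (1, 20, 21);
   (2, 11, 25); (2, 18, 22); (3, 6, 26); (3, 14, 23); (3, 17, 20);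
   (4, 7, 25); (4, 16, 19); (5, 9, 24); (5, 13, 22); (6, 11, 21);
   (6, 15, 18); (7, 8, 23); (7, 12, 20); (8, 13, 17); (9, 10, 19);
   (10, 14, 15); (11, 12, 16)]%N.

Definition cubic_terms (a : nat) (l : seq (nat * nat * nat)) : seq (nat * nat) :=
  flatten [seq let: (i, j, k) := t in
    if i == a then [:: (j, k); (k, j)] else
    if j == a then [:: (i, k); (k, i)] else
    if k == a then [:: (i, j); (j, i)] else [::] | t <- l].

Definition cubic_mat (a : nat) : spmx :=
  [seq (t, BinNums.Zpos BinNums.xH) | t <- cubic_terms a cubic_pos] ++
  [seq (t, BinNums.Zneg BinNums.xH) | t <- cubic_terms a cubic_neg].

Definition cubic_tab : seq spmx := Eval vm_compute in
  [seq cubic_mat a | a <- iota 0 27].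
Definition cmat (a : nat) : spmx := nth [::] cubic_tab a.

Lemma check_cubic_inv : all (fun k => all (fun a => szero (
    flatten [seq sscale e.2 (cmat e.1.1) | e <- rmat k & e.1.2 == a] ++
    smul 27 (str (rmat k)) (cmat a) ++ smul 27 (cmat a) (rmat k))) (iota 0 27))
  (iota 0 72).
Proof. by vm_compute. Qed.

Lemma check_cubic_sym : all (fun a => all (fun b => all (fun c =>
    BinInt.Z.eqb (scoef (cmat a) b c) (scoef (cmat a) c b) &&
    BinInt.Z.eqb (scoef (cmat a) b c) (scoef (cmat b) a c))
  (iota 0 27)) (iota 0 27)) (iota 0 27).
Proof. by vm_compute. Qed.

(* Two entries of a root vector are linked by the invariance of the cubic form,
   so that a matrix with the same support which is a derivation of the cubic
   form is proportional to the root vector. *)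
Lemma check_link : all (fun k => all (fun e => all (fun e' => (e.1 == e'.1) ||
    has (fun c => let x := scoef (cmat e.1.1) e'.1.2 c in
      let y := scoef (cmat e.1.2) e'.1.1 c in
      [&& BinInt.Z.eqb (BinInt.Z.mul x x) (BinNums.Zpos BinNums.xH),
          c \notin [seq d.1.2 | d <- rmat k] &
          BinInt.Z.eqb (BinInt.Z.add (BinInt.Z.mul e.2 x) (BinInt.Z.mul e'.2 y))
            BinNums.Z0]) (iota 0 27)) (rmat k)) (rmat k)) (iota 0 72).
Proof. by vm_compute. Qed.

Lemma check_entries : all (fun k => [&& uniq [seq e.1.1 | e <- rmat k],
    uniq [seq e.1.2 | e <- rmat k], rmat k != [::] &
    all (fun e => BinInt.Z.eqb (BinInt.Z.mul e.2 e.2) (BinNums.Zpos BinNums.xH))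
      (rmat k)]) (iota 0 72).
Proof. by vm_compute. Qed.

#[global] Opaque cmat cubic_tab.

HB.lock Definition cubm (K : fieldType) (a : nat) : 'M[K]_27 :=
  imx K 27 27 (cmat a).

Section CrossProduct.
Variable K : numFieldType.
Implicit Types (x y : 'cV[K]_27) (g E : 'M[K]_27).

Lemma cubmE a : cubm K a = imx K 27 27 (cmat a).
Proof. by rewrite cubm.unlock. Qed.

(* The row vector cross x y represents the linear form C(x, y, -). *)
Definition cross x y : 'rV[K]_27 := \sum_(a < 27) x a 0 *: (y^T *m cubm K a).

Lemma crossDl x x' y : cross (x + x') y = cross x y + cross x' y.
Proof.
rewrite -big_split; apply: eq_bigr => a _.
by rewrite /= !mxE scalerDl.
Qed.

Lemma crossZl c x y : cross (c *: x) y = c *: cross x y.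
Proof.
by rewrite scaler_sumr; apply: eq_bigr => a _; rewrite /= !mxE scalerA.
Qed.

Lemma crossDr x y y' : cross x (y + y') = cross x y + cross x y'.
Proof.
rewrite -big_split; apply: eq_bigr => a _.
by rewrite /= linearD mulmxDl scalerDr.
Qed.

Lemma crossZr c x y : cross x (c *: y) = c *: cross x y.
Proof.
rewrite scaler_sumr; apply: eq_bigr => a _.
by rewrite /= linearZ /= -scalemxAl !scalerA mulrC.
Qed.

Lemma cross0l y : cross 0 y = 0.
Proof. by rewrite -(scale0r 0) crossZl scale0r. Qed.

Lemma cross0r x : cross x 0 = 0.
Proof. by rewrite -(scale0r 0) crossZr scale0r. Qed.

Lemma cross_suml I (r : seq I) (F : I -> 'cV[K]_27) y :
  cross (\sum_(i <- r) F i) y = \sum_(i <- r) cross (F i) y.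
Proof.
elim: r => [|i r IH]; first by rewrite !big_nil cross0l.
by rewrite !big_cons crossDl IH.
Qed.

Lemma cross_delta_l (a : 'I_27) y : cross (delta_mx a 0) y = y^T *m cubm K a.
Proof.
rewrite /cross (bigD1 a) //= big1 => [|b /negbTE ba].
  by rewrite mxE !eqxx scale1r addr0.
by rewrite mxE eq_sym eq_sym ba scale0r.
Qed.

Lemma cross_delta (a b c : 'I_27) :
  cross (delta_mx a 0) (delta_mx b 0) 0 c = zr K (scoef (cmat a) b c).
Proof. by rewrite cross_delta_l trmx_delta -rowE cubmE !mxE. Qed.

Definition cubic_derivation E : Prop :=
  forall x y, cross (E *m x) y + cross x (E *m y) + cross x y *m E = 0.

Lemma col_delta_sum x : x = \sum_a x a 0 *: delta_mx a 0.
Proof.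
apply/colP => i; rewrite summxE (bigD1 i) //= big1 => [|j /negbTE ji].
  by rewrite !mxE !eqxx mulr1 addr0.
by rewrite !mxE eq_sym ji mulr0.
Qed.

Lemma rvect_derivation k : cubic_derivation (rvect K k).
Proof.
have [h|h] := ltnP k 72; last first.
  by move=> x y; rewrite rvect_big // !mul0mx mulmx0 cross0l cross0r !addr0.
have D a y : cross (rvect K k *m delta_mx a 0) y +
    y^T *m ((rvect K k)^T *m cubm K a + cubm K a *m rvect K k) = 0.
  have := imx_szero K 27 27 (all_iota0P (all_iota0P check_cubic_inv h) (ltn_ord a)).
  rewrite !imx_cat !imx_mul imx_tr -!rvectE -!cubmE => E0.
  rewrite -[RHS](mulmx0 _ (y^T)) -E0 !mulmxDr; congr (_ + _).
  have -> : cross (rvect K k *m delta_mx a 0) y =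
      y^T *m \sum_b rvect K k b a *: cubm K b.
    rewrite -colE mulmx_sumr; apply: eq_bigr => b _.
    by rewrite [X in X *: _]mxE scalemxAr.
  congr (_ *m _); rewrite rvectE.
  have /and4P [u1 u2 _ _] := all_iota0P check_entries h.
  elim: (rmat k) {u1 u2 E0} => [|[[i j] z] l IH] /=.
    by rewrite imx_nil big1 // => b _; rewrite mxE scale0r.
  have e : \sum_(b < 27) imx K 27 27 ((i, j, z) :: l) b a *: cubm K b =
     \sum_(b < 27) (if (i == b :> nat) && (j == a :> nat) then zr K z else 0)
        *: cubm K b + \sum_(b < 27) imx K 27 27 l b a *: cubm K b.
    rewrite -big_split; apply: eq_bigr => b _.
    by rewrite imx_cons mxE scalerDl mxE.
  rewrite e IH; case: (eqVneq j a) => ja /=; last first.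
    by rewrite big1 ?add0r // => b _; rewrite andbF scale0r.
  rewrite imx_cat imx_scale -cubmE; congr (_ + _).
  have [hi|hi] := ltnP i 27.
    rewrite (bigD1 (Ordinal hi)) //= eqxx big1 ?addr0 // => b ne.
    rewrite andbT; case: eqP => [ib|]; rewrite ?scale0r //.
    by case/eqP: ne; apply: val_inj.
  rewrite big1 => [|b _]; last first.
    by case: eqP => [ib|]; rewrite ?scale0r //; move: hi; rewrite ib leqNgt ltn_ord.
  rewrite cubmE -[cmat i]/(nth _ _ _) nth_default ?imx_nil ?scaler0 //.
move=> x y; rewrite {1 2 3}(col_delta_sum x) mulmx_sumr !cross_suml mulmx_suml.
rewrite -!big_split big1 // => a _ /=.
rewrite -scalemxAr !crossZl -scalemxAl -!scalerDr.
rewrite -addrA cross_delta_l cross_delta_l trmx_mul -!mulmxA -mulmxDr D.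
by rewrite scaler0.
Qed.

(** With [cross x y] read as the form C(x, y, -), the condition is C(g x, g y, g z) = C(x, y, z). *)
Definition cubic_preserving : set 'M[K]_27 :=
  [set g | g \in unitmx /\ forall x y, cross (g *m x) (g *m y) *m g = cross x y].

Lemma cubic_preserving_subgroup : subgroup cubic_preserving.
Proof.
split.
- by move=> g [].
- by split=> [|x y]; rewrite ?unitmx1 // mulmx1 !mul1mx.
- move=> g h [ug hg] [uh hh]; split=> [|x y]; first by rewrite unitmx_mul ug.
  by rewrite -(mulmxA g h x) -(mulmxA g h y) (mulmxA _ g h) hg hh.
- move=> g [ug hg]; split=> [|x y]; first by rewrite unitmx_inv.
  by have := hg (invmx g *m x) (invmx g *m y); rewrite !mulKVmx // => <-;
     rewrite mulmxK.
Qed.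

(** In the expansion in s the linear term vanishes as E is a derivation. The others reduce to C(E x,
    E y, -): the derivation identity at (E x, y) and (x, E y), together with E E = 0, gives twice
    this form as zero. *)
Lemma derivation_preserving E s : cubic_derivation E -> E *m E = 0 ->
  1%:M + s *: E \in unitmx -> cubic_preserving (1%:M + s *: E).
Proof.
move=> dE E2 u; split=> // x y.
have EE p (z : 'M[K]_(27, p)) : E *m (E *m z) = 0 by rewrite mulmxA E2 mul0mx.
have d1 := dE x y.
have d2 := dE (E *m x) y; rewrite EE cross0l add0r in d2.
have d3 := dE x (E *m y); rewrite EE cross0r addr0 in d3.
have d4 := dE (E *m x) (E *m y); rewrite !EE cross0l cross0r !add0r in d4.
have d5 := congr1 (mulmx^~ E) d1.
rewrite /= !mulmxDl mul0mx -mulmxA E2 mulmx0 addr0 in d5.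
rewrite !mulmxDl !mul1mx -!scalemxAl !(crossDl, crossDr, crossZl, crossZr).
rewrite mulmxDr mulmx1 -scalemxAr !mulmxDl -!scalemxAl d4.
move: d1 d2 d3 d5.
move: (cross (E *m x) y) (cross x (E *m y)) (cross (E *m x) (E *m y))
  (cross x y) => a b c e d1 d2 d3 d5.
have aE : a *m E = - c by apply/eqP; rewrite -addr_eq0 addrC d2.
have bE : b *m E = - c by apply/eqP; rewrite -addr_eq0 addrC d3.
have c0 : c = 0.
  apply/eqP; have /eqP : 2 *: c = 0.
    by rewrite -[RHS]oppr0 -d5 aE bE -opprD opprK scaler_nat mulr2n.
  by rewrite scaler_eq0 pnatr_eq0.
have eE : e *m E = - (a + b) by apply/eqP; rewrite -addr_eq0 addrC d1.
rewrite aE bE eE c0 ?mul0mx oppr0 ?scaler0 ?addr0.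
by apply/rowP => i; rewrite !mxE; ring.
Qed.

Lemma E6_preserves g : E6_group g -> cubic_preserving g.
Proof.
apply: (generated_sub cubic_preserving_subgroup) => {}g [i [t h]].
have pr k : cubic_preserving (rootx k t).
  apply: derivation_preserving; [exact: rvect_derivation|exact: rvect_sq|].
  exact: rootx_unit.
by case: h => ->; rewrite ?x_posE ?x_negE.
Qed.

End CrossProduct.

(** * Identification of the root subgroups defined by weights *)

Lemma check_norm : all (fun k =>
  foldr (fun j s => (rvec k)`_j *
    foldr (fun l s' => (rvec k)`_l * E6_cartan l j + s') 0 (iota 0 6) + s) 0
    (iota 0 6) == 2) (iota 0 72).
Proof. by vm_compute. Qed.

Lemma check_weights : (uniq wtab) && all (fun w => size w == 6) wtab.
Proof. by vm_compute. Qed.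

Lemma check_support_full : all (fun k => all (fun b => let w := row_weight k b in
  all (fun a => (nth [::] wtab a == w) ==> ((a, b) \in [seq e.1 | e <- rmat k]))
    (iota 0 27)) (iota 0 27)) (iota 0 72).
Proof. by vm_compute. Qed.

Lemma check_highest : all (fun j => (rvec 35)`_j == [:: 1; 2; 2; 3; 2; 1]`_j) (iota 0 6).
Proof. by vm_compute. Qed.

Lemma size_wtab : size wtab = 27. Proof. by vm_compute. Qed.

Lemma scoef_uniq l a b z : uniq [seq e.1.2 | e <- l] -> ((a, b), z) \in l ->
  scoef l a b = z.
Proof.
elim: l => //= -[[a' b'] z'] l IH /= /andP [nb ul]; rewrite inE.
case/predU1P => [[-> -> ->]|h].
  rewrite !eqxx /= scoef_notin ?BinInt.Z.add_0_r //.
  by apply: contra nb => /mapP [e el E]; apply/mapP; exists e => //; rewrite -E.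
have nbb : b' != b.
  by apply: contraNneq nb => ->; apply/mapP; exists ((a, b), z).
by rewrite (negbTE nbb) andbF; apply: IH.
Qed.

Lemma entry_uniq (T U : eqType) (f : T -> U) (l : seq T) e e' :
  uniq (map f l) -> e \in l -> e' \in l -> f e = f e' -> e = e'.
Proof.
elim: l => //= d l IH /andP [nd ul]; rewrite !inE.
have h x y : x = d -> y \in l -> f x = f y -> False.
  by move=> -> yl E; move/negP: nd; apply; rewrite E; apply/mapP; exists y.
case/predU1P => [ed|el] /predU1P [ed'|el'] E; rewrite ?ed ?ed' //.
- by case: (h _ _ ed el').
- by case: (h _ _ ed' el).
- exact: IH.
Qed.

Section RootSubgroups.
Variable K : numClosedFieldType.

Lemma poly_eval_inj (p q : {poly K}) : (forall s, p.[s] = q.[s]) -> p = q.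
Proof.
move=> h; apply/eqP; rewrite -subr_eq0; apply/negPn/negP.
by case/closed_nonrootP => s; rewrite rootE !hornerE h subrr eqxx.
Qed.

Lemma two_expz_inj : injective (fun z : int => (2 : K) ^ z).
Proof.
have two0 : (2 : K) != 0 by rewrite pnatr_eq0.
have h n : (2 : K) ^+ n = 1 -> n = 0%N.
  move=> /eqP; rewrite -natrX (eqr_nat K _ 1) => /eqP.
  by case: n => // n /eqP; rewrite expnS muln_eq1.
move=> x y /= e; apply/eqP; rewrite -subr_eq0.
have : (2 : K) ^ (x - y) = 1 by rewrite expfzDr // e -expfzDr // subrr expr0z.
case: (x - y) => n; first by rewrite -exprnP => /h ->.
rewrite NegzE -invr_expz => e1; have : (2 : K) ^+ n.+1 = 1 by
  rewrite exprnP -[LHS]invrK e1 invr1.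
by move/h.
Qed.

Lemma cubic_poly_linear n (a b c : 'rV[K]_n) :
  (forall s, s *: a + s ^+ 2 *: b + s ^+ 3 *: c = 0) -> a = 0.
Proof.
(* The combination 6 p(1) - 2 p(-1) - p(2) of the values of the cubic p removes its quadratic and
   cubic terms. *)
move=> h; have E : 6 *: a = 6 *: (1 *: a + 1 ^+ 2 *: b + 1 ^+ 3 *: c) -
    2 *: ((-1) *: a + (-1) ^+ 2 *: b + (-1) ^+ 3 *: c) -
    (2 *: a + 2 ^+ 2 *: b + 2 ^+ 3 *: c).
  by apply/rowP => i; rewrite !mxE; ring.
move: E; rewrite !h !scaler0 !subr0 => /eqP.
by rewrite scaler_eq0 pnatr_eq0 => /eqP.
Qed.

Definition rweight k (j : 'I_6) : int := \sum_l rcoef k l * E6_cartan l j.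

Lemma wt_diff_root k (a b : 'I_27) : (k < 72)%N ->
  (forall j : 'I_6, (wt a)`_j = (wt b)`_j + rweight k j) ->
  (nat_of_ord a, nat_of_ord b) \in [seq e.1 | e <- rmat k].
Proof.
have /andP [_ /allP s6] := check_weights.
move=> hk h; have := all_iota0P (all_iota0P (all_iota0P check_support_full hk)
  (ltn_ord b)) (ltn_ord a).
move/implyP; apply; apply/eqP/(@eq_from_nth _ 0).
  by rewrite size_mkseq; apply/eqP; apply: s6; rewrite mem_nth // size_wtab.
move=> j; have -> : size (nth [::] wtab a) = 6.
  by apply/eqP; apply: s6; rewrite mem_nth // size_wtab.
move=> hj; have := h (Ordinal hj); rewrite !wtE /= => ->.
by rewrite nth_mkseq //; congr (_ + _); rewrite /rweight !big_ord_recl big_ord0.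
Qed.

(** Pairing with the coroot of k, the two weights differ by 2m, while both values lie between -1 and
    1. *)
Lemma wt_diff_mult k (a b : 'I_27) (m : nat) : (k < 72)%N ->
  (forall j : 'I_6, (wt a)`_j = (wt b)`_j + m%:Z * rweight k j) -> (m <= 1)%N.
Proof.
move=> hk h.
have E : coroot_pairing k a = coroot_pairing k b + 2 * m%:Z.
  have /eqP <- := all_iota0P check_norm hk; rewrite /coroot_pairing /=.
  have hj (j : nat) (hj : (j < 6)%N) := h (Ordinal hj).
  have := (hj 0 isT, hj 1 isT, hj 2 isT, hj 3 isT, hj 4 isT, hj 5 isT)%N.
  rewrite !wtE /= /rweight !big_ord_recl !big_ord0 /= /bump /= /rcoef.
  by move=> [[[[[-> ->] ->] ->] ->] ->] /=; ring.
have := coroot_pairing_cases hk (ltn_ord a).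
have := coroot_pairing_cases hk (ltn_ord b).
by rewrite !inE E => /or3P [] /eqP -> /or3P [] /eqP; lia.
Qed.

Lemma derivation_prop k (X : 'M[K]_27) : (k < 72)%N -> cubic_derivation X ->
  (forall a b, X a b != 0 -> (nat_of_ord a, nat_of_ord b) \in [seq e.1 | e <- rmat k]) ->
  exists c, X = c *: rvect K k.
Proof.
move=> hk dX sX; have /and4P [u1 u2 nE /allP sq] := all_iota0P check_entries hk.
have lt e : e \in rmat k -> (e.1.1 < 27)%N && (e.1.2 < 27)%N.
  by move=> eL; have /andP [/andP [_ -> ->]] := allP (all_iota0P check_support hk) _ eL.
pose val (e : nat * nat * BinNums.Z) : K := X (inord e.1.1) (inord e.1.2).
have iv i : (i < 27)%N -> nat_of_ord (inord i : 'I_27) = i by move=> h; rewrite inordK.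
have colX e : e \in rmat k -> X *m delta_mx (inord e.1.2) 0 =
    val e *: delta_mx (inord e.1.1) (0 : 'I_1).
  move=> eL; have /andP [l1 l2] := lt _ eL.
  rewrite -colE; apply/colP => i; rewrite !mxE eqxx andbT.
  have [->|ne] := eqVneq i (inord e.1.1); first by rewrite mulr1.
  rewrite mulr0; apply/eqP/negPn/negP => /sX /mapP [e' e'L E'].
  have E2 : e'.1.2 = e.1.2 by rewrite -E' /= iv.
  have E := entry_uniq u2 e'L eL E2.
  by case/eqP: ne; apply/val_inj; rewrite /= iv // -E -E'.
have link e e' : e \in rmat k -> e' \in rmat k ->
    val e * zr K e.2 = val e' * zr K e'.2.
  move=> eL e'L; have [e12|ne] := eqVneq e.1 e'.1.
    by have -> : e = e' by apply: entry_uniq u2 eL e'L _; rewrite e12.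
  have := allP (allP (all_iota0P check_link hk) _ eL) _ e'L.
  rewrite (negbTE ne) orFb => /hasP [c]; rewrite mem_iota => c27 /=.
  set x := scoef _ _ _; set y := scoef _ _ _.
  case/and3P => /BinInt.Z.eqb_spec xx cn /BinInt.Z.eqb_spec xy.
  have /andP [l1 l2] := lt _ eL; have /andP [l1' l2'] := lt _ e'L.
  (* The derivation identity at the basis vectors of the two columns, in coordinate c. As c is not a
     column of the support, the third term vanishes and exactly the two entries remain. *)
  have := dX (delta_mx (inord e.1.2) 0) (delta_mx (inord e'.1.2) 0).
  rewrite !colX // crossZl crossZr => /rowP /(_ (inord c)).
  rewrite mxE [X in X + _]mxE [X in X + _ + _]mxE [X in _ + X + _]mxE.
  rewrite !cross_delta !iv // -/x -/y [X in _ + X]mxE big1 => [|d _]; last first.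
    have [->|/sX] := eqVneq (X d (inord c)) 0; first by rewrite mulr0.
    case/mapP => e0 e0L E0; case/negP: cn; apply/mapP; exists e0 => //.
    by rewrite -E0 /= iv.
  rewrite addr0 [RHS]mxE => D.
  have xx' : zr K x * zr K x = 1 by rewrite -zrM xx.
  have xy' : zr K e.2 * zr K x + zr K e'.2 * zr K y = 0 by rewrite -!zrM -zrD xy.
  have zz' : zr K e'.2 * zr K e'.2 = 1.
    by rewrite -zrM; have /BinInt.Z.eqb_spec -> := sq _ e'L.
  have zz : zr K e.2 * zr K e.2 = 1.
    by rewrite -zrM; have /BinInt.Z.eqb_spec -> := sq _ eL.
  move: (val e) (val e') (zr K x) (zr K y) (zr K e.2) (zr K e'.2) D xx' xy' zz' zz.
  move=> p q a b z z' D aa ab zz' zz.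
  have ea : p * a = - (q * b) by apply/eqP; rewrite -addr_eq0 D.
  have ez : z * a = - (z' * b) by apply/eqP; rewrite -addr_eq0 ab.
  have bb : b * b = 1.
    by rewrite -[LHS]mul1r -zz' mulrACA -[LHS]mulrNN -ez mulrACA zz aa mulr1.
  by rewrite -[LHS]mulr1 -aa mulrACA ea ez mulrNN mulrACA bb mulr1.
have [e0 e0L] : exists e0, e0 \in rmat k.
  by case: (rmat k) nE => // e0 l _; exists e0; rewrite inE eqxx.
exists (val e0 * zr K e0.2); apply/matrixP => a b.
rewrite mxE; have [/mapP [e eL Ee]|nin] := boolP ((nat_of_ord a, nat_of_ord b)
    \in [seq e.1 | e <- rmat k]).
  have Ez : rvect K k a b = zr K e.2.
    rewrite rvectE mxE; congr zr; apply: scoef_uniq u2 _.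
    by rewrite Ee; case: (e) eL.
  have -> : X a b = val e by rewrite /val -Ee /= !inord_val.
  rewrite Ez (link e0 e) // -mulrA -zrM.
  by have /BinInt.Z.eqb_spec -> := sq _ eL; rewrite mulr1.
have -> : X a b = 0 by apply/eqP; apply: contraNT nin; apply: sX.
have -> : rvect K k a b = 0 by rewrite rvectE mxE scoef_notin.
by rewrite mulr0.
Qed.

(** Equivariance under T allows s^m in the entry (a, b) only if the weights of a and b differ by m
    times the root, so m <= 1 and u(s) = 1 + s X. Preservation of the cubic form makes X a
    derivation with the support of the root vector, hence a multiple of it. *)
Lemma root_subgroup_sub k g : (k < 72)%N -> root_subgroup (rcoef k) g ->
  exists s : K, g = rootx k s.
Proof.
move=> hk [u [hE hD [q hq] hT] [s0 ->]].
have two0 : (2 : K) != 0 by rewrite pnatr_eq0.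
have coef_wt a b m : (q a b)`_m != 0 ->
    forall j : 'I_6, (wt a)`_j = (wt b)`_j + m%:Z * rweight k j.
  (* This torus element sees only coordinate j of a weight, and the powers of 2 are distinct in K,
     so exponents can be compared. *)
  move=> nz j; pose t (i : 'I_6) : K := if i == j then 2 else 1.
  have t0 : nonzero_fun t by move=> i; rewrite /t; case: ifP; rewrite ?oner_neq0.
  have prodt (w : 'I_6 -> int) : \prod_i t i ^ w i = 2 ^ w j.
    rewrite (bigD1 j) //= big1 ?mulr1 /t ?eqxx // => i /negbTE ->.
    by rewrite exp1rz.
  have ch : root_char (rcoef k) t = 2 ^ rweight k j by rewrite /root_char prodt.
  have hs s : 2 ^ (wt a)`_j * (q a b).[s] =
      (q a b).[2 ^ rweight k j * s] * 2 ^ (wt b)`_j.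
    have /matrixP /(_ a b) : torus_elt t *m u s =
        u (root_char (rcoef k) t * s) *m torus_elt t.
      by rewrite -hT // mulmxKV // torus_elt_unit.
    by rewrite torus_mull torus_mulr !prodt !hq ch.
  pose p := \poly_(i < size (q a b)) ((2 ^ rweight k j) ^+ i * (q a b)`_i).
  have : 2 ^ (wt a)`_j *: q a b = 2 ^ (wt b)`_j *: p.
    apply: poly_eval_inj => s; rewrite !hornerZ hs mulrC; congr (_ * _).
    rewrite horner_poly horner_coef; apply: eq_bigr => i _.
    by rewrite exprMn mulrCA mulrA.
  move/polyP/(_ m); rewrite !coefZ coef_poly; case: ltnP => [_|]; last first.
    by move/leq_sizeP/(_ _ (leqnn _)) => z; rewrite z eqxx in nz.
  rewrite mulrA => /(mulIf nz); rewrite exprnP exprz_exp -expfzDr // => e.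
  by rewrite [X in _ + X]mulrC; apply: two_expz_inj.
have size2 a b : (size (q a b) <= 2)%N.
  apply/leq_sizeP => m hm; apply/eqP/negPn/negP => /coef_wt /(wt_diff_mult hk).
  by rewrite leqNgt hm.
have u0 : u 0 = 1%:M.
  have un : u 0 \in unitmx by apply: subgroup_unit (E6_subgroup K) (hE 0).
  by rewrite -[LHS](mulmxK un) -hD addr0 mulmxV.
pose X := \matrix_(a, b) (q a b)`_1.
have uX s : u s = 1%:M + s *: X.
  apply/matrixP => a b; rewrite hq (horner_coef_wide _ (size2 a b)).
  rewrite !big_ord_recl big_ord0 expr0 mulr1 addr0 !mxE expr1 mulrC.
  by congr (_ + _); rewrite -horner_coef0 -hq u0 mxE.
have sX a b : X a b != 0 ->
    (nat_of_ord a, nat_of_ord b) \in [seq e.1 | e <- rmat k].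
  rewrite mxE => /coef_wt h; apply: wt_diff_root => // j.
  by rewrite h mul1r.
have dX : cubic_derivation X.
  move=> x y; apply: (@cubic_poly_linear _ _
    (cross (X *m x) (X *m y) + cross (X *m x) y *m X + cross x (X *m y) *m X)
    (cross (X *m x) (X *m y) *m X)) => s.
  have [_ /(_ x y)] := E6_preserves (hE s); rewrite uX.
  rewrite !mulmxDl !mul1mx -!scalemxAl !(crossDl, crossDr, crossZl, crossZr).
  rewrite mulmxDr mulmx1 -scalemxAr !mulmxDl -!scalemxAl.
  move: (cross (X *m x) y) (cross x (X *m y)) (cross (X *m x) (X *m y))
    (cross x y) => a b c e.
  move: (a *m X) (b *m X) (c *m X) (e *m X) => aX bX cX eX.
  move/eqP; rewrite -subr_eq0 => /eqP <-.
  by apply/rowP => i; rewrite !mxE; ring.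
have [c ec] := derivation_prop hk dX sX.
by exists (s0 * c); rewrite uX ec scalerA.
Qed.

Lemma root_subgroupE k : (k < 72)%N ->
  root_subgroup (rcoef k) = [set g | exists s : K, g = rootx k s].
Proof.
move=> hk; apply/seteqP; split=> g; first exact: root_subgroup_sub.
move=> [s ->]; exists (@rootx K k); last by exists s.
split.
- by move=> t; apply: E6_root.
- exact: rootxD.
- exists (\matrix_(a, b) (((a == b)%:R)%:P + rvect K k a b *: 'X)) => t a b.
  by rewrite !mxE !hornerE mulrC.
- by move=> t r t0; rewrite torus_rootx // mulmxK // torus_elt_unit.
Qed.

Lemma simple_rootE (i : 'I_6) : simple_root i = rcoef i.
Proof.
apply/funext => j; rewrite /simple_root /rcoef.
have /eqP -> := all_iota0P (all_iota0P check_simple_vec (ltn_ord i)) (ltn_ord j).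
by rewrite eq_sym natz.
Qed.

Lemma highest_rootE : highest_root = rcoef 35.
Proof.
apply/funext => j; rewrite /highest_root /rcoef.
by have /eqP -> := all_iota0P check_highest (ltn_ord j).
Qed.

Lemma A5A1_groupE :
  @A5A1_group K = rd_group (@E6_torus K) (@rootx K) simpleH ropp.
Proof.
rewrite /A5A1_group /rd_group; congr generated; congr (_ `|` _).
have oppE k : (k < 72)%N -> (fun j => - rcoef k j) = rcoef (ropp k).
  by move=> hk; apply/funext => j; rewrite rcoef_opp.
apply/seteqP; split=> g.
  move=> [c hc]; have [k Sk ec] : exists2 k, simpleH k & c = rcoef k.
    case: hc => [->|[i ni ->]]; first by exists 35%N => //; exact: highest_rootE.
    exists (nat_of_ord i); last exact: simple_rootE.
    move: ni; rewrite -val_eqE /= inordK // /simpleH !inE.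
    by case: i => [[|[|[|[|[|[|]]]]]] hi].
  have /andP [/refl_root_lt k36 _] := simpleH_refl Sk.
  have k72 : (k < 72)%N by apply: ltn_trans k36 _.
  rewrite ec oppE // !root_subgroupE ?ropp_lt //.
  by case=> -[s ->]; exists k, s; split; auto.
move=> [k [s [Sk hg]]]; have /andP [/refl_root_lt k36 _] := simpleH_refl Sk.
have k72 : (k < 72)%N by apply: ltn_trans k36 _.
exists (rcoef k).
  move: Sk; rewrite /simpleH !inE => Sk.
  have [->|k35] := eqVneq k 35%N; first by left; rewrite highest_rootE.
  have k6 : (k < 6)%N.
    case/predU1P: (Sk) => [-> //|]; do 4?[case/predU1P => [-> //|]].
    by rewrite (negbTE k35).
  right; exists (Ordinal k6); last by rewrite simple_rootE.
  rewrite -val_eqE /= inordK //; apply/eqP => k1; move: Sk; rewrite k1.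
  by [].
rewrite oppE // !root_subgroupE ?ropp_lt //.
by case: hg => ->; [left|right]; exists s.
Qed.

Lemma A5A1_subgroup : subgroup (@A5A1_group K).
Proof. by rewrite A5A1_groupE; apply: rd_group_subgroup (root_datumH K). Qed.

Lemma A5A1_sub : @A5A1_group K `<=` @E6_group K.
Proof.
rewrite A5A1_groupE; apply: (generated_sub (E6_subgroup K)).
move=> g [/E6_has_torus //|[k [s [Sk hg]]]].
have /andP [/refl_root_lt k36 _] := simpleH_refl Sk.
have k72 : (k < 72)%N by apply: ltn_trans k36 _.
by case: hg => ->; apply: E6_root => //; apply: ropp_lt.
Qed.

End RootSubgroups.

(** * Maximal parabolic subgroups *)

Section Parabolic.
Variable K : numClosedFieldType.

Definition parabolic (i : nat) : set 'M[K]_27 :=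
  rd_parabolic (@E6_torus K) (@rootx K) posG simpleG ropp (fun g => g <> i).

(** Polynomial functions of one parameter, as opposed to [polyfun] on matrices. *)
Definition poly_fun (f : K -> K) : Prop := exists p : {poly K}, forall s, f s = p.[s].

Lemma poly_fun_alg : funalg poly_fun.
Proof.
split.
- by move=> c; exists c%:P => s; rewrite hornerC.
- by move=> f g [p hp] [q hq]; exists (p + q) => s; rewrite hp hq hornerD.
- by move=> f g [p hp] [q hq]; exists (p * q) => s; rewrite hp hq hornerM.
Qed.

Lemma rootx_poly k : mxfun poly_fun (fun s : K => rootx k s).
Proof.
move=> a b; exists (((a == b)%:R)%:P + rvect K k a b *: 'X) => s.
by rewrite !mxE !hornerE mulrC.
Qed.

Lemma coroot_rrefl k u : (k < 72)%N -> u != 0 ->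
  coroot_elt k u *m rrefl k 1 = rrefl k 1 *m coroot_elt k u^-1 :> 'M[K]_27.
Proof.
move=> hk u0; have u0' : u^-1 != 0 by rewrite invr_eq0.
rewrite !coroot_eltE // rrefl1E !sl2c_mul invrK.
by apply: sl2c_eq; move: (u^-1) => v; ring.
Qed.

Lemma rootx_oppE_refl k s : s != 0 -> rootx (ropp k) s =
  rootx k s^-1 *m rrefl k (- s^-1) *m rootx k s^-1 :> 'M[K]_27.
Proof.
move=> s0; have xV t : rootx k t *m rootx k (- t) = 1%:M :> 'M[K]_27.
  by rewrite -rootxD subrr rootx0.
have xV' t : rootx k (- t) *m rootx k t = 1%:M :> 'M[K]_27.
  by rewrite -rootxD addNr rootx0.
rewrite /rrefl invrN invrK opprK !mulmxA xV mul1mx.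
by rewrite -mulmxA xV' mulmx1.
Qed.

Section LineStabilizer.
Variables (i : 'I_6) (m : nat) (rho : 'M[K]_27 -> 'M[K]_m) (v : 'cV[K]_m).
Hypotheses (hrho : is_rational_rep (@E6_group K) rho)
  (hv : is_highest_weight_vector i rho v).

Let P := line_stabilizer (@E6_group K) rho v.
Let E6x k s : (k < 72)%N -> @E6_group K (rootx k s) := @E6_root K k s.
Let lt72 k : (k < 6)%N -> (k < 72)%N. Proof. by move=> h; apply: ltn_trans h _. Qed.
Let r1 : rho 1%:M = 1%:M. Proof. by case: hrho. Qed.
Let rM g h : @E6_group K g -> @E6_group K h -> rho (g *m h) = rho g *m rho h.
Proof. by case: hrho => _ + _; apply. Qed.
Let v0 : v != 0. Proof. by case: hv. Qed.

Let rho_inv g : E6_group g -> rho (invmx g) *m rho g = 1%:M.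
Proof.
move=> Eg; have sG := E6_subgroup K.
by rewrite -rM ?mulVmx ?(subgroup_unit sG) //; apply: (subgroupV sG).
Qed.

Let stab_neq0 g c : E6_group g -> rho g *m v = c *: v -> c != 0.
Proof.
move=> Eg e; apply: contraNneq v0 => c0; rewrite c0 scale0r in e.
by rewrite -[v]mul1mx -(rho_inv Eg) -mulmxA e mulmx0.
Qed.

Lemma line_stabilizer_subgroup : subgroup P.
Proof.
have sG := E6_subgroup K; split.
- by move=> g [Eg _]; apply: (subgroup_unit sG).
- split; first exact: (subgroup1 sG).
  by exists 1; rewrite r1 mul1mx scale1r.
- move=> g h [Eg [c ec]] [Eh [d ed]]; split; first exact: (subgroupM sG).
  by exists (d * c); rewrite rM // -mulmxA ed -scalemxAr ec scalerA.
- move=> g [Eg [c ec]]; split; first exact: (subgroupV sG).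
  exists c^-1; have c0 := stab_neq0 Eg ec.
  apply: (scalerI c0); rewrite scalerA divff // scale1r scalemxAr -ec.
  by rewrite mulmxA rho_inv // mul1mx.
Qed.

Let xv k s : (k < 6)%N -> rho (rootx k s) *m v = v.
Proof.
by move=> hk; case: hv => _ + _; move=> /(_ (Ordinal hk) s); rewrite x_posE.
Qed.

Let tv k u : (k < 6)%N -> u != 0 ->
  rho (coroot_elt k u) *m v = (if k == i then u else 1) *: v.
Proof.
move=> hk u0; case: hv => _ _ /(_ _ (coroot_nonzero k u0)) ->.
rewrite /rcoef.
have /eqP -> := all_iota0P (all_iota0P check_simple_vec hk) (ltn_ord i).
by case: (k == i); rewrite ?expr1z ?expr0z.
Qed.

Let E6t k u : (k < 72)%N -> u != 0 -> @E6_group K (coroot_elt k u).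
Proof. by move=> hk u0; apply: E6_has_torus; apply: coroot_torus. Qed.

Let E6n k u : (k < 72)%N -> @E6_group K (rrefl k u).
Proof.
move=> hk; have sG := E6_subgroup K; apply: (subgroupM sG); last exact: E6x.
by apply: (subgroupM sG); apply: E6x => //; apply: ropp_lt.
Qed.

(** The orbit map s -> x_{-k}(s) v is polynomial in s. By the rank one identity it equals x_k(1/s) w
    for s != 0, where w is the reflected vector, fixed by the coroot of k because omega_i vanishes
    on it. So it is polynomial in 1/s too, hence constant. *)
Let stab_opp k s : (k < 6)%N -> k != i -> P (rootx (ropp k) s).
Proof.
move=> hk ki; have k72 := lt72 hk; split; first by apply: E6x; apply: ropp_lt.
exists 1; rewrite scale1r.
pose w := rho (rrefl k 1) *m v.
have hw u : u != 0 -> rho (coroot_elt k u) *m w = w.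
  move=> u0; have u0' : u^-1 != 0 by rewrite invr_eq0.
  rewrite /w mulmxA -rM; [|exact: E6t|exact: E6n].
  rewrite coroot_rrefl // rM; [|exact: E6n|exact: E6t].
  by rewrite -mulmxA tv // (negbTE ki) scale1r.
have F t : t != 0 -> rho (rootx (ropp k) t) *m v = rho (rootx k t^-1) *m w.
  move=> t0; have t0' : - t^-1 != 0 by rewrite oppr_eq0 invr_eq0.
  rewrite rootx_oppE_refl // rM; [|by apply: (subgroupM (E6_subgroup K));
    [apply: E6x|apply: E6n]|exact: E6x].
  rewrite rM; [|exact: E6x|exact: E6n].
  rewrite -!mulmxA xv // rrefl_coroot // rM; [|exact: E6t|exact: E6n].
  by rewrite -(mulmxA (rho (coroot_elt k _))) hw.
have poly_rho j (z : 'cV[K]_m) (a : 'I_m) : (j < 72)%N ->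
    poly_fun (fun t => (rho (rootx j t) *m z) a 0).
  move=> hj; have hA := poly_fun_alg.
  have hr : mxfun poly_fun (fun t => rho (rootx j t)).
    move=> b c; case: hrho => _ _ /(_ b c) [p [l hp]].
    apply: (@fa_ext _ _ _ (fun t => p.@[fun k => mxvec (rootx j t) 0 k])).
      apply: (@fa_meval _ _ _ hA _ p (fun l t => mxvec (rootx j t) 0 l)) => l'.
      case/mxvec_indexP: l' => b' c'.
      by apply: fa_ext (rootx_poly j b' c') _ => t; rewrite mxvecE.
    move=> t; rewrite hp; last exact: E6x.
    by rewrite (det_E6 (E6x t hj)) expr1n divr1.
  exact: (mxfun_mul hA hr (mxfun_const hA z)).
apply/matrixP => a b; rewrite ord1.
have [p hp] := poly_rho (ropp k) v a (ropp_lt k72).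
have [q hq] := poly_rho k w a k72.
have pq t : t != 0 -> p.[t] = q.[t^-1] by move=> t0; rewrite -hp -hq F.
by rewrite hp (poly_inv_const pq) -hp rootx0 r1 mul1mx.
Qed.

(** Otherwise the reflection in alpha_i would stabilize the line of v. It inverts the coroot, so the
    coroot element at 2 would act on v both by 2 and by 1/2. *)
Let stab_opp_i : ~ (forall s, P (rootx (ropp i) s)).
Proof.
move=> hP; have i6 := ltn_ord i; have i72 := lt72 i6.
have Px s : P (rootx i s).
  by split; [exact: E6x|exists 1; rewrite xv // scale1r].
have [_ [c ec]] : P (rrefl i 1).
  have sP := line_stabilizer_subgroup.
  by apply: (subgroupM sP) => //; apply: (subgroupM sP).
have c0 := stab_neq0 (E6n 1 i72) ec.
have two0 : 2 != 0 :> K by rewrite pnatr_eq0.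
have two0' : 2^-1 != 0 :> K by rewrite invr_eq0.
have : rho (coroot_elt i 2 *m rrefl i 1) *m v =
    rho (rrefl i 1 *m coroot_elt i 2^-1) *m v by rewrite coroot_rrefl.
rewrite rM; [|exact: E6t|exact: E6n]; rewrite rM; [|exact: E6n|exact: E6t].
rewrite -!mulmxA ec tv // eqxx -!scalemxAr ec tv // eqxx.
rewrite !scalerA => /eqP; rewrite -subr_eq0 -scalerBl scaler_eq0 (negbTE v0) orbF.
rewrite mulrC -mulrBl mulf_eq0 (negbTE c0) orbF subr_eq0 => /eqP e.
have : (4 : K) = 1 by rewrite -[4]/(2 * 2)%:R natrM {2}e divff.
by move/eqP; rewrite (eqr_nat K 4 1).
Qed.

Theorem line_stabilizerE : P = parabolic i.
Proof.
have sP := line_stabilizer_subgroup.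
have PG : P `<=` rd_group (@E6_torus K) (@rootx K) simpleG ropp.
  by rewrite -E6_groupE => g [].
have BP : rd_borel (@E6_torus K) (@rootx K) posG `<=` P.
  apply: (generated_sub sP) => g [Tg|[k [s [pk ->]]]].
    split; first exact: E6_has_torus.
    by case: Tg => t t0 <-; exists (t i); case: hv => _ _; apply.
  apply: (pos_root_gen sP) => // j t hj; split; first by apply: E6x; apply: lt72.
  by exists 1; rewrite xv // scale1r.
rewrite (overgroup_parabolic (root_datumG K) sP PG BP).
rewrite /parabolic /rd_parabolic; congr generated; congr (_ `|` _).
apply/seteqP; split=> g [k [s [Sk Jk ->]]]; exists k, s; split=> //.
  by move=> ki; apply: stab_opp_i => t; rewrite -ki; apply: Jk.
by move=> t; apply: stab_opp => //; apply/eqP.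
Qed.

End LineStabilizer.

Lemma max_parabolicE (i : 'I_6) (P : set 'M[K]_27) :
  is_max_parabolic i P -> P = parabolic i.
Proof.
by move=> [m [rho [v [hr _ hv ->]]]]; apply: line_stabilizerE hr hv.
Qed.

Lemma parabolic_subgroup i : subgroup (parabolic i).
Proof. exact: (rd_parabolic_subgroup (root_datumG K)). Qed.

Lemma parabolic_sub i : parabolic i `<=` @E6_group K.
Proof.
apply: (generated_sub (E6_subgroup K)).
have lt k : (k < 36)%N -> (k < 72)%N by move=> h; apply: ltn_trans h _.
move=> g [[/E6_has_torus //|[k [s [pk ->]]]]|[k [s [Sk _ ->]]]].
  by apply: E6_root; apply: lt.
by apply: E6_root; apply: ropp_lt; apply: lt; apply: ltn_trans Sk _.
Qed.

Lemma rootx_e0 k s : (k < 36)%N ->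
  rootx k s *m delta_mx 0 0 = delta_mx 0 0 :> 'cV[K]_27.
Proof.
move=> hk; rewrite /rootx mulmxDl mul1mx -scalemxAl -colE.
have -> : col 0 (rvect K k) = 0.
  by apply/colP => a; rewrite !mxE rvect_upper.
by rewrite scaler0 addr0.
Qed.

(** The defining module has highest weight omega_1, so the description of line stabilizers applies
    to the identity representation. *)
Lemma parabolic0E : parabolic 0 = [set g | @E6_group K g /\
  exists c : K, g *m delta_mx 0 (0 : 'I_1) = c *: delta_mx 0 0].
Proof.
rewrite -[0%N]/(nat_of_ord (ord0 : 'I_6)).
rewrite -(@line_stabilizerE ord0 27 id (delta_mx 0 0)) //.
  split=> //; move=> a b; have [p hp] := @polyfun_id K 27 a b.
  by exists p, 0 => g _; rewrite hp divr1.
split.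
- by apply/eqP => /matrixP /(_ 0 0) /eqP; rewrite !mxE !eqxx oner_eq0.
- by move=> j t; rewrite x_posE rootx_e0 //; apply: ltn_trans (ltn_ord j) _.
- move=> t t0; apply/colP => a; rewrite torus_mull !mxE andbT.
  case: (eqVneq a 0) => [->|_]; rewrite ?mulr0 // !mulr1.
  by rewrite wtE /= !big_ord_recl big_ord0 /= expr1z !expr0z !mulr1.
Qed.

End Parabolic.

(** * A Borel subgroup of A5 x A1 *)

Section UpperTriangular.
Variables (K : closedFieldType) (n : nat).

Definition band (k : nat) : set 'M[K]_n :=
  [set M | forall a b : 'I_n, (b < a + k)%N -> M a b = 0].

Definition upper_group : set 'M[K]_n := [set g | g \in unitmx /\ band 0 g].

Lemma band_mul k l M N : band k M -> band l N -> band (k + l) (M *m N).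
Proof.
move=> hM hN a b hab; rewrite mxE big1 // => c _.
have [h|h] := ltnP c (a + k); first by rewrite hM ?mul0r.
rewrite hN ?mulr0 //; apply: leq_trans hab _.
by rewrite addnA leq_add2r.
Qed.

Lemma band_le k l M : (l <= k)%N -> band k M -> band l M.
Proof.
by move=> lk hM a b h; apply: hM; apply: leq_trans h _; rewrite leq_add2l.
Qed.

Lemma band_sub k M N : band k M -> band k N -> band k (M - N).
Proof. by move=> hM hN a b h; rewrite !mxE hM // hN // subr0. Qed.

Lemma band1 : band 0 1%:M.
Proof.
by move=> a b; rewrite addn0 mxE -val_eqE /= => /gtn_eqF ->.
Qed.

Lemma band0_diag M N a : band 0 M -> band 0 N -> (M *m N) a a = M a a * N a a.
Proof.
move=> hM hN; rewrite mxE (bigD1 a) //= big1 ?addr0 // => c.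
rewrite neq_ltn => /orP [ca|ac]; first by rewrite hM ?mul0r ?addn0.
by rewrite hN ?mulr0 ?addn0.
Qed.

(** Triangularity is restated as stability of a flag, because stability passes to the inverse by
    comparing ranks. *)
Lemma band0_flag M : band 0 M <->
  forall k, ((pid_mx k : 'M[K]_n) *m M^T <= (pid_mx k : 'M[K]_n))%MS.
Proof.
split=> [hM k|h a b]; last first.
  rewrite addn0 => ba; have /submxP [D] := h b.+1.
  move/matrixP/(_ b a); rewrite mxE (bigD1 b) //= big1 => [|c /negbTE cb].
    rewrite !mxE eqxx ltnSn mul1r addr0 => ->.
    by rewrite big1 // => c _; rewrite mxE [(_ < b.+1)%N]ltnS leqNgt;
       case: eqP => [->|_]; rewrite ?ba ?mulr0.
  rewrite mxE; case: eqP => [/val_inj e|_]; last by rewrite mul0r.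
  by rewrite e eqxx in cb.
apply/row_subP => a.
have -> : row a (pid_mx k *m M^T) =
    (row a (pid_mx k *m M^T)) *m (pid_mx k : 'M[K]_n).
  apply/rowP => b; rewrite mxE [in RHS]mxE (bigD1 b) //= big1 => [|c /negbTE cb].
    rewrite [row _ _ _ _]mxE [pid_mx k b b]mxE eqxx addr0 /=.
    have [bk|kb] := ltnP b k; rewrite ?mulr1 ?mulr0 //.
    rewrite mxE big1 // => c _; rewrite !mxE.
    case: (eqVneq (a : nat) c) => [ac|_]; rewrite ?mul0r //=.
    have [ak|_] := ltnP a k; rewrite ?mul0r // mul1r hM // addn0 -ac.
    exact: leq_trans kb.
  rewrite [pid_mx k c b]mxE; case: eqP => [/val_inj e|_]; last by rewrite mulr0.
  by rewrite e eqxx in cb.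
exact: submxMl.
Qed.

Lemma upper_subgroup : subgroup upper_group.
Proof.
split.
- by move=> g [].
- by split; [exact: unitmx1|exact: band1].
- move=> g h [ug bg] [uh bh]; split; first by rewrite unitmx_mul ug.
  exact: (band_mul bg bh).
- move=> g [ug /band0_flag bg]; split; first by rewrite unitmx_inv.
  apply/band0_flag => k; rewrite trmx_inv.
  have ut : g^T \in unitmx by rewrite unitmx_tr.
  have rk : \rank ((pid_mx k : 'M[K]_n) *m g^T) = \rank (pid_mx k : 'M[K]_n).
    by rewrite mxrankMfree // row_free_unit.
  have /leqifP := mxrank_leqif_sup (bg k); rewrite rk ltnn.
  case: ifP => // le _; apply: submx_trans (submxMr _ le) _.
  by rewrite mulmxK.
Qed.

Definition unipotent_band (k : nat) : set 'M[K]_n :=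
  [set g | upper_group g /\ band k (g - 1%:M)].

Lemma unipotent_band_subgroup k : subgroup (unipotent_band k).
Proof.
have sU := upper_subgroup; split.
- by move=> g [[]].
- by split=> [|a b _]; [exact: (subgroup1 sU)|rewrite subrr mxE].
- move=> g h [Ug bg] [Uh bh]; split; first exact: (subgroupM sU).
  have -> : g *m h - 1%:M = (g - 1%:M) *m h + (h - 1%:M).
    by rewrite mulmxBl mul1mx addrA subrK.
  move=> a b hab; rewrite mxE.
  have bgh : band k ((g - 1%:M) *m h) by rewrite -[k]addn0; apply: band_mul Uh.2.
  by rewrite (bgh a b hab) (bh a b hab) addr0.
- move=> g [Ug bg]; have Uv := subgroupV sU Ug; split=> // a b hab.
  have -> : invmx g - 1%:M = - ((g - 1%:M) *m invmx g).
    by rewrite mulmxBl mulmxV ?mul1mx ?opprB //; case: Ug.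
  have bv : band k ((g - 1%:M) *m invmx g) by rewrite -[k]addn0; apply: band_mul Uv.2.
  by rewrite mxE bv // oppr0.
Qed.

Lemma commutator_band k g h : upper_group g -> upper_group h ->
  band k (g *m h - h *m g) ->
  unipotent_band k (g *m h *m invmx g *m invmx h).
Proof.
have sU := upper_subgroup; move=> Ug Uh bgh.
have Ugv := subgroupV sU Ug; have Uhv := subgroupV sU Uh.
split; first by do 3?apply: (subgroupM sU).
have -> : g *m h *m invmx g *m invmx h - 1%:M =
    (g *m h - h *m g) *m (invmx g *m invmx h).
  rewrite mulmxBl mulmxA -[h *m g *m _]mulmxA (mulmxA g (invmx g)).
  by rewrite mulmxV ?mul1mx ?mulmxV //; [case: Uh|case: Ug].
by rewrite -[k]addn0; apply: band_mul => //; apply: (band_mul Ugv.2 Uhv.2).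
Qed.

(** The first derived group is unipotent, and each further one vanishes on at least one more
    diagonal above the main one. *)
Lemma upper_solvable (B : set 'M[K]_n) : subgroup B -> B `<=` upper_group ->
  solvable_grp B.
Proof.
move=> sB BU; exists n.+1.
have D k : iter k.+1 (@derived K n) B `<=` unipotent_band k.+1.
  elim: k => [|k IH].
    rewrite /=; apply: (derived_ind (unipotent_band_subgroup 1)) => g h /BU Ug /BU Uh.
    apply: commutator_band => // a b; rewrite addn1 ltnS leq_eqVlt.
    case/orP => [/eqP/val_inj ->|ba].
      rewrite mxE [X in _ + X]mxE (band0_diag _ Ug.2 Uh.2) (band0_diag _ Uh.2 Ug.2).
      by rewrite mulrC subrr.
    have bb := band_sub (band_mul Ug.2 Uh.2) (band_mul Uh.2 Ug.2).
    by apply: bb; rewrite !addn0.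
  rewrite iterS.
  apply: (derived_ind (unipotent_band_subgroup k.+2)) => g h /IH [Ug bg] /IH [Uh bh].
  apply: commutator_band => //.
  have -> : g *m h - h *m g = (g - 1%:M) *m (h - 1%:M) - (h - 1%:M) *m (g - 1%:M).
    rewrite !(mulmxBl, mulmxBr) !mulmx1 !mul1mx; move: (g *m h) (h *m g) => p q.
    by apply/matrixP => a b; rewrite !mxE; ring.
  apply: (@band_le (k.+1 + k.+1)); first by rewrite addSnnS leq_addl.
  by apply: band_sub; apply: band_mul.
have sD k : iter k (@derived K n) B 1%:M.
  elim: k => [|k IH] /=; first exact: (subgroup1 sB).
  apply: sub_generated; exists 1%:M => //; exists 1%:M => //.
  by rewrite invmx1 !mulmx1.
apply/seteqP; split=> [g /D [_ bg]|g ->]; last exact: (sD n.+1).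
apply/eqP; rewrite -subr_eq0; apply/eqP/matrixP => a b.
rewrite bg ?mxE //; apply: leq_trans (ltn_ord b) _.
by rewrite addnS ltnW // ltnS leq_addl.
Qed.

End UpperTriangular.

Section BorelA5A1.
Variable K : numClosedFieldType.

Definition borelH : set 'M[K]_27 := rd_borel (@E6_torus K) (@rootx K) posH.

Lemma borelH_subgroup : subgroup borelH.
Proof. exact: (rd_borel_subgroup (root_datumH K)). Qed.

Lemma borelHx k s : posH k -> borelH (rootx k s).
Proof. by move=> pk; apply: sub_generated; right; exists k, s. Qed.

Lemma borelHt (t : 'I_6 -> K) : nonzero_fun t -> borelH (torus_elt t).
Proof. by move=> t0; apply: sub_generated; left; exists t. Qed.

Lemma rvect_nz k : (k < 72)%N -> exists a b, rvect K k a b != 0.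
Proof.
move=> hk; have /and4P [_ u2 nE /allP sq] := all_iota0P check_entries hk.
have [e eL] : exists e, e \in rmat k.
  by case: (rmat k) nE => // e0 l _; exists e0; rewrite inE eqxx.
have /andP [/andP [_ l1] l2] := allP (all_iota0P check_support hk) _ eL.
exists (Ordinal l1), (Ordinal l2); rewrite rvectE mxE /=.
rewrite (scoef_uniq u2 (z := e.2)); last by case: (e) eL => -[].
apply: contraTneq isT => e0; have := congr1 (fun z => z * zr K e.2) e0.
rewrite /= mul0r -zrM; have /BinInt.Z.eqb_spec -> := sq _ eL.
by move/eqP; rewrite zr1 oner_eq0.
Qed.

Lemma coroot_rootx k u s : (k < 72)%N -> u != 0 ->
  coroot_elt k u *m rootx k s = rootx k (u ^+ 2 * s) *m coroot_elt k u :> 'M[K]_27.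
Proof.
move=> hk u0; rewrite coroot_eltE // !rootxE !sl2c_mul.
by apply: sl2c_eq; field.
Qed.

(** Two opposite root groups generate the elements of the coroot, whose commutators with root
    elements give back all root elements. So no derived group loses them. *)
Lemma sl2_not_solvable k (A : set 'M[K]_27) : (k < 72)%N -> subgroup A ->
  (forall s, A (rootx k s)) -> (forall s, A (rootx (ropp k) s)) ->
  ~ solvable_grp A.
Proof.
move=> hk sA Ak Ak' [l eA].
have D j : let D := iter j (@derived K 27) A in
    [/\ subgroup D, forall s, D (rootx k s) & forall s, D (rootx (ropp k) s)].
  elim: j => [|j [sD Dk Dk']] //=; set D := iter j _ _ in sD Dk Dk' *.
  have two0 : 2 != 0 :> K by rewrite pnatr_eq0.
  have comm i s : (i < 72)%N -> (forall r, D (rootx i r)) ->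
      (forall r, D (rootx (ropp i) r)) -> derived D (rootx i s).
    move=> hi Di Di'; have Dc := coroot_gen sD hi Di Di' two0.
    (* The coroot element at 2 multiplies the parameter by 4, so the commutator has parameter (4 -
       1) s / 3 = s. *)
    have := commutator_derived Dc (Di (s / 3)).
    have uc := subgroup_unit sD Dc.
    rewrite coroot_rootx // mulmxK //.
    have -> : invmx (rootx i (s / 3)) = rootx i (- (s / 3)).
      exact: (rd_invx (root_datumG K)).
    rewrite -rootxD; congr (derived D (rootx i _)).
    by field.
  split; first exact: derived_subgroup.
    by move=> s; apply: comm.
  by move=> s; apply: comm; rewrite ?roppK //; apply: ropp_lt.
have [_ + _] := D l; rewrite eA => /(_ 1) /=.
have [a [b nz]] := rvect_nz hk.
rewrite /rootx scale1r => /matrixP /(_ a b) /eqP; rewrite [X in X == _]mxE.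
by rewrite -subr_eq0 addrAC subrr add0r (negbTE nz).
Qed.

Lemma overgroup_borelH (P : set 'M[K]_27) : subgroup P ->
  P `<=` @A5A1_group K -> borelH `<=` P ->
  (forall g, simpleH g -> ~ forall s, P (rootx (ropp g) s)) -> P = borelH.
Proof.
move=> sP PH BP hP; rewrite A5A1_groupE in PH.
rewrite (overgroup_parabolic (root_datumH K) sP PH BP).
rewrite /rd_parabolic /borelH /rd_borel; congr generated.
by apply/seteqP; split=> g; [case=> // -[k [s [Sk /hP]]]|left].
Qed.

Lemma torus_upper : @E6_torus K `<=` @upper_group K 27.
Proof.
move=> _ [t t0 <-]; split; first exact: torus_elt_unit.
by move=> a b; rewrite addn0 torus_eltE -val_eqE /= => /gtn_eqF ->.
Qed.

Lemma rootx_upper k s : (k < 36)%N -> @upper_group K 27 (rootx k s).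
Proof.
move=> hk; split; first exact: rootx_unit.
move=> a b; rewrite addn0 => ba; rewrite !mxE rvect_upper // ?(ltnW ba) //.
by rewrite mulr0 addr0 -val_eqE /= gtn_eqF.
Qed.

Lemma borelH_upper : borelH `<=` @upper_group K 27.
Proof.
apply: (generated_sub (upper_subgroup K 27)) => g [/torus_upper //|[k [s [pk ->]]]].
by apply: rootx_upper; apply: posH_lt.
Qed.

Lemma polyfun_entry_closed (Z : pred ('I_27 * 'I_27)) :
  zclosed [set M : 'M[K]_27 | forall ab, Z ab -> M ab.1 ab.2 = 0].
Proof.
have -> : [set M : 'M[K]_27 | forall ab, Z ab -> M ab.1 ab.2 = 0] =
    [set M | forall ab : {ab | Z ab}, M (sval ab).1 (sval ab).2 = 0].
  by apply/seteqP; split=> M h; [case=> ab Zab; apply: h|move=> ab Zab;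
    apply: (h (exist _ ab Zab))].
by apply: zclosed_zeros => -[ab Zab]; apply: polyfun_id.
Qed.

Lemma borelH_sub : borelH `<=` @A5A1_group K.
Proof.
have sH := A5A1_subgroup K; apply: (generated_sub sH).
move=> g [Tg|[k [s [pk ->]]]].
  by rewrite A5A1_groupE; apply: sub_generated; left.
apply: (pos_root_genH sH) pk => i r Si; rewrite A5A1_groupE.
by apply: sub_generated; right; exists i, r; split; auto.
Qed.

Lemma A5A1_special : special (@A5A1_group K).
Proof. by move=> g /A5A1_sub /det_E6. Qed.

Lemma simpleH_opp_upper g : simpleH g ->
  ~ @upper_group K 27 (rootx (ropp g) 1).
Proof.
move=> /simpleH_refl /andP [/refl_root_lt g36 _] [_ up].
have g72 : (g < 72)%N by apply: ltn_trans g36 _.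
have [a [b nz]] := rvect_nz g72.
have ab : (a < b)%N by rewrite ltnNge; apply: contra nz => ba; rewrite rvect_upper.
have := up b a; rewrite addn0 ab => /(_ isT).
rewrite -rootx_tr !mxE -val_eqE /= ltn_eqF // add0r mul1r.
by move/eqP; rewrite (negbTE nz).
Qed.

(** The right side contains [borelH] and no opposite simple root group of H, which are lower
    triangular. This form shows that [borelH] is closed in H and gives the shape of its elements. *)
Lemma borelHE : borelH = @A5A1_group K `&` @upper_group K 27.
Proof.
symmetry; apply: overgroup_borelH.
- by apply: subgroup_setI; [exact: A5A1_subgroup|exact: upper_subgroup].
- by move=> g [].
- by move=> g Bg; split; [exact: borelH_sub|exact: borelH_upper].
- by move=> g Sg hg; apply: (simpleH_opp_upper Sg); case: (hg 1).
Qed.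

Lemma borelH_closed : zclosed_in (@A5A1_group K) borelH.
Proof.
exists [set M | forall ab : 'I_27 * 'I_27, (ab.2 < ab.1)%N -> M ab.1 ab.2 = 0].
  exact: polyfun_entry_closed.
rewrite borelHE; apply/seteqP; split=> g [Hg].
  by move=> [_ bg]; split=> // -[a b] /= ab; apply: bg; rewrite addn0.
move=> h; split=> //; split; first exact: (subgroup_unit (A5A1_subgroup K)).
by move=> a b; rewrite addn0 => ab; apply: (h (a, b)).
Qed.

(** Parametrized so that u = 1 gives the identity and u = 2 gives [rootx k s]. *)
Lemma rootx_curve (A : set 'M[K]_27) k s : (forall r, A (rootx k r)) ->
  laurent_curve A (fun u => rootx k (s * (u - 1))).
Proof.
move=> Ak; split=> [|//|u _ //]; last by rewrite subrr mulr0 rootx0.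
have hA := laurent_alg K; have hc := mxfun_const hA.
apply: (mxfun_add hA (hc _ _ _) (mxfun_scale hA _ (hc _ _ _))).
apply: (fa_mul hA (fa_const hA s) (fa_sub hA (laurent_id K) (fa_const hA 1))).
Qed.

Lemma coroot_curve (A : set 'M[K]_27) k :
  (forall u, u != 0 -> A (coroot_elt k u)) -> laurent_curve A (@coroot_elt K k).
Proof.
move=> Ak; split=> //; last by apply: torus_elt1 => j; rewrite exp1rz.
have hA := laurent_alg K; move=> a b.
apply: (@fa_ext _ _ _ (fun u => (\prod_j u ^ (rcoef k j * (wt a)`_j)) * (a == b)%:R)).
  apply: (fa_mul hA); last exact: fa_const.
  by apply: (fa_prod hA) => j; apply: laurent_exprz.
move=> u; rewrite torus_eltE mulr_natr; congr (_ *+ _).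
by apply: eq_bigr => j _; rewrite exprz_exp.
Qed.

(** T is replaced by the images of the simple coroots, so that every generator lies on a Laurent
    curve through 1. *)
Lemma borelH_connected : zconnected borelH.
Proof.
pose S := [set g : 'M[K]_27 | (exists k u, [/\ (k < 6)%N, u != 0 & g = coroot_elt k u])
  \/ exists k s, posH k /\ g = rootx k s].
have uS g : S g -> g \in unitmx.
  case=> [[k [u [_ u0 ->]]]|[k [s [_ ->]]]]; last exact: rootx_unit.
  by apply: torus_elt_unit; apply: coroot_nonzero.
have sS := subgroup_generated uS.
have Sx k s : posH k -> generated S (rootx k s).
  by move=> pk; apply: sub_generated; right; exists k, s.
have Sc k u : (k < 6)%N -> u != 0 -> generated S (coroot_elt k u).
  by move=> hk u0; apply: sub_generated; left; exists k, u.
have -> : borelH = generated S.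
  apply/seteqP; split.
    apply: (generated_sub sS) => g [Tg|[k [s [pk ->]]]]; last exact: Sx.
    exact: (torus_gen sS Sc).
  apply: (generated_sub borelH_subgroup) => g.
  case=> [[k [u [_ u0 ->]]]|[k [s [pk ->]]]]; last exact: borelHx.
  by apply: borelHt; apply: coroot_nonzero.
apply: zirred_connected; apply: zirred_generated => // g.
case=> [[k [u [hk u0 ->]]]|[k [s [pk ->]]]].
  exists (@coroot_elt K k); split; last by exists u.
  by apply: coroot_curve => v v0; apply: Sc.
exists (fun u => rootx k (s * (u - 1))); split.
  by apply: rootx_curve => r; apply: Sx.
exists 2; first by rewrite pnatr_eq0.
by congr (rootx k _); ring.
Qed.

(** For maximality: a larger subgroup of H contains an opposite simple root group along with the
    positive one, hence is not solvable. *)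
Theorem borelH_borel : borel_subgroup (@A5A1_group K) borelH.
Proof.
split.
  split; [exact: borelH_subgroup|exact: borelH_closed|exact: borelH_connected|].
  exact: (upper_solvable borelH_subgroup borelH_upper).
move=> B' [sB' [Z _ eB'] _ solB'] BB'; apply: overgroup_borelH => //.
  by rewrite eB' => g [].
move=> g Sg hg; have /andP [/refl_root_lt g36 pg] := simpleH_refl Sg.
have g72 : (g < 72)%N by apply: ltn_trans g36 _.
apply: (sl2_not_solvable g72 sB' _ hg solB') => s.
by apply: BB'; apply: borelHx.
Qed.

End BorelA5A1.

(** * The outer automorphism *)

Section DoubleCosets.
Variables (K : fieldType) (n : nat).
Implicit Types (G H B P : set 'M[K]_n).

Definition dcoset B g P : set 'M[K]_n :=
  [set x | exists b p, [/\ B b, P p & x = b *m g *m p]].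

Lemma sphericalE G H P : subgroup G -> H `<=` G -> P `<=` G -> subgroup P ->
  spherical G H P <-> exists B g, [/\ borel_subgroup H B, G g &
    zopen_in G (dcoset B g P)].
Proof.
move=> sG HG PG sP.
have key B g : borel_subgroup H B -> G g ->
    [set x | G x /\ orbit_left B (lcoset P g) (lcoset P x)] = dcoset B g P.
  move=> [[sB [Z _ eB] _ _] _] Gg.
  have BG b : B b -> G b by rewrite eB => -[/HG].
  apply/seteqP; split=> x.
    move=> [Gx [b Bb e]].
    have : lcoset P x x by exists 1%:M; [exact: (subgroup1 sP)|rewrite mulmx1].
    by rewrite -e => -[_ [p Pp <-] <-]; exists b, p; rewrite mulmxA.
  move=> [b [p [Bb Pp ->]]]; split.
    by do 2?apply: (subgroupM sG) => //; [apply: BG|apply: PG].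
  exists b => //; apply/seteqP; split=> y.
    move=> [_ [q Pq <-] <-]; exists (invmx p *m q).
      by apply: (subgroupM sP) => //; apply: (subgroupV sP).
    by rewrite -!mulmxA (mulmxA p) mulmxV ?mul1mx // (subgroup_unit sP Pp).
  move=> [q Pq <-]; exists (g *m (p *m q)); last by rewrite !mulmxA.
  by exists (p *m q) => //; apply: (subgroupM sP).
split=> [[B bB [_ [g Gg <-] [_ oO]]]|[B [g [bB Gg oO]]]].
  by exists B, g; split=> //; rewrite -(key _ _ bB Gg).
exists B => //; exists (lcoset P g); first by exists g.
split; last by rewrite key.
have [[_ [Z _ eB] _ _] _] := bB.
have BG b : B b -> G b by rewrite eB => -[/HG].
move=> _ [b Bb <-]; exists (b *m g); first by apply: (subgroupM sG) => //; apply: BG.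
apply/seteqP; split=> y.
  by move=> [p Pp <-]; exists (g *m p); [exists p|rewrite mulmxA].
by move=> [_ [p Pp <-] <-]; exists p; rewrite // mulmxA.
Qed.

End DoubleCosets.

Definition node_flip (j : nat) : nat := nth 0%N [:: 5; 1; 4; 3; 2; 0]%N j.

Definition weight_flip_tab : seq nat := Eval vm_compute in
  [seq index (mkseq (fun j => - (nth [::] wtab a)`_(node_flip j)) 6) wtab | a <- iota 0 27].

Definition root_flip (k : nat) : nat :=
  index (mkseq (fun j => (rvec k)`_(node_flip j)) 6) all_roots.

Definition flip_sign (k : nat) : BinNums.Z := zsign (all (fun e =>
  BinInt.Z.eqb (scoef (rmat (root_flip k)) (nth 0%N weight_flip_tab e.1.2)
    (nth 0%N weight_flip_tab e.1.1)) e.2) (rmat k)).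

Lemma check_weight_flip : all (fun a => let a' := nth 0%N weight_flip_tab a in
  [&& (a' < 27)%N, nth 0%N weight_flip_tab a' == a &
   all (fun j => (nth [::] wtab a')`_j == - (nth [::] wtab a)`_(node_flip j)) (iota 0 6)])
  (iota 0 27).
Proof. by vm_compute. Qed.

Lemma check_root_flip : all (fun k =>
   let s := flip_sign k in let f := rmat (root_flip k) in
   all (fun a => all (fun b => BinInt.Z.eqb
     (scoef (rmat k) (nth 0%N weight_flip_tab b) (nth 0%N weight_flip_tab a))
     (BinInt.Z.mul s (scoef f a b))) (iota 0 27)) (iota 0 27)) (iota 0 72).
Proof. by vm_compute. Qed.

Lemma check_root_flip_index : all (fun k =>
  [&& root_flip (ropp k) == ropp (root_flip k), (root_flip k < 72)%N,
   posG k ==> posG (root_flip k), simpleG k ==> (root_flip k == node_flip k)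
   & simpleH k ==> simpleH (root_flip k)]) (iota 0 72).
Proof. by vm_compute. Qed.

#[global] Opaque root_flip flip_sign weight_flip_tab.

Definition weight_flip (a : 'I_27) : 'I_27 := inord (nth 0%N weight_flip_tab a).

Lemma weight_flip_val a : nat_of_ord (weight_flip a) = nth 0%N weight_flip_tab a.
Proof.
by have /and3P [h _ _] := all_iota0P check_weight_flip (ltn_ord a); rewrite inordK.
Qed.

Lemma weight_flipK : involutive weight_flip.
Proof.
move=> a; apply: val_inj; rewrite /= !weight_flip_val.
by have /and3P [_ /eqP -> _] := all_iota0P check_weight_flip (ltn_ord a).
Qed.

Lemma wt_flip a (j : 'I_6) : (wt (weight_flip a))`_j = - (wt a)`_(node_flip j).
Proof.
rewrite !wtE weight_flip_val.
have /and3P [_ _ h] := all_iota0P check_weight_flip (ltn_ord a).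
by have /eqP -> := all_iota0P h (ltn_ord j).
Qed.

Section Flip.
Variable K : numClosedFieldType.
Local Notation G := (@E6_group K).
Local Notation H := (@A5A1_group K).

(* On the group of type E_6, [flip] is the outer automorphism g |-> J g^-T J^-1
   for the permutation matrix J identifying V with its twisted dual; the adjugate
   makes it a polynomial map. *)
Definition flip (M : 'M[K]_27) : 'M[K]_27 :=
  \matrix_(a, b) (\adj M) (weight_flip b) (weight_flip a).

Lemma flip_polymap : mxfun (@polyfun K 27) flip.
Proof.
have hA := polyfun_alg K 27; move=> a b.
apply: fa_ext (mxfun_adj hA (@polyfun_id K 27) (weight_flip b) (weight_flip a)) _ => M.
by rewrite [in RHS]mxE.
Qed.

Lemma flipE g : \det g = 1 ->
  flip g = \matrix_(a, b) (invmx g) (weight_flip b) (weight_flip a).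
Proof. by move=> dg; rewrite invmx_adj. Qed.

Lemma flip_mul g h : \det g = 1 -> \det h = 1 -> flip (g *m h) = flip g *m flip h.
Proof.
move=> dg dh; have ug : g \in unitmx by rewrite unitmxE dg unitr1.
have uh : h \in unitmx by rewrite unitmxE dh unitr1.
rewrite !flipE ?det_mulmx ?dg ?dh ?mulr1 // invmxM //.
apply/matrixP => a b; rewrite !mxE (reindex_inj (inv_inj weight_flipK)) /=.
by apply: eq_bigr => c _; rewrite !mxE mulrC.
Qed.

Lemma flip1 : flip 1%:M = 1%:M.
Proof.
rewrite flipE ?det1 // invmx1; apply/matrixP => a b; rewrite !mxE.
by rewrite (inj_eq (inv_inj weight_flipK)) eq_sym.
Qed.

Lemma flip_rootx k s : (k < 72)%N ->
  flip (rootx k s) = rootx (root_flip k) (- zr K (flip_sign k) * s).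
Proof.
move=> hk; rewrite flipE ?det_rootx //.
have -> : invmx (rootx k s) = rootx k (- s) by exact: (rd_invx (root_datumG K)).
apply/matrixP => a b; rewrite !mxE (inj_eq (inv_inj weight_flipK)) eq_sym.
rewrite !rvectE !mxE !weight_flip_val.
have /BinInt.Z.eqb_spec -> := all_iota0P (all_iota0P (all_iota0P check_root_flip hk)
  (ltn_ord a)) (ltn_ord b).
by rewrite zrM; ring.
Qed.

Lemma flip_torus (t : 'I_6 -> K) : nonzero_fun t ->
  \det (torus_elt t) = 1 -> E6_torus (flip (torus_elt t)).
Proof.
move=> t0 dt; pose nf (j : 'I_6) : 'I_6 := inord (node_flip j).
have nfE j : nat_of_ord (nf j) = node_flip j.
  by rewrite inordK //; case: j => [[|[|[|[|[|[|]]]]]] hj].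
have nfK : involutive nf.
  by move=> j; apply: val_inj; rewrite /= !nfE; case: j => [[|[|[|[|[|[|]]]]]] hj].
exists (fun j => t (nf j)); first by move=> j; apply: t0.
rewrite flipE // torus_elt_inv //; apply/matrixP => a b.
rewrite torus_eltE [in RHS]mxE torus_eltE (inj_eq (inv_inj weight_flipK)).
rewrite [b == a]eq_sym; case: (eqVneq a b) => [->|_]; last by rewrite !mulr0n.
congr (_ *+ _); rewrite (reindex_inj (inv_inj nfK)) /=; apply: eq_bigr => j _.
by rewrite nfK wt_flip nfE exprz_inv opprK.
Qed.

Definition flip_preimage (A : set 'M[K]_27) : set 'M[K]_27 :=
  [set g | \det g = 1 /\ A (flip g)].

Lemma flip_preimage_subgroup A : subgroup A -> subgroup (flip_preimage A).
Proof.
move=> sA; split.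
- by move=> g [dg _]; rewrite unitmxE dg unitr1.
- by split; rewrite ?det1 // flip1; apply: (subgroup1 sA).
- move=> g h [dg Ag] [dh Ah]; split; first by rewrite det_mulmx dg dh mulr1.
  by rewrite flip_mul //; apply: (subgroupM sA).
- move=> g [dg Ag]; have ug : g \in unitmx by rewrite unitmxE dg unitr1.
  have dv : \det (invmx g) = 1 by rewrite det_inv dg invr1.
  split=> //; apply: (subgroupMl sA Ag).
  by rewrite -flip_mul // mulmxV // flip1; apply: (subgroup1 sA).
Qed.

Lemma flip_E6 g : G g -> G (flip g).
Proof.
have sG := E6_subgroup K; rewrite {1}E6_groupE => Gg.
have [] // : flip_preimage G g.
apply: (generated_sub (flip_preimage_subgroup sG) _ Gg) => {Gg} h [Th|[k [s [Sk hk]]]].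
  have dh := det_E6 (E6_has_torus Th); split=> //.
  by case: Th dh => t t0 <- dh; apply: E6_has_torus; apply: flip_torus.
have k72 : (k < 72)%N by apply: ltn_trans Sk _.
have fl i r : (i < 72)%N -> G (flip (rootx i r)).
  move=> hi; rewrite flip_rootx //; apply: E6_root.
  by have /and5P [] := all_iota0P check_root_flip_index hi.
by split; case: hk => ->; rewrite ?det_rootx //; apply: fl => //; apply: ropp_lt.
Qed.

Lemma flip_A5A1 g : H g -> H (flip g).
Proof.
have sH := A5A1_subgroup K; rewrite {1}A5A1_groupE => Hg.
have [] // : flip_preimage H g.
apply: (generated_sub (flip_preimage_subgroup sH) _ Hg) => {Hg} h [Th|[k [s [Sk hk]]]].
  have dh := det_E6 (E6_has_torus Th); split=> //.
  case: Th dh => t t0 <- dh; rewrite A5A1_groupE; apply: sub_generated; left.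
  exact: flip_torus.
have /andP [/refl_root_lt k36 _] := simpleH_refl Sk.
have k72 : (k < 72)%N by apply: ltn_trans k36 _.
have /and5P [/eqP fo _ _ _ /implyP /(_ Sk) Sf] := all_iota0P check_root_flip_index k72.
split; case: hk => ->; rewrite ?det_rootx // A5A1_groupE; apply: sub_generated; right.
  by exists (root_flip k), (- zr K (flip_sign k) * s); split=> //; left; rewrite flip_rootx.
exists (root_flip k), (- zr K (flip_sign (ropp k)) * s); split=> //; right.
by rewrite flip_rootx ?ropp_lt // fo.
Qed.

Lemma flip_inv g : G g -> flip (invmx g) = invmx (flip g).
Proof.
have sG := E6_subgroup K; move=> Gg; have ug := subgroup_unit sG Gg.
have uf := subgroup_unit sG (flip_E6 Gg).
rewrite -[LHS](mulKmx uf) -flip_mul ?(det_E6 Gg) ?mulmxV ?flip1 ?mulmx1 //.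
exact: det_E6 (subgroupV sG Gg).
Qed.

Lemma flipK g : G g -> flip (flip g) = g.
Proof.
move=> Gg; have Gv := subgroupV (E6_subgroup K) Gg.
rewrite flipE ?(det_E6 (flip_E6 Gg)) // -flip_inv // flipE ?(det_E6 Gv) //.
by rewrite invmxK; apply/matrixP => a b; rewrite !mxE !weight_flipK.
Qed.

Lemma flip_parabolic i g : (i < 6)%N -> @parabolic K i g ->
  @parabolic K (node_flip i) (flip g).
Proof.
move=> hi Pg; have sP := parabolic_subgroup K (node_flip i).
have [] // : flip_preimage (@parabolic K (node_flip i)) g.
apply: (generated_sub (flip_preimage_subgroup sP) _ Pg) => {Pg} h.
case=> [[Th|[k [s [pk ->]]]]|[k [s [Sk ki ->]]]].
- have dh := det_E6 (E6_has_torus Th); split=> //.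
  case: Th dh => t t0 <- dh; apply: sub_generated; left; left.
  exact: flip_torus.
- have k72 : (k < 72)%N by apply: ltn_trans pk _.
  have /and5P [_ _ /implyP /(_ pk) pf _ _] := all_iota0P check_root_flip_index k72.
  split; first exact: det_rootx.
  rewrite flip_rootx //; apply: sub_generated; left; right.
  by exists (root_flip k), (- zr K (flip_sign k) * s).
have k72 : (k < 72)%N by apply: ltn_trans Sk _.
have /and5P [/eqP fo _ _ /implyP /(_ Sk) /eqP fk _] := all_iota0P check_root_flip_index k72.
split; first exact: det_rootx.
rewrite flip_rootx ?ropp_lt // fo; apply: sub_generated; right.
exists (root_flip k), (- zr K (flip_sign (ropp k)) * s); split=> //; rewrite fk.
  by move: (k) Sk => j; do 6?case: j => [//|j].
by move: (k) (i) Sk hi ki => j l; do 6?(case: j => [|j]; first by do 6?case: l => [|l] //).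
Qed.

(** As [flip] is an involution of G, this preimage is also the image of A for A inside G; preimages
    go well with closed sets. *)
Definition flips (A : set 'M[K]_27) : set 'M[K]_27 := [set g | G g /\ A (flip g)].

Lemma flipsK A : A `<=` G -> flips (flips A) = A.
Proof.
move=> AG; apply/seteqP; split=> g; first by move=> [Gg [_]]; rewrite flipK.
by move=> Ag; have Gg := AG _ Ag; split=> //; split; rewrite ?flipK //; apply: flip_E6.
Qed.

Lemma flips_sub A : flips A `<=` G. Proof. by move=> g []. Qed.

Lemma flipsS A B : A `<=` B -> flips A `<=` flips B.
Proof. by move=> AB g [Gg /AB]. Qed.

Lemma flips_A5A1 : flips H = H.
Proof.
apply/seteqP; split=> g; last first.
  by move=> Hg; split; [exact: A5A1_sub|exact: flip_A5A1].
by move=> [Gg /flip_A5A1]; rewrite flipK.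
Qed.

Lemma flips_subgroup A : subgroup A -> subgroup (flips A).
Proof.
move=> sA; have -> : flips A = G `&` flip_preimage A.
  by apply/seteqP; split=> g [Gg]; [split=> //; split=> //; apply: det_E6|case].
exact: subgroup_setI (E6_subgroup K) (flip_preimage_subgroup sA).
Qed.

Lemma flips_closed_in A B : zclosed_in A B -> zclosed_in (flips A) (flips B).
Proof.
move=> [Z cZ ->]; exists (flip @^-1` Z).
  exact: zclosed_preim flip_polymap cZ.
by apply/seteqP; split=> g; [move=> [Gg []]|move=> [[Gg]]].
Qed.

Lemma flips_connected A : A `<=` G -> zconnected A -> zconnected (flips A).
Proof.
move=> AG cA A1 A2 c1 c2 eA e0.
have [[Z1 _ e1] [Z2 _ e2]] := (c1, c2).
have A1G : A1 `<=` G by rewrite e1 => g [[]].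
have A2G : A2 `<=` G by rewrite e2 => g [[]].
have := flips_closed_in c1; have := flips_closed_in c2; rewrite flipsK // => c2' c1'.
have [] := cA _ _ c1' c2'.
- rewrite -[A in LHS](flipsK AG) eA; apply/seteqP; split=> g.
    by move=> [Gg [?|?]]; [left|right].
  by move=> [[Gg ?]|[Gg ?]]; split=> //; [left|right].
- apply/seteqP; split=> g //= [[_ g1] [_ g2]].
  by have : (A1 `&` A2) (flip g) by []; rewrite e0.
- by move=> e; left; rewrite -(flipsK A1G) e; apply/seteqP; split=> g // [].
- by move=> e; right; rewrite -(flipsK A2G) e; apply/seteqP; split=> g // [].
Qed.

Lemma flips_derived_sub A : subgroup A -> A `<=` G ->
  derived (flips A) `<=` flips (derived A).
Proof.
move=> sA AG; have sG := E6_subgroup K.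
apply: derived_ind; first exact: flips_subgroup (derived_subgroup sA).
move=> g h [Gg Ag] [Gh Ah]; have Gv := subgroupV sG Gg; have Gw := subgroupV sG Gh.
have Ggh := subgroupM sG Gg Gh; have Gghv := subgroupM sG Ggh Gv.
split; first exact: (subgroupM sG).
rewrite !flip_mul ?det_E6 // !flip_inv //; exact: commutator_derived.
Qed.

Lemma derived_mono (A B : set 'M[K]_27) : subgroup B -> A `<=` B ->
  derived A `<=` derived B.
Proof.
move=> sB AB; apply: generated_sub; first exact: derived_subgroup.
by move=> _ [g /AB Bg [h /AB Bh <-]]; apply: commutator_derived.
Qed.

Lemma flips_solvable A : subgroup A -> A `<=` G -> solvable_grp A ->
  solvable_grp (flips A).
Proof.
move=> sA AG [k eA]; exists k.
have it (B : set 'M[K]_27) j : subgroup B -> subgroup (iter j (@derived K 27) B).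
  by move=> sB; elim: j => [|j IH] //=; apply: derived_subgroup.
have itG j : iter j (@derived K 27) A `<=` G.
  elim: j => [|j IH] //=; apply: subset_trans IH.
  exact: derived_sub (it _ _ sA).
have h j : iter j (@derived K 27) (flips A) `<=` flips (iter j (@derived K 27) A).
  elim: j => [|j IH] //=.
  apply: subset_trans (flips_derived_sub (it _ _ sA) (itG j)).
  exact: derived_mono (flips_subgroup (it _ _ sA)) IH.
apply/seteqP; split=> g; last first.
  by move=> ->; apply: (subgroup1 (it _ _ (flips_subgroup sA))).
move/h; rewrite eA => -[Gg /= e].
by rewrite -(flipK Gg) e flip1.
Qed.

Lemma flips_ccs B : closed_conn_solvable H B -> closed_conn_solvable H (flips B).
Proof.
move=> [sB cB nB solB]; have BG : B `<=` G.
  by case: cB => Z _ -> g [/A5A1_sub].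
split; [exact: flips_subgroup| |exact: flips_connected|exact: flips_solvable].
by rewrite -flips_A5A1; apply: flips_closed_in.
Qed.

Lemma ccs_sub B : closed_conn_solvable H B -> B `<=` G.
Proof. by move=> [_ [Z _ ->] _ _] g [/A5A1_sub]. Qed.

Lemma flips_borel B : borel_subgroup H B -> borel_subgroup H (flips B).
Proof.
move=> [cB mB]; split; first exact: flips_ccs.
move=> B' cB' BB'; have B'G := ccs_sub cB'.
rewrite -(flipsK B'G); congr flips; apply: mB; first exact: flips_ccs.
by rewrite -[B](flipsK (ccs_sub cB)); apply: flipsS.
Qed.

(** The automorphism is polynomial and preserves H, so it permutes the Borel subgroups of H and
    carries open double cosets to open double cosets. *)
Theorem spherical_flips P : subgroup P -> P `<=` G -> A5A1_spherical P ->
  A5A1_spherical (flips P).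
Proof.
move=> sP PG; have sG := E6_subgroup K; have HG := @A5A1_sub K.
move/(sphericalE sG HG PG sP) => [B [g [bB Gg [Z cZ eZ]]]].
apply/(sphericalE sG HG (@flips_sub P) (flips_subgroup sP)).
exists (flips B), (flip g); split; [exact: flips_borel|exact: flip_E6|].
have BG := ccs_sub bB.1.
exists (flip @^-1` Z); first exact: zclosed_preim flip_polymap cZ.
have GZ x : G x -> (~ Z (flip x)) <-> dcoset B g P (flip x).
  by move=> Gx; rewrite eZ; split=> [|[]//]; split=> //; apply: flip_E6.
apply/seteqP; split=> x.
  move=> [b [p [[Gb Bb] [Gp Pp] ->]]].
  have Gx : G (b *m flip g *m p).
    by do 2?apply: (subgroupM sG) => //; apply: flip_E6.
  split=> //; apply/(GZ _ Gx); exists (flip b), (flip p); split=> //.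
  have Gf := flip_E6 Gg; have Gbf := subgroupM sG Gb Gf.
  by rewrite !flip_mul ?det_E6 // flipK.
move=> [Gx /(GZ _ Gx) [b [p [Bb Pp e]]]].
have Gb := BG _ Bb; have Gp := PG _ Pp; have Gbg := subgroupM sG Gb Gg.
exists (flip b), (flip p); split.
- by split; [exact: flip_E6|rewrite flipK].
- by split; [exact: flip_E6|rewrite flipK].
- by rewrite -!flip_mul ?det_E6 // -e flipK.
Qed.

Lemma flips_parabolic i : (i < 6)%N -> flips (@parabolic K i) = @parabolic K (node_flip i).
Proof.
move=> hi; have hf : (node_flip i < 6)%N by do 6?case: i hi => [|i] hi.
have ff : node_flip (node_flip i) = i by do 6?case: i hi hf => [|i] hi hf.
apply/seteqP; split=> g.
  by move=> [Gg /(flip_parabolic hi)]; rewrite flipK.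
move=> Pg; split; first exact: parabolic_sub Pg.
by rewrite -ff; apply: flip_parabolic.
Qed.

End Flip.

(** * The open orbit on G/P_1 *)

(* The weights whose alpha_2-grading is odd for A5A1: they span the summand
   (6, 2) of the minuscule module, the other ones the summand (15, 1). *)
Definition oddw (a : nat) : bool :=
  a \in [:: 0; 1; 2; 3; 5; 7; 20; 22; 23; 24; 25; 26]%N.

Lemma check_parity : all (fun k => (~~ odd (absz (rvec k)`_1)) ==>
  all (fun e => oddw e.1.1 == oddw e.1.2) (rmat k)) (iota 0 72).
Proof. by vm_compute. Qed.

Lemma check_parity_posH : all (fun k => posH k ==>
  (~~ odd (absz (rvec k)`_1) && ~~ odd (absz (rvec (ropp k))`_1))) (iota 0 36).
Proof. by vm_compute. Qed.

(** On vectors whose dead coordinates vanish, the quadratic form with coefficients l reduces to a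
    nonzero multiple of x_a x_p. *)
Definition quad_check (l : spmx) (dead : pred nat) (a p : nat) : bool :=
  all (fun e => [|| (e.1 == (a, p)), (e.1 == (p, a)), dead e.1.1 | dead e.1.2]) l
  && ~~ BinInt.Z.eqb (foldr (fun e s => if (e.1 == (a, p)) || (e.1 == (p, a))
       then BinInt.Z.add e.2 s else s) BinNums.Z0 l) BinNums.Z0.

Definition word_vec (w : seq (nat * BinNums.Z)) (v : spmx) : spmx :=
  foldr (fun ks v => smerge v (sscale ks.2 (smul 27 (rmat ks.1) v))) v w.

Section Parity.
Variable K : numClosedFieldType.

(** The projection of the minuscule module to its H-summand (15, 1). *)
Definition piU : 'M[K]_27 := diag_mx (\row_a (~~ oddw a)%:R).

Lemma piU_entry n (M : 'M[K]_(27, n)) a b :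
  (piU *m M) a b = if oddw a then 0 else M a b.
Proof. by rewrite mul_diag_mx !mxE; case: (oddw a); rewrite ?mul0r ?mul1r. Qed.

Lemma piU_entryr n (M : 'M[K]_(n, 27)) a b :
  (M *m piU) a b = if oddw b then 0 else M a b.
Proof. by rewrite mul_mx_diag !mxE; case: (oddw b); rewrite ?mulr0 ?mulr1. Qed.

Lemma rvect_parity k : (k < 72)%N -> ~~ odd (absz (rvec k)`_1) ->
  rvect K k *m piU = piU *m rvect K k.
Proof.
move=> hk ev; apply/matrixP => a b; rewrite piU_entry piU_entryr.
have /implyP /(_ ev) /allP h := all_iota0P check_parity hk.
have [->|nz] := eqVneq (rvect K k a b) 0; first by rewrite !if_same.
have /mapP [e eL E] : (nat_of_ord a, nat_of_ord b) \in [seq e.1 | e <- rmat k].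
  by apply: contraNT nz => /scoef_notin z; rewrite rvectE mxE z.
by have := h _ eL; rewrite -E /= => /eqP ->.
Qed.

Lemma A5A1_piU g : @A5A1_group K g -> g *m piU = piU *m g.
Proof.
pose A := [set g : 'M[K]_27 | g \in unitmx /\ g *m piU = piU *m g].
have sA : subgroup A.
  split.
  - by move=> h [].
  - by split; [exact: unitmx1|rewrite mulmx1 mul1mx].
  - move=> h h' [uh eh] [uh' eh']; split; first by rewrite unitmx_mul uh.
    by rewrite -mulmxA eh' mulmxA eh mulmxA.
  - move=> h [uh eh]; split; first by rewrite unitmx_inv.
    rewrite -[RHS](mulKmx uh) (mulmxA h) eh -(mulmxA piU) mulmxV //.
    by rewrite mulmx1.
rewrite A5A1_groupE => Hg; suff [] : A g by [].
apply: (generated_sub sA _ Hg) => h [[t t0 <-]|[k [s [Sk hk]]]].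
  split; first exact: torus_elt_unit.
  apply/matrixP => a b; rewrite piU_entry piU_entryr torus_eltE.
  by case: eqP => [->//|_]; rewrite mulr0n !if_same.
have /andP [/refl_root_lt k36 pk] := simpleH_refl Sk.
have k72 : (k < 72)%N by apply: ltn_trans k36 _.
have /implyP /(_ pk) /andP [ev ev'] := all_iota0P check_parity_posH k36.
have com i : (i < 72)%N -> ~~ odd (absz (rvec i)`_1) -> A (rootx i s).
  move=> hi evi; split; first exact: rootx_unit.
  rewrite /rootx mulmxDl mulmxDr mul1mx mulmx1 -scalemxAl -scalemxAr.
  by rewrite rvect_parity.
by case: hk => ->; apply: com => //; apply: ropp_lt.
Qed.

Lemma A5A1_parity g (a b : 'I_27) : @A5A1_group K g -> oddw a != oddw b -> g a b = 0.
Proof.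
move=> /A5A1_piU /matrixP /(_ a b); rewrite piU_entry piU_entryr.
by case: (oddw a); case: (oddw b).
Qed.

Lemma sum_scoef (F : 'I_27 -> 'I_27 -> K) (l : spmx) :
  all (fun e => (e.1.1 < 27)%N && (e.1.2 < 27)%N) l ->
  \sum_(a < 27) \sum_(b < 27) zr K (scoef l a b) * F a b =
  \sum_(e <- l) zr K e.2 * F (inord e.1.1) (inord e.1.2).
Proof.
elim: l => [_|[[i j] z] l IH /= /andP [/andP [hi hj] hl]].
  by rewrite big_nil big1 // => a _; rewrite big1 // => b _; rewrite mul0r.
rewrite big_cons -IH //= => {IH}.
rewrite (eq_bigr (fun a : 'I_27 => (\sum_(b < 27) (if (i == a :> nat) && (j == b :> nat)
    then zr K z * F a b else 0)) + \sum_(b < 27) zr K (scoef l a b) * F a b)); last first.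
  move=> a _; rewrite -big_split; apply: eq_bigr => b _ /=.
  by case: ifP => _; rewrite ?add0r // zrD mulrDl.
rewrite big_split /=; congr (_ + _).
rewrite (bigD1 (inord i)) //= (bigD1 (inord j)) //= !inordK // !eqxx /=.
rewrite big1 => [|b nb]; last first.
  case: eqP => // jb; case/eqP: nb; apply: val_inj.
  by rewrite /= inordK.
rewrite addr0 big1 ?addr0 // => a na; rewrite big1 // => b _.
case: eqP => //= ia; case/eqP: na; apply: val_inj; by rewrite /= inordK.
Qed.

Lemma check_cmat_lt : all (fun c =>
  all (fun e => (e.1.1 < 27)%N && (e.1.2 < 27)%N) (cmat c)) (iota 0 27).
Proof. by vm_compute. Qed.

Lemma cross_coord (x y : 'cV[K]_27) (c : 'I_27) : cross x y 0 c =
  \sum_(e <- cmat c) zr K e.2 * (x (inord e.1.1) 0 * y (inord e.1.2) 0).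
Proof.
rewrite -(sum_scoef (fun a b => x a 0 * y b 0)); last exact: all_iota0P check_cmat_lt _ _.
rewrite summxE; apply: eq_bigr => a _; rewrite mxE [(_ *m _) 0 c]mxE mulr_sumr.
apply: eq_bigr => b _; rewrite cubmE !mxE.
have sym a' b' c' := andP (all_iota0P (all_iota0P (all_iota0P check_cubic_sym
  (ltn_ord (a' : 'I_27))) (ltn_ord (b' : 'I_27))) (ltn_ord (c' : 'I_27))).
have [/BinInt.Z.eqb_spec -> _] := sym a b c.
have [_ /BinInt.Z.eqb_spec ->] := sym a c b.
by rewrite mulrA [RHS]mulrC.
Qed.

Lemma quad_checkP (l : spmx) (dead : pred nat) a p (x : 'cV[K]_27) :
  quad_check l dead a p -> all (fun e => (e.1.1 < 27)%N && (e.1.2 < 27)%N) l ->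
  (forall i, (i < 27)%N -> dead i -> x (inord i) 0 = 0) ->
  exists2 N : K, N != 0 &
    \sum_(e <- l) zr K e.2 * (x (inord e.1.1) 0 * x (inord e.1.2) 0) =
    N * (x (inord a) 0 * x (inord p) 0).
Proof.
case/andP => hl hN lt hx; set N := foldr _ _ _ in hN; exists (zr K N).
  by apply: contra hN => /eqP; rewrite /zr => /eqP; rewrite intr_eq0 =>
    /eqP e; apply/BinInt.Z.eqb_spec; rewrite -[N]ssrZ.int_of_ZK e.
rewrite /N {hN N}; elim: l hl lt => [|e l IH] /=.
  by rewrite big_nil zr0 mul0r.
case/andP => he hl /andP [/andP [h1 h2] lt]; rewrite big_cons IH //.
have [ap|nap] := boolP ((e.1 == (a, p)) || (e.1 == (p, a))).
  rewrite zrD mulrDl; congr (_ * _ + _).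
  by case/orP: ap => /eqP ->; rewrite //= mulrC.
move: he nap; rewrite negb_or => he /andP [/negbTE n1 /negbTE n2].
move: he; rewrite n1 n2 /= => /orP [d|d].
  by rewrite (hx _ h1 d) mul0r mulr0 add0r.
by rewrite (hx _ h2 d) !mulr0 add0r.
Qed.

Definition gword (w : seq (nat * BinNums.Z)) : 'M[K]_27 :=
  foldr (fun ks g => rootx ks.1 (zr K ks.2) *m g) 1%:M w.

Lemma gword_E6 w : all (fun ks => (ks.1 < 72)%N) w -> @E6_group K (gword w).
Proof.
have sG := E6_subgroup K; elim: w => [_|ks w IH /= /andP [h hw]].
  exact: (subgroup1 sG).
by apply: (subgroupM sG); [exact: E6_root|exact: IH].
Qed.

Lemma word_vecE w p v : imx K 27 p (word_vec w v) = gword w *m imx K 27 p v.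
Proof.
elim: w => [|[k s] w IH] /=; first by rewrite mul1mx.
rewrite imx_merge imx_scale imx_mul IH -rvectE /rootx -mulmxA mulmxDl mul1mx.
by rewrite -scalemxAl.
Qed.

End Parity.

(** Coordinates 26 and 21 are nonzero at a generic point from the start. Coordinate 14 is known to
    be nonzero once the vanishing of the coordinates in Z reduces [pfaffian] to a multiple of x_14
    x_21. *)
Definition pivot_ok (Z : seq nat) (p : nat) : bool :=
  [|| p == 26, p == 21 | (p == 14) &&
     quad_check (cmat 4) (fun i => oddw i || (i \in Z)) 14 21]%N.

(* A step (true, k, a, p) kills the coordinate a with the root k and the pivot
   p; a step (false, c, a, p) kills a with the cone equation of index c, which
   has reduced to x_a x_p = 0. *)
Definition reduction_ok (Z : seq nat) (st : bool * nat * nat * nat) : bool :=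
  let: (b, k, a, p) := st in
  pivot_ok Z p && (a < 27)%N && (p < 27)%N &&
  if b then [&& posH k, ((a, p) \in [seq e.1 | e <- rmat k]) &
       all (fun e => (e.1.1 \in Z) ==> (e.1.2 \in Z)) (rmat k)]
  else (k < 27)%N && quad_check (cmat k) (mem Z) a p.

Fixpoint reductions_ok (Z : seq nat) (l : seq (bool * nat * nat * nat)) : bool :=
  if l is st :: l' then reduction_ok Z st && reductions_ok (st.1.2 :: Z) l'
  else true.

(** The order matters: a root step must not revive a coordinate killed before, the cone equations
    become monomial only after enough root steps, and pivot 14 becomes available only after part of
    the clearing with pivot 21. The surviving coordinates are 5, 14, 21 and 26. *)
Definition reduction : seq (bool * nat * nat * nat) :=
  [:: (true, 5, 25, 26); (true, 10, 24, 26); (true, 15, 23, 26); (true, 20, 22, 26);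
   (true, 22, 20, 26); (true, 35, 7, 26); (false, 0, 12, 26); (false, 1, 10, 26);
   (false, 2, 8, 26); (false, 3, 6, 26); (false, 5, 4, 26); (true, 2, 19, 21);
   (true, 6, 18, 21); (true, 8, 17, 21); (true, 11, 16, 21); (true, 14, 15, 21);
   (true, 17, 13, 21); (false, 10, 1, 26); (false, 12, 0, 26); (true, 4, 11, 14);
   (true, 9, 9, 14); (false, 6, 3, 26); (false, 8, 2, 26)]%N.

Lemma check_reduction : reductions_ok [::] reduction &&
  all (fun a => (a \in [:: 5; 14; 21; 26]%N) || (a \in [seq st.1.2 | st <- reduction]))
    (iota 0 27).
Proof. by vm_compute. Qed.

Section OpenOrbit.
Variable K : numClosedFieldType.
Implicit Types (y : 'cV[K]_27) (g b : 'M[K]_27).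

(** Equal to 2 (x_14 x_21 + x_17 x_18 - x_16 x_19), that is, up to the factor 2 a 4 by 4
    sub-Pfaffian when (15, 1) is viewed as a space of alternating 6 by 6 matrices. *)
Definition pfaffian y : K := cross (piU K *m y) (piU K *m y) 0 (inord 4).

Definition generic_cone y (Z : seq nat) : Prop :=
  [/\ cross y y = 0, y (inord 26) 0 != 0, y (inord 21) 0 != 0, pfaffian y != 0 &
      forall a, (a < 27)%N -> a \in Z -> y (inord a) 0 = 0].

Lemma upper_diag_neq0 g a : upper_group g -> g a a != 0.
Proof.
move=> Ug; have Uv := subgroupV (upper_subgroup K 27) Ug.
have := band0_diag a Ug.2 Uv.2; rewrite mulmxV ?Ug.1 // mxE eqxx => e.
by apply: contraTneq isT => g0; move: e; rewrite g0 mul0r => /eqP; rewrite oner_eq0.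
Qed.

Lemma odd_ge21 (c : nat) : (21 < c)%N -> (c < 27)%N -> oddw c.
Proof. by do 27?[case: c => [//|c]]. Qed.

Lemma odd_lt4 (c : nat) : (c < 4)%N -> oddw c.
Proof. by do 4?[case: c => [//|c]]. Qed.

(** Elements of [borelH] are upper triangular and preserve parity, so row i has only its diagonal
    entry. This applies to 26, the last index, and to 21, the last even one. *)
Lemma borelH_row (i : 'I_27) b y : borelH b ->
  (forall c : 'I_27, (i < c)%N -> oddw i != oddw c) ->
  (b *m y) i 0 = b i i * y i 0.
Proof.
rewrite borelHE => -[Hb [_ ub]] hi; rewrite mxE (bigD1 i) //= big1 ?addr0 // => c.
rewrite neq_ltn => /orP [ci|ic]; first by rewrite ub ?mul0r // addn0.
by rewrite (A5A1_parity Hb) ?mul0r // hi.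
Qed.

Lemma borelH_26 b y : borelH b ->
  (b *m y) (inord 26) 0 = b (inord 26) (inord 26) * y (inord 26) 0.
Proof.
move=> Bb; apply: borelH_row => // c; rewrite inordK // ltnNge.
by rewrite -ltnS ltn_ord.
Qed.

Lemma borelH_21 b y : borelH b ->
  (b *m y) (inord 21) 0 = b (inord 21) (inord 21) * y (inord 21) 0.
Proof.
by move=> Bb; apply: borelH_row => // c; rewrite inordK // => h;
   rewrite (odd_ge21 h (ltn_ord c)).
Qed.

(** The quadratic map goes to linear forms, on which b acts through its inverse. Since 4 is the
    first even index, column 4 of the inverse has only its diagonal entry. *)
Lemma borelH_pfaffian b y : borelH b ->
  pfaffian (b *m y) = invmx b (inord 4) (inord 4) * pfaffian y.
Proof.
move=> Bb; have := Bb; rewrite borelHE => -[Hb _].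
have [ub pr] := E6_preserves (A5A1_sub Hb).
have Bv := subgroupV (borelH_subgroup K) Bb.
have := Bv; rewrite borelHE => -[Hv [_ uv]].
rewrite /pfaffian !mulmxA -(A5A1_piU Hb) -!mulmxA.
set x := piU K *m y.
have -> : cross (b *m x) (b *m x) = cross x x *m invmx b.
  by rewrite -(pr x x) mulmxK.
rewrite mxE (bigD1 (inord 4)) //= big1 ?addr0 => [|c]; first by rewrite mulrC.
have i4 : nat_of_ord (inord 4 : 'I_27) = 4%N by rewrite inordK.
rewrite -val_eqE /= neq_ltn i4 => /orP [c4|c4].
  by rewrite (A5A1_parity Hv) ?mulr0 // i4 odd_lt4.
by rewrite (uv c (inord 4)) ?mulr0 // addn0 i4.
Qed.

Lemma cross_cone b y : borelH b -> cross y y = 0 -> cross (b *m y) (b *m y) = 0.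
Proof.
rewrite borelHE => -[/A5A1_sub Eb _] c0; have [ub pr] := E6_preserves Eb.
by rewrite -[LHS](mulmxK ub) pr c0 mul0mx.
Qed.

Lemma generic_cone_borel b y Z : borelH b -> generic_cone y [::] ->
  (forall a, (a < 27)%N -> a \in Z -> (b *m y) (inord a) 0 = 0) ->
  generic_cone (b *m y) Z.
Proof.
move=> Bb [c0 y26 y21 yp _] hZ; have Ub := borelH_upper Bb.
have Uv := subgroupV (upper_subgroup K 27) Ub.
split=> //; first exact: cross_cone.
- by rewrite borelH_26 // mulf_neq0 // upper_diag_neq0.
- by rewrite borelH_21 // mulf_neq0 // upper_diag_neq0.
- by rewrite borelH_pfaffian // mulf_neq0 // upper_diag_neq0.
Qed.

Lemma pivot_neq0 y Z p : generic_cone y Z -> pivot_ok Z p -> y (inord p) 0 != 0.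
Proof.
move=> [_ y26 y21 yp hZ] /or3P [/eqP -> //|/eqP -> //|/andP [/eqP -> chk]].
have lt : all (fun e => (e.1.1 < 27)%N && (e.1.2 < 27)%N) (cmat 4).
  exact: (all_iota0P check_cmat_lt).
have [|N N0 E] := quad_checkP (x := piU K *m y) chk lt.
  move=> i hi /orP [oi|iZ]; rewrite piU_entry inordK //; first by rewrite oi.
  by case: ifP => // _; apply: hZ.
apply: contra yp => /eqP y0; rewrite /pfaffian cross_coord inordK // E.
by rewrite !piU_entry !inordK //= y0 mul0r mulr0.
Qed.

Lemma reduction_step y Z st : generic_cone y Z -> reduction_ok Z st ->
  exists2 b, borelH b & generic_cone (b *m y) (st.1.2 :: Z).
Proof.
case: st => [[[t k] a] p] gy /=; have [c0 y26 y21 yp hZ] := gy.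
case/andP => /andP [/andP [pv a27] p27]; have yp0 := pivot_neq0 gy pv.
case: t => [/and3P [pk key /allP hk]|/andP [k27 chk]]; last first.
  exists 1%:M; first exact: (subgroup1 (borelH_subgroup K)).
  rewrite mul1mx; split=> // i i27; rewrite inE => /predU1P [->|]; last exact: hZ.
  have lt : all (fun e => (e.1.1 < 27)%N && (e.1.2 < 27)%N) (cmat k).
    exact: (all_iota0P check_cmat_lt).
  have [|N N0 E] := quad_checkP (x := y) chk lt; first exact: hZ.
  have /eqP := cross_coord y y (inord k); rewrite c0 mxE inordK // E eq_sym.
  by rewrite !mulf_eq0 (negbTE N0) (negbTE yp0) orbF => /eqP.
have k72 : (k < 72)%N by apply: ltn_trans (posH_lt pk) _.
have /and4P [u1 u2 _ /allP sq] := all_iota0P check_entries k72.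
have keyP (i j : 'I_27) : rvect K k i j != 0 ->
    exists2 e, e \in rmat k & e.1 = (nat_of_ord i, nat_of_ord j).
  move=> nz; have /mapP [e eL E] : (nat_of_ord i, nat_of_ord j) \in [seq e.1 | e <- rmat k].
    by apply: contraNT nz => /scoef_notin z; rewrite rvectE mxE z.
  by exists e.
have rowa : (rvect K k *m y) (inord a) 0 =
    rvect K k (inord a) (inord p) * y (inord p) 0.
  rewrite mxE (bigD1 (inord p)) //= big1 ?addr0 // => j nj.
  have [->|/keyP [e eL E]] := eqVneq (rvect K k (inord a) j) 0; first by rewrite mul0r.
  have /mapP [e' e'L E'] := key.
  have ee : e.1.1 = e'.1.1 by rewrite E -E' /= inordK.
  have {}ee := entry_uniq u1 eL e'L ee.
  by case/eqP: nj; apply: val_inj; rewrite /= inordK // -[p]/((a, p).2) E' -ee E.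
have nz : rvect K k (inord a) (inord p) != 0.
  have /mapP [e eL E] := key; rewrite rvectE mxE !inordK //.
  rewrite (scoef_uniq u2 (z := e.2)); last by rewrite E; case: (e) eL.
  have /BinInt.Z.eqb_spec e1 := sq _ eL.
  by apply: contraTneq isT => e0; have := zrM K e.2 e.2;
     rewrite e1 e0 mul0r zr1 => /eqP; rewrite oner_eq0.
exists (rootx k (- (y (inord a) 0) / (rvect K k (inord a) (inord p) * y (inord p) 0))).
  exact: borelHx.
apply: generic_cone_borel; [exact: borelHx|by split|].
move=> i i27; rewrite /rootx mulmxDl mul1mx -scalemxAl mxE [X in _ + X]mxE inE.
case/predU1P => [->|iZ].
  by rewrite rowa mulfVK ?subrr // mulf_neq0.
rewrite (hZ i i27 iZ) add0r mxE big1 ?mulr0 // => j _.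
have [->|/keyP [e eL E]] := eqVneq (rvect K k (inord i) j) 0; first by rewrite mul0r.
have := hk _ eL; rewrite E /= inordK // iZ /= => jZ.
by rewrite -[j]inord_val hZ ?mulr0.
Qed.

Lemma reductions y Z l : generic_cone y Z -> reductions_ok Z l ->
  exists2 b, borelH b & generic_cone (b *m y) ([seq st.1.2 | st <- rev l] ++ Z).
Proof.
have sB := borelH_subgroup K.
elim: l y Z => [|st l IH] y Z gy /=.
  by exists 1%:M; rewrite ?mul1mx //; apply: (subgroup1 sB).
case/andP => /(reduction_step gy) [b Bb gb] /(IH _ _ gb) [b' Bb' gb'].
exists (b' *m b); first exact: (subgroupM sB).
by rewrite -mulmxA rev_cons map_rcons cat_rcons.
Qed.

Lemma normal_form y : generic_cone y [::] -> exists2 b, borelH b &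
  generic_cone (b *m y) [seq a <- iota 0 27 | a \notin [:: 5; 14; 21; 26]%N].
Proof.
have /andP [chk /all_iota0P full] := check_reduction.
move=> /reductions /(_ chk) [b Bb [h1 h2 h3 h4 h5]]; exists b => //; split=> //.
move=> a a27; rewrite mem_filter => /andP [na _]; apply: h5 => //.
by rewrite cats0 map_rev mem_rev; have := full _ a27; rewrite (negbTE na).
Qed.

Lemma cone_coord5 y : cross y y = 0 ->
  (forall a, (a < 27)%N -> a \notin [:: 5; 14; 21; 26]%N -> y (inord a) 0 = 0) ->
  y (inord 5) 0 * y (inord 26) 0 = - (y (inord 14) 0 * y (inord 21) 0).
Proof.
move=> c0 hz; have := cross_coord y y (inord 4); rewrite c0 mxE inordK //.
have -> : cmat 4 = cubic_mat 4 by vm_compute.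
rewrite /cubic_mat /= !big_cons big_nil /=.
rewrite (hz 7) // (hz 25) // (hz 16) // (hz 19) // (hz 17) // (hz 18) //.
rewrite !(mul0r, mulr0, addr0, add0r) !zr1 !mul1r.
move: (y (inord 5) 0) (y (inord 26) 0) (y (inord 14) 0) (y (inord 21) 0).
move=> p q r s e; have : 2 * (p * q + r * s) = 0 by rewrite e; ring.
by move/eqP; rewrite mulf_eq0 pnatr_eq0 /= addr_eq0 => /eqP.
Qed.

Lemma torus_normal_form y y' : 
  let Z := [seq a <- iota 0 27 | a \notin [:: 5; 14; 21; 26]%N] in
  generic_cone y Z -> generic_cone y' Z ->
  exists2 t, @E6_torus K t & t *m y = y'.
Proof.
move=> Z gy gy'.
have chk : pivot_ok Z 14 by vm_compute.
have y14 := pivot_neq0 gy chk; have y14' := pivot_neq0 gy' chk.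
have zero x : generic_cone x Z -> forall a, (a < 27)%N ->
    a \notin [:: 5; 14; 21; 26]%N -> x (inord a) 0 = 0.
  by move=> [_ _ _ _ h] a a27 na; apply: h => //; rewrite mem_filter na mem_iota.
have e5 := cone_coord5 (let: And5 h _ _ _ _ := gy in h) (zero _ gy).
have e5' := cone_coord5 (let: And5 h _ _ _ _ := gy' in h) (zero _ gy').
have [_ y26 y21 _ _] := gy; have [_ y26' y21' _ _] := gy'.
move: e5 e5'; set p := y (inord 5) 0; set p' := y' (inord 5) 0.
set q := y (inord 26) 0 in y26 *; set q' := y' (inord 26) 0 in y26' *.
set r := y (inord 14) 0 in y14 *; set r' := y' (inord 14) 0 in y14' *.
set s := y (inord 21) 0 in y21 *; set s' := y' (inord 21) 0 in y21' *.
move=> e5 e5'.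
have ep : p = - (r * s) / q by rewrite -e5 mulfK.
have ep' : p' = - (r' * s') / q' by rewrite -e5' mulfK.
(* Solved from the weights so as to scale coordinates 26, 21 and 14 by q'/q, s'/s and r'/r;
   coordinate 5 then agrees by the remaining cone equation. *)
pose t (j : 'I_6) : K := nth 1 [:: 1; 1; s / s'; 1; (s / s') * (r / r'); q / q'] j.
have t0 : nonzero_fun t.
  rewrite /t; case=> -[|[|[|[|[|[|]]]]]] // hj;
    by rewrite /= ?oner_neq0 ?mulf_neq0 ?invr_eq0.
exists (torus_elt t); first by exists t.
apply/matrixP => a b; rewrite ord1 torus_mull wtE.
have [|na] := boolP (nat_of_ord a \in [:: 5; 14; 21; 26]%N); last first.
  by rewrite -[a]inord_val (zero _ gy _ (ltn_ord a) na) (zero _ gy' _ (ltn_ord a) na) mulr0.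
rewrite !big_ord_recl big_ord0 /t /= !exp1rz !mul1r mulr1.
rewrite !inE; case/or4P => /eqP ea; have ea' : a = inord a by rewrite inord_val.
- rewrite ea ea' ea /bump /= -[y _ 0]/p -[y' _ 0]/p' /= ep ep' ?expr0z ?mul1r ?exprN1.
  by rewrite ?expr1z; field; rewrite ?y26 ?y26' ?y14 ?y14' ?y21 ?y21'.
- rewrite ea ea' ea /bump /= -[y _ 0]/r -[y' _ 0]/r' /= ?expr0z ?mulr1 ?exprN1 ?expr1z.
  by field; rewrite ?y26 ?y26' ?y14 ?y14' ?y21 ?y21'.
- rewrite ea ea' ea /bump /= -[y _ 0]/s -[y' _ 0]/s' /= ?expr0z ?mulr1 ?exprN1 ?expr1z.
  by field; rewrite ?y26 ?y26' ?y14 ?y14' ?y21 ?y21'.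
- rewrite ea ea' ea /bump /= -[y _ 0]/q -[y' _ 0]/q' /= ?expr0z ?mul1r ?exprN1 ?expr1z.
  by field; rewrite ?y26 ?y26' ?y14 ?y14' ?y21 ?y21'.
Qed.

Lemma generic_transitive y y' : generic_cone y [::] -> generic_cone y' [::] ->
  exists2 b, borelH b & b *m y = y'.
Proof.
have sB := borelH_subgroup K.
move=> /normal_form [b Bb gb] /normal_form [b' Bb' gb'].
have [t Tt et] := torus_normal_form gb gb'.
exists (invmx b' *m (t *m b)).
  apply: (subgroupM sB); first exact: (subgroupV sB).
  by apply: (subgroupM sB) => //; apply: sub_generated; left.
rewrite -2!mulmxA et mulmxA mulVmx ?mul1mx //; exact: (subgroup_unit sB).
Qed.

Let e0 : 'cV[K]_27 := delta_mx 0 0.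

Lemma E6_cone g : @E6_group K g -> cross (g *m e0) (g *m e0) = 0.
Proof.
move=> Eg; have [ug pr] := E6_preserves Eg.
rewrite -[LHS](mulmxK ug) pr (_ : cross e0 e0 = 0) ?mul0mx //.
apply/rowP => c; rewrite cross_delta mxE.
have E : scoef (cmat 0%N) 0%N c = BinNums.Z0.
  have /all_iota0P h : all (fun c => BinInt.Z.eqb (scoef (cmat 0%N) 0%N c) BinNums.Z0)
    (iota 0 27) by vm_compute.
  by apply/BinInt.Z.eqb_spec; apply: h.
exact: (congr1 (zr K) E).
Qed.

(** A word bringing the highest weight vector into the normal form. In [base_wordE] the coordinate
    21 is -1, as forced by x_5 x_26 = - x_14 x_21 when the other three are 1. *)
Definition base_word : seq (nat * BinNums.Z) :=
  let p := BinNums.Zpos BinNums.xH in let m := BinNums.Zneg BinNums.xH in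
  [:: (19, p); (31, p); (35, p); (71, m); (35, p); (22, p); (58, m); (22, p)]%N.

Lemma base_wordE : gword K base_word *m e0 =
  delta_mx (inord 26) 0 + delta_mx (inord 14) 0 + delta_mx (inord 5) 0
  - delta_mx (inord 21) 0.
Proof.
have e0E : imx K 27 1 (sunit 0 0) = e0 := imx_unit K (0 : 'I_27) (0 : 'I_1).
rewrite -e0E -word_vecE (imx_seqv K 27 1 (l' := sunit 26 0 ++ sunit 14 0 ++ sunit 5 0 ++
  sneg (sunit 21 0))); last by vm_compute.
rewrite !imx_cat imx_neg -!addrA.
have U (a : nat) : (a < 27)%N -> imx K 27 1 (sunit a 0) = delta_mx (inord a) 0.
  by move=> ha; rewrite -imx_unit inordK.
by rewrite !U.
Qed.

Lemma base_generic : generic_cone (gword K base_word *m e0) [::].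
Proof.
have Eg : @E6_group K (gword K base_word) by apply: gword_E6; vm_compute.
have val (a : nat) : (a < 27)%N -> (gword K base_word *m e0) (inord a) 0 =
    (a == 26)%:R + (a == 14)%:R + (a == 5)%:R - (a == 21)%:R :> K.
  move=> ha; rewrite base_wordE !mxE !andbT -!val_eqE /= !inordK //.
split; first exact: E6_cone.
- by rewrite val //= subr0 !addr0 oner_neq0.
- by rewrite val //= !addr0 add0r oppr_eq0 oner_neq0.
- rewrite /pfaffian cross_coord inordK //.
  have -> : cmat 4 = cubic_mat 4 by vm_compute.
  rewrite /cubic_mat /= !big_cons big_nil /= !piU_entry !inordK //= !val //=.
  rewrite !zr1; apply/eqP => E; have : (2 : K) = 0 by rewrite -[RHS]oppr0 -E; ring.
  by move/eqP; rewrite pnatr_eq0.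
by [].
Qed.

(** The double coset is exactly the locus F != 0 of G: F is rescaled by nonzero factors under B and
    P_1, and B acts transitively on generic points of the cone. *)
Theorem parabolic0_spherical : A5A1_spherical (@parabolic K 0).
Proof.
have sG := E6_subgroup K; have sB := borelH_subgroup K.
have BG b : borelH b -> @E6_group K b by move=> /borelH_sub /A5A1_sub.
apply/(sphericalE sG (@A5A1_sub K) (@parabolic_sub K 0) (parabolic_subgroup K 0)).
have Eg0 : @E6_group K (gword K base_word) by apply: gword_E6; vm_compute.
set g0 := gword K base_word in Eg0 *.
exists (@borelH K), g0; split; [exact: borelH_borel|exact: Eg0|].
pose F (g : 'M[K]_27) := (g *m e0) (inord 26) 0 * (g *m e0) (inord 21) 0 *
  pfaffian (g *m e0).
have pF : polyfun F.
  have hA := polyfun_alg K 27.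
  have hy : mxfun (@polyfun K 27) (fun g => g *m e0).
    by apply: (mxfun_mul hA); [exact: polyfun_id|exact: (mxfun_const hA)].
  apply: (fa_mul hA); first exact: (fa_mul hA).
  have hp := mxfun_mul hA (mxfun_const hA (piU K)) hy.
  apply: (fa_ext (f := fun g => \sum_(e <- cmat (inord 4 : 'I_27)) zr K e.2 *
    ((piU K *m (g *m e0)) (inord e.1.1) 0 * (piU K *m (g *m e0)) (inord e.1.2) 0))).
    apply: (fa_sum hA) => e; apply: (fa_mul hA); first exact: (fa_const hA).
    by apply: (fa_mul hA).
  by move=> g; rewrite /pfaffian cross_coord.
exists [set g | forall _ : unit, F g = 0]; first exact: zclosed_zeros.
have Fgen g : @E6_group K g -> F g != 0 -> generic_cone (g *m e0) [::].
  by move=> Eg; rewrite !mulf_eq0 !negb_or => /andP [/andP [h1 h2] h3]; split=> //;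
     apply: E6_cone.
have genF g : generic_cone (g *m e0) [::] -> F g != 0.
  by move=> [_ h1 h2 h3 _]; rewrite !mulf_neq0.
apply/seteqP; split=> g.
  move=> [b [p [Bb Pp ->]]]; have Ep := parabolic_sub Pp.
  have Ebg := subgroupM sG (BG _ Bb) Eg0.
  split; first exact: (subgroupM sG).
  move=> /(_ tt); apply/eqP; have := Pp; rewrite parabolic0E => -[_ [c]]; rewrite -/e0 => ec.
  have c0 : c != 0.
    apply: contraTneq isT => c0; move: ec; rewrite c0 scale0r => ec.
    have := mulKmx (subgroup_unit sG Ep) e0; rewrite -/e0 ec mulmx0.
    by move/matrixP/(_ 0 0)/eqP; rewrite !mxE !eqxx eq_sym oner_eq0.
  have gb : generic_cone (b *m (g0 *m e0)) [::].
    exact: generic_cone_borel Bb base_generic _.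
  apply: genF; rewrite -(mulmxA (b *m g0) p e0) ec -scalemxAr -(mulmxA b g0 e0).
  have [h1 h2 h3 h4 _] := gb; split=> //.
  - by rewrite crossZl crossZr h1 !scaler0.
  - by rewrite mxE mulf_neq0.
  - by rewrite mxE mulf_neq0.
  - rewrite /pfaffian -!scalemxAr crossZl crossZr !mxE.
    by rewrite !mulf_neq0.
move=> [Eg /existsNP [_ /eqP Fg]].
have [b Bb eb] := generic_transitive base_generic (Fgen _ Eg Fg).
have Ebg := subgroupM sG (BG _ Bb) Eg0.
exists b, (invmx (b *m g0) *m g); split=> //; last first.
  by rewrite mulmxA mulmxV ?mul1mx // (subgroup_unit sG Ebg).
rewrite parabolic0E; split.
  by apply: (subgroupM sG) => //; apply: (subgroupV sG).
exists 1; rewrite scale1r -mulmxA -eb (mulmxA b).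
by rewrite mulKmx // (subgroup_unit sG Ebg).
Qed.

End OpenOrbit.

(** * Semi-invariants for P_2, P_3 and P_4 *)

Lemma check_theta_comm : all (fun k =>
  szero (commutator (rmat 35) (rmat k)) && szero (commutator (rmat 71) (rmat k)))
  [:: 0; 2; 3; 4; 5; 36; 38; 39; 40; 41]%N.
Proof. by vm_compute. Qed.

Section Casimir.
Variable K : numClosedFieldType.
Local Notation G := (@E6_group K).
Local Notation H := (@A5A1_group K).
Implicit Types (A : 'M[K]_27).

Lemma E6_irreducible : zirred G.
Proof.
have uS g : [set g | exists (i : 'I_6) (t : K), g = x_pos i t \/ g = x_neg i t] g ->
    g \in unitmx.
  by move=> [i [t [->|->]]]; rewrite ?x_posE ?x_negE rootx_unit.
apply: zirred_generated => // g hg; case: (hg) => i [t h].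
have [k [k72 ->]] : exists k, (k < 72)%N /\ g = rootx k t.
  have i72 : (i < 72)%N by apply: ltn_trans (ltn_ord i) _.
  case: h => ->; first by exists i; rewrite x_posE.
  by exists (ropp i); rewrite x_negE ropp_lt.
exists (fun u => rootx k (t * (u - 1))); split.
  by apply: rootx_curve => r; apply: E6_root.
exists 2; first by rewrite pnatr_eq0.
by congr (rootx k _); ring.
Qed.

Lemma open_orbit_proportional (B P : set 'M[K]_27) g0 (f1 f2 : 'M[K]_27 -> K) :
  B `<=` G -> P `<=` G -> G g0 -> B 1%:M -> P 1%:M ->
  zopen_in G (dcoset B g0 P) -> polyfun f1 -> polyfun f2 ->
  (forall b, B b -> exists c, forall g, G g ->
     f1 (b *m g) = c * f1 g /\ f2 (b *m g) = c * f2 g) ->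
  (forall p, P p -> exists c, forall g, G g ->
     f1 (g *m p) = c * f1 g /\ f2 (g *m p) = c * f2 g) ->
  exists a1 a2, (a1 != 0) || (a2 != 0) /\
    forall g, G g -> a1 * f1 g + a2 * f2 g = 0.
Proof.
move=> BG PG Gg0 B1 P1 [Z cZ eZ] p1 p2 hB hP; have sG := E6_subgroup K.
have [a1 [a2 [nz e0]]] : exists a1 a2, (a1 != 0) || (a2 != 0) /\
    a1 * f1 g0 + a2 * f2 g0 = 0.
  have [f20|nz] := eqVneq (f2 g0) 0.
    by exists 0, 1; rewrite oner_neq0 orbT f20 mul0r mulr0 addr0.
  by exists (f2 g0), (- f1 g0); rewrite nz; split=> //; ring.
exists a1, a2; split=> // g Gg; pose f g := a1 * f1 g + a2 * f2 g.
have hA := polyfun_alg K 27.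
have pf : polyfun f.
  by apply: (fa_add hA); apply: (fa_mul hA) => //; apply: (fa_const hA).
have fD x : dcoset B g0 P x -> f x = 0.
  move=> [b [p [Bb Pp ->]]]; have [c hc] := hB b Bb; have [d hd] := hP p Pp.
  have Gbg := subgroupM sG (BG _ Bb) Gg0.
  rewrite /f !(hd _ Gbg).1 !(hd _ Gbg).2 !(hc _ Gg0).1 !(hc _ Gg0).2.
  by rewrite !mulrA ![_ * c]mulrC ![_ * d]mulrC -!mulrA -!mulrDr e0 !mulr0.
have Dg0 : dcoset B g0 P g0 by exists 1%:M, 1%:M; rewrite mul1mx mulmx1.
have nZ : ~ Z g0 by move: Dg0; rewrite eZ => -[].
have [q [pq q0 qZ]] := zclosed_sep cZ nZ.
apply/eqP/negPn/negP => fg.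
have [x Gx [fx qx]] := E6_irreducible pf pq Gg Gg0 fg q0.
case/eqP: fx; apply: fD; rewrite eZ; split=> // Zx.
by rewrite qZ // eqxx in qx.
Qed.

(* The A1 factor is <e, f, h>; [casimir] is the tensor 2 e*f + 2 f*e + h*h,
   evaluated on the linear forms X |-> tr (X A) and X |-> tr (X A'). *)
Definition theta_e : 'M[K]_27 := rvect K 35.
Definition theta_f : 'M[K]_27 := rvect K 71.
Definition theta_h : 'M[K]_27 := theta_e *m theta_f - theta_f *m theta_e.

Definition casimir A A' : K :=
  2 * \tr (theta_e *m A) * \tr (theta_f *m A')
  + 2 * \tr (theta_f *m A) * \tr (theta_e *m A')
  + \tr (theta_h *m A) * \tr (theta_h *m A').

Definition conjr (b A : 'M[K]_27) : 'M[K]_27 := b *m A *m invmx b.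

Lemma trace_conjr X b A : \tr (X *m conjr b A) = \tr (invmx b *m X *m b *m A).
Proof. by rewrite /conjr mulmxA mxtrace_mulC !mulmxA. Qed.

Lemma conjrM b c A : b \in unitmx -> c \in unitmx ->
  conjr (b *m c) A = conjr b (conjr c A).
Proof. by move=> ub uc; rewrite /conjr invmxM // !mulmxA. Qed.

(** Checked on generators of H: T scales e and f by inverse factors, the root groups of A_5
    centralize the A_1 factor, and on the root groups of A_1 itself the conjugates of e, f and h are
    written out. *)
Lemma casimir_conjr b A A' : H b -> casimir (conjr b A) (conjr b A') = casimir A A'.
Proof.
pose I := [set b : 'M[K]_27 | b \in unitmx /\
  forall A A', casimir (conjr b A) (conjr b A') = casimir A A'].
have sI : subgroup I.
  split.
  - by move=> g [].
  - by split=> [|B B']; rewrite ?unitmx1 // /conjr invmx1 !mul1mx !mulmx1.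
  - move=> g h [ug hg] [uh hh]; split=> [|B B']; first by rewrite unitmx_mul ug.
    by rewrite !conjrM // hg hh.
  - move=> g [ug hg]; split=> [|B B']; first by rewrite unitmx_inv.
    rewrite -hg -!conjrM ?unitmx_inv // mulmxV //.
    by rewrite /conjr invmx1 !mul1mx !mulmx1.
have ee : theta_e *m theta_e = 0 by apply: rvect_sq.
have ff : theta_f *m theta_f = 0 by apply: rvect_sq.
have efe : theta_e *m theta_f *m theta_e = theta_e by apply: (rvect_efe K 35).
have fef : theta_f *m theta_e *m theta_f = theta_f by apply: (rvect_efe K 71).
have invx k s : invmx (rootx k s) = rootx k (- s) :> 'M[K]_27.
  exact: (rd_invx (root_datumG K)).
have mid (s : K) x X : (1%:M + (- s) *: x) *m X *m (1%:M + s *: x) =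
    X + s *: (X *m x - x *m X) - s ^+ 2 *: (x *m X *m x).
  rewrite !(mulmxDl, mulmxDr) !mul1mx !mulmx1 -!scalemxAl -!scalemxAr -?scalemxAl.
  by move: (X *m x) (x *m X) (x *m X *m x) => p q r;
     apply/matrixP => i j; rewrite !mxE; ring.
rewrite A5A1_groupE => Hb; suff [_ ->//] : I b.
apply: (generated_sub sI _ Hb) => {Hb} g [[t t0 <-]|[k [s [Sk hk]]]].
  split=> [|B B']; first exact: torus_elt_unit.
  set T := torus_elt t; set c := root_char (rcoef 35) t.
  have c0 : c != 0 := root_char_neq0 _ t0.
  have uT : T \in unitmx by apply: torus_elt_unit.
  have Te : invmx T *m theta_e *m T = c^-1 *: theta_e.
    apply: (scalerI c0); rewrite scalerA divff // scale1r -mulmxA scalemxAr.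
    by rewrite -torus_rvect // mulKmx.
  have Tf : invmx T *m theta_f *m T = c *: theta_f.
    have := torus_rvect 71 t0; rewrite -[71%N]/(ropp 35) root_char_opp // -/c => e.
    have c0' : c^-1 != 0 by rewrite invr_eq0.
    apply: (scalerI c0'); rewrite scalerA mulVf // scale1r -mulmxA scalemxAr.
    by rewrite -e mulKmx.
  have Th : invmx T *m theta_h *m T = theta_h.
    have sp X Y : invmx T *m (X *m Y) *m T = (invmx T *m X *m T) *m (invmx T *m Y *m T).
      by rewrite !mulmxA mulmxK.
    rewrite /theta_h mulmxBr mulmxBl !sp Te Tf -!scalemxAl -!scalemxAr !scalerA.
    by rewrite divff // mulVf // !scale1r.
  rewrite /casimir !trace_conjr Te Tf Th -!scalemxAl !linearZ /=.
  by move: (\tr _) (\tr _) (\tr _) (\tr _) (\tr _) (\tr _) => *; field.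
have com i r : (i \in [:: 0; 2; 3; 4; 5; 36; 38; 39; 40; 41]%N) -> I (rootx i r).
  move=> /(allP check_theta_comm) /andP [/(imx_szero K 27 27) ce /(imx_szero K 27 27) cf].
  rewrite imx_commutator in ce; rewrite imx_commutator in cf.
  split=> [|B B']; first exact: rootx_unit.
  move/eqP: ce; rewrite subr_eq0 => /eqP ce; move/eqP: cf; rewrite subr_eq0 => /eqP cf.
  have cx X : X *m rvect K i = rvect K i *m X -> invmx (rootx i r) *m X *m rootx i r = X.
    move=> cX.
    by rewrite -mulmxA /rootx mulmxDr mulmx1 -scalemxAr cX scalemxAl -{1}[X]mul1mx -mulmxDl
      -/(rootx i r) mulKmx // rootx_unit.
  have he : invmx (rootx i r) *m theta_e *m rootx i r = theta_e by apply: cx.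
  have hf : invmx (rootx i r) *m theta_f *m rootx i r = theta_f by apply: cx.
  have hh : invmx (rootx i r) *m theta_h *m rootx i r = theta_h.
    apply: cx; rewrite /theta_h mulmxBl mulmxBr -[theta_e *m theta_f *m _]mulmxA.
    rewrite -[theta_f *m theta_e *m _]mulmxA !(ce, cf) /theta_e /theta_f.
    by rewrite !mulmxA ce cf.
  by rewrite /casimir !trace_conjr he hf hh.
have trN (X : 'M[K]_27) : \tr (- X) = - \tr X by rewrite raddfN.
have xe r : I (rootx 35 r).
  split=> [|B B']; first exact: rootx_unit.
  have he : invmx (rootx 35 r) *m theta_e *m rootx 35 r = theta_e.
    by rewrite invx mid ee mul0mx subrr !scaler0 addr0 subr0.
  have hf : invmx (rootx 35 r) *m theta_f *m rootx 35 r =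
      theta_f - r *: theta_h - r ^+ 2 *: theta_e.
    by rewrite invx mid -/theta_e efe -[theta_f *m theta_e - _]opprB scalerN.
  have hh : invmx (rootx 35 r) *m theta_h *m rootx 35 r = theta_h + 2 * r *: theta_e.
    have h1 : theta_h *m theta_e = theta_e.
      by rewrite mulmxBl efe -mulmxA ee mulmx0 subr0.
    have h2 : theta_e *m theta_h = - theta_e.
      by rewrite mulmxBr !mulmxA efe ee mul0mx sub0r.
    rewrite invx mid -/theta_e h1 h2 mulNmx ee oppr0 scaler0 subr0 opprK.
    by rewrite -mulr2n -scalerMnr scalerMnl mulr_natl.
  rewrite /casimir !trace_conjr he hf hh; move: theta_h theta_e theta_f => th te tf.
  rewrite !(mulmxDl, mulNmx) -!scalemxAl.
  rewrite !(mxtraceD, trN, mxtraceZ).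
  by ring.
have xf r : I (rootx 71 r).
  split=> [|B B']; first exact: rootx_unit.
  have hf : invmx (rootx 71 r) *m theta_f *m rootx 71 r = theta_f.
    by rewrite invx mid ff mul0mx subrr !scaler0 addr0 subr0.
  have he : invmx (rootx 71 r) *m theta_e *m rootx 71 r =
      theta_e + r *: theta_h - r ^+ 2 *: theta_f.
    by rewrite invx mid -/theta_f fef.
  have hh : invmx (rootx 71 r) *m theta_h *m rootx 71 r = theta_h - 2 * r *: theta_f.
    have h1 : theta_h *m theta_f = - theta_f.
      by rewrite mulmxBl fef -mulmxA ff mulmx0 sub0r.
    have h2 : theta_f *m theta_h = theta_f.
      by rewrite mulmxBr !mulmxA fef ff mul0mx subr0.
    rewrite invx mid -/theta_f h1 h2 ff scaler0 subr0 -opprD.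
    by rewrite -mulr2n scalerN -scalerMnr scalerMnl mulr_natl.
  rewrite /casimir !trace_conjr he hf hh; move: theta_h theta_e theta_f => th te tf.
  rewrite !(mulmxDl, mulNmx) -!scalemxAl.
  rewrite !(mxtraceD, trN, mxtraceZ).
  by ring.
move: Sk; rewrite /simpleH !inE => /or4P [|||/or3P []] /eqP ek; subst k;
  case: hk => ->; by [apply: com | apply: xe | apply: xf].
Qed.

End Casimir.

(** * Relations between semi-invariants, and eigenvectors of an arbitrary B *)

Definition oddroot (k : nat) : bool := odd (absz (rvec k)`_1).

(** The 40 odd root vectors span the H-summand (20, 2) of the Lie algebra. It is minuscule, so
    conjugation by a root element has no quadratic term. *)
Lemma check_odd_stable : all (fun g => all (fun k => oddroot k ==>
  szero (smul 27 (smul 27 (rmat g) (rmat k)) (rmat g)) &&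
  let j := rsum g k in
  if (j < 72)%N then
    oddroot j && seqv (commutator (rmat g) (rmat k)) (sscale (csgn g k) (rmat j))
  else szero (commutator (rmat g) (rmat k))) (iota 0 72))
  [:: 0; 2; 3; 4; 5; 35; 36; 38; 39; 40; 41; 71]%N.
Proof. by vm_compute. Qed.

Section Relation.
Variable K : numClosedFieldType.
Local Notation G := (@E6_group K).
Local Notation H := (@A5A1_group K).
Implicit Types (A X b g : 'M[K]_27) (B P : set 'M[K]_27).

Lemma casimirZ c c' A X : casimir (c *: A) (c' *: X) = c * c' * casimir A X.
Proof.
rewrite /casimir -!scalemxAr !mxtraceZ.
by move: theta_e theta_f theta_h => e f h; ring.
Qed.

Lemma casimir_fun (T : Type) (Q : (T -> K) -> Prop) (F F' : T -> 'M[K]_27) :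
  funalg Q -> mxfun Q F -> mxfun Q F' -> Q (fun x => casimir (F x) (F' x)).
Proof.
move=> hQ hF hF'; rewrite /casimir.
have h (E : T -> 'M[K]_27) M : mxfun Q E -> Q (fun x => \tr (M *m E x)).
  by move=> hE; apply: (fa_trace hQ); apply: (mxfun_mul hQ) => //; apply: (mxfun_const hQ).
by do ![apply: (fa_add hQ) | apply: (fa_mul hQ) | apply: (fa_const hQ) | apply: h].
Qed.

(** Both terms have degree 2 in A and degree 2 in the pair (A', r); this is what gives them equal
    characters. *)
Definition casimir_form (a1 a2 : K) A A' (r : K) : K :=
  a1 * casimir A A' ^+ 2 + a2 * (casimir A A * r ^+ 2).

Lemma casimir_form_fun (T : Type) (Q : (T -> K) -> Prop) a1 a2
    (F F' : T -> 'M[K]_27) r : funalg Q -> mxfun Q F -> mxfun Q F' -> Q r ->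
  Q (fun x => casimir_form a1 a2 (F x) (F' x) (r x)).
Proof.
move=> hQ hF hF' hr; rewrite /casimir_form.
have h (F1 F2 : T -> 'M[K]_27) (h1 : mxfun Q F1) (h2 : mxfun Q F2) :=
  casimir_fun hQ h1 h2.
apply: (fa_add hQ); apply: (fa_mul hQ); try exact: (fa_const hQ).
  exact: (fa_exp hQ 2 (h _ _ hF hF')).
by apply: (fa_mul hQ); [apply: h | apply: (fa_exp hQ 2 hr)].
Qed.

Lemma casimir_formZ a1 a2 c c' A A' r :
  casimir_form a1 a2 (c *: A) (c' *: A') (c' * r) =
  (c * c') ^+ 2 * casimir_form a1 a2 A A' r.
Proof. by rewrite /casimir_form !casimirZ; ring. Qed.

Lemma casimir_form_conjr a1 a2 b A A' r : H b ->
  casimir_form a1 a2 (conjr b A) (conjr b A') r = casimir_form a1 a2 A A' r.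
Proof. by move=> Hb; rewrite /casimir_form !casimir_conjr. Qed.

(** A' and r are multiplied by a common factor c2 and A by c1, up to conjugation by an element of H,
    which [casimir] does not see. Both terms are thus multiplied by (c1 c2)^2. *)
Lemma casimir_relation B P g0 (A A' : 'M[K]_27 -> 'M[K]_27) (r : 'M[K]_27 -> K) :
  B `<=` H -> B 1%:M -> P `<=` G -> P 1%:M -> G g0 ->
  zopen_in G (dcoset B g0 P) ->
  mxfun (@polyfun K 27) A -> mxfun (@polyfun K 27) A' -> polyfun r ->
  (forall b, B b -> exists c1 c2, forall g, G g ->
    [/\ A (b *m g) = c1 *: conjr b (A g), A' (b *m g) = c2 *: conjr b (A' g)
      & r (b *m g) = c2 * r g]) ->
  (forall p, P p -> exists c1 c2, forall g, G g ->
    [/\ A (g *m p) = c1 *: A g, A' (g *m p) = c2 *: A' g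
      & r (g *m p) = c2 * r g]) ->
  exists a1 a2, (a1 != 0) || (a2 != 0) /\
    forall g, G g -> casimir_form a1 a2 (A g) (A' g) (r g) = 0.
Proof.
move=> BH B1 PG P1 Gg0 op pA pA' pr hB hP.
have hQ := polyfun_alg K 27.
pose f a1 a2 g := casimir_form a1 a2 (A g) (A' g) (r g).
have pf a1 a2 : polyfun (f a1 a2) by apply: casimir_form_fun.
have BG : B `<=` G by move=> b /BH; apply: A5A1_sub.
have [||a1 [a2 [nz e]]] := open_orbit_proportional BG PG Gg0 B1 P1 op (pf 1 0) (pf 0 1).
- move=> b Bb; have [c1 [c2 h]] := hB b Bb; exists ((c1 * c2) ^+ 2) => g Gg.
  have [e1 e2 e3] := h g Gg.
  by rewrite /f e1 e2 e3 !casimir_formZ !(casimir_form_conjr _ _ _ _ _ (BH _ Bb)).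
- move=> p Pp; have [c1 [c2 h]] := hP p Pp; exists ((c1 * c2) ^+ 2) => g Gg.
  by have [e1 e2 e3] := h g Gg; rewrite /f e1 e2 e3 !casimir_formZ.
exists a1, a2; split=> // g Gg; rewrite -(e g Gg) /f /casimir_form.
by ring.
Qed.

Section Eigenvectors.
Variable B : set 'M[K]_27.
Hypothesis hB : closed_conn_solvable H B.

Let BH : B `<=` H. Proof. by case: hB => _ [Z _ ->] _ _ b []. Qed.
Let dB b : B b -> \det b = 1. Proof. by move=> /BH; apply: A5A1_special. Qed.
Let sB : subgroup B. Proof. by case: hB. Qed.
Let eigenvector m (rho : 'M[K]_27 -> 'M[K]_m) k (S : 'M[K]_(k, m)) :
  polyrep B rho -> S != 0 -> rep_stable B rho S ->
  exists2 v, rep_eigen B rho v & (v <= S)%MS.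
Proof. by case: hB => ? ? ? ? *; apply: lie_kolchin. Qed.

Lemma parity_eigen (o : bool) : exists x : 'cV[K]_27,
  [/\ x != 0, forall a : 'I_27, oddw a != o -> x a 0 = 0 &
      forall b, B b -> exists c, invmx b *m x = c *: x].
Proof.
pose C : 'M[K]_27 := if o then 1%:M - piU K else piU K.
have cE (x : 'rV[K]_27) (a : 'I_27) : (x *m C) 0 a = if oddw a == o then x 0 a else 0.
  have sub (y : 'rV[K]_27) : (x - y) 0 a = x 0 a - y 0 a by rewrite !mxE.
  rewrite /C; case: (o); rewrite ?mulmxBr ?mulmx1 ?sub piU_entryr;
    by case: (oddw a); rewrite /= ?subr0 ?subrr.
have CT : C^T = C.
  by rewrite /C; case: (o); rewrite ?linearB /= ?trmx1 tr_diag_mx.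
have Cb b : H b -> C *m b = b *m C.
  by move=> Hb; rewrite /C; case: (o); rewrite ?mulmxBr ?mulmxBl ?mulmx1 ?mul1mx A5A1_piU.
(* Representations act on row vectors from the right, so the action of b^-1 on columns appears as
   the transpose of the adjugate. The row space of C is the summand of parity o. *)
have [|||v [v0 ev] vC] := @eigenvector _ (fun b => (\adj b)^T) _ C.
- split=> [||g h Bg Bh].
  + by apply: mxfun_tr; apply: (mxfun_adj (polyfun_alg _ _)); apply: polyfun_id.
  + by rewrite -invmx_adj ?det1 // invmx1 trmx1.
  + have Bgh := subgroupM sB Bg Bh.
    rewrite -!invmx_adj ?dB // invmxM ?trmx_mul //; exact: (subgroup_unit sB).
- pose a : 'I_27 := if o then inord 0 else inord 4.
  apply/eqP => C0; have := cE (delta_mx 0 a) a; rewrite C0 mulmx0 mxE.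
  have -> : oddw a = o by rewrite /a; case: (o); rewrite inordK.
  by rewrite eqxx mxE !eqxx => /esym /eqP; rewrite oner_eq0.
- move=> b Bb; apply/submxP; exists ((\adj b)^T).
  rewrite -invmx_adj ?dB // -[in LHS]CT -[in RHS]CT -!trmx_mul; congr (_^T).
  by rewrite Cb //; apply: subgroupV (@A5A1_subgroup K) _; apply: BH.
have {vC} [D eD] : exists D : 'rV_27, v = D *m C by apply/submxP.
exists v^T; split=> [|a na|b Bb].
- by apply: contraNneq v0 => e; rewrite -[v]trmxK e trmx0.
- by rewrite mxE eD cE (negPf na).
- have [c hc] := ev b Bb; exists c.
  by rewrite -linearZ /= -hc trmx_mul trmxK invmx_adj // dB.
Qed.

Definition odd_part (c : 'I_72 -> K) : 'M[K]_27 := \sum_(k < 72 | oddroot k) c k *: rvect K k.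

Let S : 'M[K]_(72, 27 * 27) := \matrix_(k < 72)
  (if oddroot k then mxvec (rvect K k) else 0).

Let odd_memP X : reflect (exists c, X = odd_part c) (mxvec X <= S)%MS.
Proof.
have rS (k : 'I_72) : row k S = if oddroot k then mxvec (rvect K k) else 0 by rewrite rowK.
apply: (iffP submxP) => [[D e]|[c ->]].
  exists (D 0); apply: (can_inj mxvecK).
  rewrite e mulmx_sum_row /odd_part linear_sum [in RHS]big_mkcond /=; apply: eq_bigr => k _.
  by rewrite rS; case: ifP; rewrite ?scaler0 // linearZ.
exists (\row_k c k).
rewrite mulmx_sum_row /odd_part linear_sum [in LHS]big_mkcond /=; apply: eq_bigr => k _.
by rewrite rS mxE; case: ifP; rewrite ?scaler0 // linearZ.
Qed.

Let odd_mem_sum (I : finType) (Q : pred I) (F : I -> 'M[K]_27) :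
  (forall i, Q i -> mxvec (F i) <= S)%MS -> (mxvec (\sum_(i | Q i) F i) <= S)%MS.
Proof. by move=> h; rewrite linear_sum; apply: summx_sub. Qed.

Let odd_memZ c X : (mxvec X <= S)%MS -> (mxvec (c *: X) <= S)%MS.
Proof. by move=> h; rewrite linearZ; apply: scalemx_sub. Qed.

Let odd_memD X Y : (mxvec X <= S)%MS -> (mxvec Y <= S)%MS -> (mxvec (X + Y) <= S)%MS.
Proof. by move=> h h'; rewrite linearD; apply: addmx_sub. Qed.

Let odd_mem_rvect (k : nat) : (k < 72)%N -> oddroot k -> (mxvec (rvect K k) <= S)%MS.
Proof.
move=> k72 ok; have := row_sub (Ordinal k72) S.
by rewrite rowK /= ok.
Qed.

Let odd_stable b : H b -> forall X, (mxvec X <= S)%MS -> (mxvec (invmx b *m X *m b) <= S)%MS.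
Proof.
pose I := [set b : 'M[K]_27 | b \in unitmx /\ forall X, (mxvec X <= S)%MS ->
  (mxvec (invmx b *m X *m b) <= S)%MS /\ (mxvec (b *m X *m invmx b) <= S)%MS].
have sI : subgroup I.
  split.
  - by move=> g [].
  - by split=> [|X hX]; rewrite ?unitmx1 // !invmx1 !mul1mx !mulmx1.
  - move=> g h [ug hg] [uh hh]; split=> [|X hX]; first by rewrite unitmx_mul ug.
    have [g1 _] := hg X hX; have [_ h2] := hh X hX; rewrite invmxM //; split.
      by have [h1 _] := hh _ g1; rewrite !mulmxA in h1 *.
    by have [_ g2] := hg _ h2; rewrite !mulmxA in g2 *.
  - move=> g [ug hg]; split=> [|X hX]; first by rewrite unitmx_inv.
    by rewrite invmxK; have [] := hg X hX.
rewrite A5A1_groupE => Hb; suff [_ h] : I b by move=> X /h [].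
have mk b' : b' \in unitmx -> (forall k : 'I_72, oddroot k ->
    (mxvec (invmx b' *m rvect K k *m b') <= S)%MS) ->
    forall X, (mxvec X <= S)%MS -> (mxvec (invmx b' *m X *m b') <= S)%MS.
  move=> ub' h X /odd_memP [c ->]; rewrite mulmx_sumr mulmx_suml; apply: odd_mem_sum => k ok.
  by rewrite -scalemxAr -scalemxAl; apply: odd_memZ; apply: h.
have mk2 b' : I b' <-> b' \in unitmx /\ (forall k : 'I_72, oddroot k ->
    (mxvec (invmx b' *m rvect K k *m b') <= S)%MS /\
    (mxvec (b' *m rvect K k *m invmx b') <= S)%MS).
  split=> [[ub h]|[ub h]]; split=> //.
    by move=> k ok; apply: h; apply: odd_mem_rvect.
  move=> X hX; split; first by apply: mk => // k /h [].
  have := @mk (invmx b'); rewrite invmxK unitmx_inv; apply=> // k /h []; by [].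
apply: (generated_sub sI _ Hb) => {Hb} g [[t t0 <-]|[k [s [Sk hk]]]]; apply/mk2.
  have tor (u : 'I_6 -> K) k : nonzero_fun u ->
      torus_elt u *m rvect K k *m invmx (torus_elt u) = root_char (rcoef k) u *: rvect K k.
    by move=> u0; rewrite torus_rvect // -scalemxAl mulmxK // torus_elt_unit.
  have t0' : nonzero_fun (fun j => (t j)^-1) by move=> j; rewrite invr_eq0.
  split=> [|k ok]; first exact: torus_elt_unit.
  rewrite tor //; split; last by apply: odd_memZ; apply: odd_mem_rvect.
  rewrite torus_elt_inv // -[X in _ *m X](invmxK) torus_elt_inv // tor //.
  by apply: odd_memZ; apply: odd_mem_rvect.
have invx j u : invmx (rootx j u) = rootx j (- u) :> 'M[K]_27.
  exact: (rd_invx (root_datumG K)).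
have step i u (j : 'I_72) :
    (i \in [:: 0; 2; 3; 4; 5; 35; 36; 38; 39; 40; 41; 71]%N) -> oddroot j ->
    (mxvec (rootx i u *m rvect K j *m rootx i (- u)) <= S)%MS.
  move=> hi oj; have /implyP/(_ oj) := all_iota0P (allP check_odd_stable i hi) (ltn_ord j).
  move=> /andP [/(imx_szero K 27 27) z h]; rewrite !imx_mul -!rvectE in z.
  have -> : rootx i u *m rvect K j *m rootx i (- u) =
      rvect K j + u *: (rvect K i *m rvect K j - rvect K j *m rvect K i).
    rewrite /rootx !(mulmxDl, mulmxDr) !mul1mx !mulmx1 -!scalemxAl -!scalemxAr -?scalemxAl.
    rewrite z !scaler0; move: (_ *m rvect K j) (rvect K j *m _) => p q.
    by apply/matrixP => a b'; rewrite !mxE; ring.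
  apply: odd_memD; first exact: odd_mem_rvect.
  apply: odd_memZ; rewrite -imx_commutator; move: h => /=; case: ifP => [j72|_].
    move=> /andP [oj' /(imx_seqv K 27 27) ->]; rewrite imx_scale -rvectE.
    by apply: odd_memZ; apply: odd_mem_rvect.
  by move=> /(imx_szero K 27 27) ->; rewrite linear0 sub0mx.
have fin i u : (i \in [:: 0; 2; 3; 4; 5; 35; 36; 38; 39; 40; 41; 71]%N) ->
    rootx i u \in unitmx /\ (forall j : 'I_72, oddroot j ->
    (mxvec (invmx (rootx i u) *m rvect K j *m rootx i u) <= S)%MS /\
    (mxvec (rootx i u *m rvect K j *m invmx (rootx i u)) <= S)%MS).
  move=> hi; split=> [|j oj]; first exact: rootx_unit.
  rewrite invx; split; last exact: step.
  by have := step i (- u) j hi oj; rewrite opprK.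
move: Sk; rewrite /simpleH !inE => /or4P [|||/or3P []] /eqP ek; subst k;
  by case: hk => ->; apply: fin.
Qed.

Lemma odd_eigen : exists c : 'I_72 -> K,
  [/\ odd_part c != 0 & forall b, B b -> exists x,
      invmx b *m odd_part c *m b = x *: odd_part c].
Proof.
(* X -> b^-1 X b on vectorized matrices; the adjugate makes it polynomial in b. *)
pose rho (b : 'M[K]_27) := lin_mx (mulmxr b \o mulmx (\adj b)).
have rhoE b u : u *m rho b = mxvec (\adj b *m vec_mx u *m b).
  by rewrite mul_rV_lin.
have eqM m (M N : 'M[K]_m) : (forall u : 'rV_m, u *m M = u *m N) -> M = N.
  by move=> h; apply/row_matrixP => i; rewrite !rowE h.
have [|||v [v0 ev] vS] := @eigenvector _ rho _ S.
- split=> [||g h Bg Bh].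
  + have hQ := polyfun_alg K 27.
    have e i (b : 'M[K]_27) : row i (rho b) = mxvec (\adj b *m vec_mx (delta_mx 0 i) *m b).
      by rewrite rowE rhoE.
    move=> i; case/mxvec_indexP => j1 j2.
    apply: (fa_ext (f := fun b => (\adj b *m vec_mx (delta_mx 0 i) *m b) j1 j2)); last first.
      move=> b; have := congr1 (fun u : 'rV_(27 * 27) => u 0 (mxvec_index j1 j2)) (e i b).
      by rewrite mxvecE [in X in X -> _]mxE => ->.
    apply: (mxfun_mul hQ); last exact: polyfun_id.
    apply: (mxfun_mul hQ); last exact: (mxfun_const hQ).
    by apply: (mxfun_adj hQ); apply: polyfun_id.
  + apply: eqM => u; rewrite rhoE -invmx_adj ?det1 // invmx1.
    by rewrite mul1mx !mulmx1 vec_mxK.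
  + apply: eqM => u; rewrite mulmxA !rhoE mxvecK.
    have Bgh := subgroupM sB Bg Bh.
    rewrite -!invmx_adj ?dB // invmxM ?(subgroup_unit sB) //.
    by rewrite !mulmxA.
- have [a [b ab]] := @rvect_nz K 1 isT; apply/eqP => S0.
  have /submxP [D] := @odd_mem_rvect 1 isT isT.
  rewrite S0 mulmx0 => /eqP; rewrite mxvec_eq0 => /eqP e.
  by rewrite e mxE eqxx in ab.
- move=> b Bb; apply/row_subP => k; rewrite row_mul rhoE -invmx_adj ?dB //.
  by apply: (odd_stable (BH Bb)); rewrite vec_mxK; apply: row_sub.
have [c ec] : exists c, vec_mx v = odd_part c by apply/odd_memP; rewrite vec_mxK.
exists c; rewrite -ec; split=> [|b Bb]; first by rewrite vec_mx_eq0.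
have [x hx] := ev b Bb; exists x.
by rewrite -linearZ /= -hx rhoE mxvecK -invmx_adj // dB.
Qed.

End Eigenvectors.
End Relation.

(* A one-parameter subgroup of the torus that separates the weights of each
   parity, as well as the roots outside A5 x A1. *)
Definition curve_degrees : seq int := [:: -3; 7; 8; -5; 7; -8].

Definition wdeg (a : nat) : int :=
  foldr (fun j z => curve_degrees`_j * (nth [::] wtab a)`_j + z) 0 (iota 0 6).

Definition rdeg (k : nat) : int :=
  foldr (fun j z => curve_degrees`_j *
    foldr (fun l s => (rvec k)`_l * E6_cartan l j + s) 0 (iota 0 6) + z) 0 (iota 0 6).

Lemma check_wdeg : all (fun o => uniq (map wdeg [seq a <- iota 0 27 | oddw a == o]))
  [:: true; false].
Proof. by vm_compute. Qed.

Lemma check_rdeg : uniq (map rdeg [seq k <- iota 0 72 | oddroot k]).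
Proof. by vm_compute. Qed.

Lemma wdeg_inj a b : (a < 27)%N -> (b < 27)%N -> oddw a = oddw b ->
  wdeg a = wdeg b -> a = b.
Proof.
move=> a27 b27 e; have /(allP check_wdeg) u : oddw b \in [:: true; false] by case: oddw.
by apply: (entry_uniq u); rewrite mem_filter mem_iota ?e ?eqxx.
Qed.

Lemma rdeg_inj k l : (k < 72)%N -> (l < 72)%N -> oddroot k -> oddroot l ->
  rdeg k = rdeg l -> k = l.
Proof.
by move=> k72 l72 ok ol; apply: (entry_uniq check_rdeg); rewrite mem_filter mem_iota ?ok ?ol.
Qed.

Lemma foldr_sum6 (F : nat -> int) :
  foldr (fun j z => F j + z) 0 (iota 0 6) = \sum_(j < 6) F j.
Proof. by rewrite -(big_mkord xpredT F) unlock. Qed.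

(** * Degeneration of eigenvectors along a one-parameter torus *)

Section Degeneration.
Variable K : numClosedFieldType.
Local Notation G := (@E6_group K).
Local Notation H := (@A5A1_group K).
Implicit Types (X Y b g : 'M[K]_27) (P : set 'M[K]_27) (n m : 'cV[K]_27).

Definition torus_curve (s : K) : 'I_6 -> K := fun j => s ^ curve_degrees`_j.

Lemma torus_curve_nonzero s : s != 0 -> nonzero_fun (torus_curve s).
Proof. by move=> s0 j; rewrite expfz_neq0. Qed.

Lemma torus_curve_prod s (f : 'I_6 -> int) : s != 0 ->
  \prod_j torus_curve s j ^ f j = s ^ (\sum_(j < 6) curve_degrees`_j * f j).
Proof.
move=> s0; rewrite (big_morph (fun z => s ^ z) (id1 := 1) (op1 := *%R)) //.
  by apply: eq_bigr => j _; rewrite /torus_curve exprz_exp.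
by move=> x y; rewrite expfzDr.
Qed.

Lemma torus_curve_wt s (a : 'I_27) : s != 0 ->
  \prod_j torus_curve s j ^ (wt a)`_j = s ^ wdeg a.
Proof.
by move=> s0; rewrite (torus_curve_prod (fun j => (wt a)`_j)) // /wdeg foldr_sum6 wtE.
Qed.

Lemma torus_curve_root s k : s != 0 ->
  root_char (rcoef k) (torus_curve s) = s ^ rdeg k.
Proof.
move=> s0; rewrite /root_char (torus_curve_prod (fun j => \sum_l rcoef k l * E6_cartan l j)) //.
rewrite /rdeg (foldr_sum6 (fun j => curve_degrees`_j * _)); congr (s ^ _).
by apply: eq_bigr => j _; rewrite (foldr_sum6 (fun l => (rvec k)`_l * E6_cartan l j)).
Qed.

Lemma poly_fun_vanish (F : K -> K) : poly_fun F ->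
  (forall s, s != 0 -> F s = 0) -> F 0 = 0.
Proof.
move=> [p hp] h; rewrite hp; suff -> : p = 0 by rewrite horner0.
have /eqP : p * 'X = 0.
  apply: poly_eval_inj => s; rewrite hornerM hornerX horner0.
  by have [->|s0] := eqVneq s 0; rewrite ?mulr0 // -hp h // mul0r.
by rewrite mulf_eq0 polyX_eq0 orbF => /eqP.
Qed.

(* Rescaling a curve with distinct degrees in its nonzero coordinates makes it
   converge to a coordinate vector. *)
Lemma degeneration N (v : 'I_N -> K) (w : 'I_N -> int) k1 : v k1 != 0 ->
  (forall k l, v k != 0 -> v l != 0 -> w k = w l -> k = l) ->
  exists k0 (u : 'I_N -> K -> K), [/\ v k0 != 0, forall k, poly_fun (u k),
    forall s k, s != 0 -> u k s = s ^ (- w k0) * (s ^ w k * v k) &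
    forall k, u k 0 = (k == k0)%:R * v k0].
Proof.
move=> v1 inj; case: (@Order.TotalTheory.arg_minP _ _ _ k1 (fun k => v k != 0) w v1) => k0 v0 min.
exists k0, (fun k s => v k * s ^+ `|w k - w k0|%N); split=> // [k|s k s0|k].
- by exists ((v k)%:P * 'X^`|w k - w k0|%N) => s; rewrite hornerM hornerC hornerXn.
- have [->|vk] := eqVneq (v k) 0; first by rewrite mul0r !mulr0.
  rewrite mulrA -expfzDr // mulrC exprnP; congr (s ^ _ * _).
  by rewrite gez0_abs ?subr_ge0 ?min // addrC.
- have [->|kk] := eqVneq k k0; first by rewrite subrr mulr1 mul1r.
  have [->|vk] := eqVneq (v k) 0; first by rewrite !mul0r.
  rewrite mul0r expr0n absz_eq0 subr_eq0; case: eqP => [e|_]; last by rewrite mulr0.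
  by rewrite (inj _ _ vk v0 e) eqxx in kk.
Qed.

Lemma casimir_formZr a1 a2 c A A' (r : K) :
  casimir_form a1 a2 A (c *: A') (c * r) = c ^+ 2 * casimir_form a1 a2 A A' r.
Proof. by have := casimir_formZ a1 a2 1 c A A' r; rewrite scale1r mul1r. Qed.

Definition bracket Y X : 'M[K]_27 := Y *m X - X *m Y.

Lemma bracketZ c Y X : bracket (c *: Y) X = c *: bracket Y X.
Proof. by rewrite /bracket -scalemxAl -scalemxAr -scalerBr. Qed.

Lemma bracket_conjr b Y X : b \in unitmx ->
  bracket Y (conjr b X) = conjr b (bracket (invmx b *m Y *m b) X).
Proof.
move=> ub; rewrite /bracket /conjr mulmxBr mulmxBl !mulmxA mulmxV // mul1mx.
by rewrite mulmxK.
Qed.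

Lemma mxfun_sub (T : Type) (Q : (T -> K) -> Prop) p q (F F' : T -> 'M[K]_(p, q)) :
  funalg Q -> mxfun Q F -> mxfun Q F' -> mxfun Q (fun x => F x - F' x).
Proof.
move=> hQ hF hF' a b; apply: (fa_ext (fa_sub hQ (hF a b) (hF' a b))) => x.
by rewrite !mxE.
Qed.

Lemma odd_relation P (A : 'M[K]_27 -> 'M[K]_27) :
  subgroup P -> P `<=` G -> A5A1_spherical P -> mxfun (@polyfun K 27) A ->
  (forall b g, H b -> G g -> A (b *m g) = conjr b (A g)) ->
  (forall p, P p -> exists c, forall g, G g -> A (g *m p) = c *: A g) ->
  exists k a1 a2, [/\ (k < 72)%N, oddroot k, (a1 != 0) || (a2 != 0) &
    forall g, G g -> casimir_form a1 a2 (A g) (bracket (rvect K k) (A g))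
      (\tr (rvect K k *m A g)) = 0].
Proof.
move=> sP PG /(sphericalE (E6_subgroup K) (@A5A1_sub K) PG sP) [B [g0 [[cB _] Gg0 op]]] pA lA rA.
have hQ := polyfun_alg K 27.
have [c [m0 ev]] := odd_eigen cB; set M := odd_part c in m0 ev.
have [sB [Z _ eB] _ _] := cB; have BH : B `<=` H by rewrite eB => b [].
have uH b : H b -> b \in unitmx by apply: subgroup_unit (@A5A1_subgroup K).
have [||b Bb|p Pp|a1 [a2 [nz rel]]] := @casimir_relation K B P g0 A (fun g => bracket M (A g))
    (fun g => \tr (M *m A g)) BH (subgroup1 sB) PG (subgroup1 sP) Gg0 op pA _ _ _ _.
- apply: (mxfun_sub hQ); apply: (mxfun_mul hQ) => //; exact: (mxfun_const hQ).
- apply: (fa_trace hQ); apply: (mxfun_mul hQ) => //; exact: (mxfun_const hQ).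
- have [x ex] := ev b Bb; exists 1, x => g Gg; have Hb := BH b Bb.
  rewrite lA // scale1r bracket_conjr ?uH // ex bracketZ trace_conjr ex.
  by rewrite /conjr -!scalemxAr -!scalemxAl mxtraceZ.
- have [x ex] := rA p Pp; exists x, x => g Gg.
  by rewrite ex // /bracket -!scalemxAr -!scalemxAl scalerBr mxtraceZ.
(* Replacing g by b^-1 g and using the H-invariance of [casimir], the relation passes from M to its
   H-conjugates with the same a1 and a2. *)
have twist b g : H b -> G g -> casimir_form a1 a2 (A g) (bracket (b *m M *m invmx b) (A g))
    (\tr (b *m M *m invmx b *m A g)) = 0.
  move=> Hb Gg; have Hb' : H (invmx b) := subgroupV (@A5A1_subgroup K) Hb.
  have Gbg : G (invmx b *m g) := subgroupM (E6_subgroup K) (A5A1_sub Hb') Gg.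
  rewrite -(rel _ Gbg) lA // bracket_conjr ?uH // trace_conjr invmxK.
  by rewrite casimir_form_conjr.
pose v (k : 'I_72) := if oddroot k then c k else 0.
have [k1 vk1] : exists k, v k != 0.
  apply: contra_notP (elimN eqP m0) => h; rewrite /M /odd_part big1 // => k ok.
  have [/eqP|vk] := boolP (v k == 0); first by rewrite /v ok => ->; rewrite scale0r.
  by case: h; exists k.
have vinj (k l : 'I_72) : v k != 0 -> v l != 0 -> rdeg k = rdeg l -> k = l.
  rewrite /v; case: ifP; rewrite ?eqxx // => ok _; case: ifP; rewrite ?eqxx // => ol _ e.
  by apply: val_inj; apply: rdeg_inj e.
have [k0 [u [v0 pu us u0]]] := degeneration (w := fun k : 'I_72 => rdeg k) vk1 vinj.
have ok0 : oddroot k0 by move: v0; rewrite /v; case: ifP; rewrite ?eqxx.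
pose mc s := \sum_k u k s *: rvect K (nat_of_ord k).
exists k0, a1, a2; split=> // g Gg.
pose F s := casimir_form a1 a2 (A g) (bracket (mc s) (A g)) (\tr (mc s *m A g)).
have hq := poly_fun_alg K.
have pmc : mxfun (@poly_fun K) mc.
  move=> a b; apply: (fa_ext (f := fun s => \sum_k u k s * rvect K (nat_of_ord k) a b)).
    apply: (fa_sum hq) => k; apply: (fa_mul hq) => //; exact: (fa_const hq).
  by move=> s; rewrite /mc summxE; apply: eq_bigr => k _; rewrite [RHS]mxE.
have pF : poly_fun F.
  have cA : mxfun (@poly_fun K) (fun=> A g) by apply: (mxfun_const hq).
  apply: (casimir_form_fun _ _ hq cA).
    by apply: (mxfun_sub hq); apply: (mxfun_mul hq).
  by apply: (fa_trace hq); apply: (mxfun_mul hq).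
have Fs s : s != 0 -> F s = 0.
  move=> s0; set t := torus_elt (torus_curve s).
  have t0 := torus_curve_nonzero s0.
  have -> : F s = casimir_form a1 a2 (A g)
      (s ^ (- rdeg k0) *: bracket (t *m M *m invmx t) (A g))
      (s ^ (- rdeg k0) * \tr (t *m M *m invmx t *m A g)).
    rewrite /F; have -> : mc s = s ^ (- rdeg k0) *: (t *m M *m invmx t).
      rewrite /M /odd_part big_mkcond mulmx_sumr mulmx_suml scaler_sumr; apply: eq_bigr => k _.
      rewrite us // /v; case: ifP => ok; last by rewrite !mulr0 scale0r mulmx0 mul0mx scaler0.
      rewrite -scalemxAr -scalemxAl torus_rvect // -scalemxAl mulmxK ?torus_elt_unit //.
      by rewrite torus_curve_root // [_ * c k]mulrC -!scalerA.
    by rewrite bracketZ -scalemxAl mxtraceZ.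
  rewrite casimir_formZr twist ?mulr0 // A5A1_groupE; apply: sub_generated; left.
  by exists (torus_curve s).
have := poly_fun_vanish pF Fs; rewrite /F.
have -> : mc 0 = v k0 *: rvect K k0.
  rewrite /mc (bigD1 k0) //= u0 eqxx mul1r big1 ?addr0 // => k kk.
  by rewrite u0 (negPf kk) mul0r scale0r.
rewrite bracketZ -scalemxAl mxtraceZ casimir_formZr => /eqP.
by rewrite mulf_eq0 expf_eq0 (negPf v0) andbF => /eqP.
Qed.

End Degeneration.

(** * Equivariant maps from G to End V for P_2, P_3 and P_4 *)

Definition parabolic_gens (i : nat) : seq nat :=
  iota 0 36 ++ [seq ropp j | j <- iota 0 6 & j != i].

(** The span of the first n weight vectors is stable under the parabolic: n = 2 for P_3 and n = 3
    for P_4. Its top exterior power is the highest weight line, of weight omega_3 or omega_4. *)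
Definition block_check (i n : nat) : bool :=
  all (fun k => all (fun e => ~~ ((n <= e.1.1) && (e.1.2 < n))%N) (rmat k)) (parabolic_gens i).

Lemma check_block2 : block_check 2 2.
Proof. by vm_compute. Qed.

Lemma check_block3 : block_check 3 3.
Proof. by vm_compute. Qed.

(** The root vector of the highest root spans the highest weight line of the adjoint module, whose
    highest weight is omega_2. *)
Lemma check_theta_parabolic :
  all (fun k => szero (commutator (rmat 35) (rmat k))) (parabolic_gens 1).
Proof. by vm_compute. Qed.

Section Equivariants.
Variable K : numClosedFieldType.
Local Notation G := (@E6_group K).
Local Notation H := (@A5A1_group K).
Implicit Types (b g p : 'M[K]_27) (P : set 'M[K]_27) (x y n m : 'cV[K]_27).

Lemma parabolic_ind i (I : set 'M[K]_27) : subgroup I -> @E6_torus K `<=` I ->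
  (forall k s, k \in parabolic_gens i -> I (rootx k s)) -> parabolic i `<=` I.
Proof.
move=> sI tI xI; apply: (generated_sub sI) => g [[/tI //|[k [s [pk ->]]]]|[k [s [sk ki ->]]]];
  apply: xI; rewrite mem_cat.
  by rewrite mem_iota; apply/orP; left.
by apply/orP; right; apply: map_f; rewrite mem_filter mem_iota; apply/andP; split=> //; apply/eqP.
Qed.

Let invx j u : invmx (rootx j u) = rootx j (- u) :> 'M[K]_27.
Proof. exact: (rd_invx (root_datumG K)). Qed.

Definition block (k : nat) p : Prop :=
  forall a b : 'I_27, (k <= a)%N -> (b < k)%N -> p a b = 0.

Lemma parabolic_block i (n : nat) : block_check i n -> forall p, parabolic i p -> block n p.
Proof.
move=> chk; pose I := [set p : 'M[K]_27 | [/\ p \in unitmx, block n p & block n (invmx p)]].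
have bM p q : block n p -> block n q -> block n (p *m q).
  move=> hp hq a b na bn; rewrite mxE big1 // => c _.
  by case: (ltnP c n) => cn; [rewrite hp ?mul0r | rewrite hq ?mulr0].
have b1 : block n 1%:M.
  move=> a b na bn; rewrite mxE; case: eqP => // e.
  by move: na; rewrite e leqNgt bn.
have sI : subgroup I.
  split.
  - by move=> p [].
  - by split; rewrite ?unitmx1 ?invmx1.
  - by move=> p q [up bp bp'] [uq bq bq']; split; rewrite ?unitmx_mul ?up // ?invmxM //; apply: bM.
  - by move=> p [up bp bp']; split; rewrite ?unitmx_inv ?invmxK.
suff : parabolic i `<=` I by move=> h p /h [].
apply: parabolic_ind => // [p [t t0 <-]|k s hk].
  have bt (u : 'I_6 -> K) : block n (torus_elt u).
    move=> a b na bn; rewrite torus_eltE; case: eqP => // e.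
    by move: na; rewrite e leqNgt bn.
  by split; rewrite ?torus_elt_unit ?torus_elt_inv.
have bx u : block n (rootx k u).
  move=> a b na bn; rewrite /rootx mxE b1 // add0r mxE rvectE mxE scoef_notin ?mulr0 //.
  apply/mapP => -[e he ee]; have := allP (allP chk k hk) e he.
  by rewrite -ee /= na bn.
by split; rewrite ?rootx_unit ?invx.
Qed.

Definition ycol (j : nat) g : 'cV[K]_27 := g *m delta_mx (inord j) 0.

Lemma block_col (n : nat) p g (j : nat) : (n <= 27)%N -> block n p -> (j < n)%N ->
  ycol j (g *m p) = \sum_(k < n) p (inord k) (inord j) *: ycol k g.
Proof.
move=> n27 bp jn; have j27 : (j < 27)%N := leq_trans jn n27.
rewrite /ycol -mulmxA; under eq_bigr do rewrite scalemxAr.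
rewrite -mulmx_sumr; congr (_ *m _).
rewrite [LHS]col_delta_sum.
rewrite (big_ord_widen 27 (fun k => p (inord k) (inord j) *: delta_mx (inord k) 0)) //.
rewrite [RHS]big_mkcond; apply: eq_bigr => a _; rewrite -colE mxE inord_val.
by case: ltnP => // na; rewrite bp ?scale0r // inordK.
Qed.

Lemma cross_E6 g x y : G g -> cross (g *m x) (g *m y) = cross x y *m invmx g.
Proof. by move=> /E6_preserves [ug h]; rewrite -(h x y) mulmxK. Qed.

Lemma cross_fun (T : Type) (Q : (T -> K) -> Prop) (F F' : T -> 'cV[K]_27) :
  funalg Q -> mxfun Q F -> mxfun Q F' -> mxfun Q (fun z : T => cross (F z) (F' z)).
Proof.
move=> hQ hF hF' i j.
apply: (fa_ext (f := fun z : T => \sum_(a < 27) F z a 0 * ((F' z)^T *m cubm K a) i j)).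
  apply: (fa_sum hQ) => a; apply: (fa_mul hQ) => //.
  by apply: (mxfun_mul hQ); [apply: mxfun_tr | apply: (mxfun_const hQ)].
by move=> z; rewrite /cross summxE; apply: eq_bigr => a _; rewrite [RHS]mxE.
Qed.

Lemma ycol_fun j : mxfun (@polyfun K 27) (ycol j).
Proof.
apply: (mxfun_mul (polyfun_alg K 27)); first exact: polyfun_id.
exact: (mxfun_const (polyfun_alg K 27)).
Qed.

Lemma ycolM j b g : ycol j (b *m g) = b *m ycol j g.
Proof. by rewrite /ycol mulmxA. Qed.

Lemma piU_A5A1 b x : H b -> piU K *m (b *m x) = b *m (piU K *m x).
Proof. by move=> Hb; rewrite mulmxA -A5A1_piU // -mulmxA. Qed.

Let outerE (x : 'cV[K]_27) (r : 'rV[K]_27) i j : (x *m r) i j = x i 0 * r 0 j.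
Proof. by rewrite mxE big_ord1. Qed.

(* [adjoint_orbit], [triple_orbit] and [pair_orbit n] come from polynomial maps
   on the adjoint module, on the third and on the second exterior power of V,
   evaluated at the images under g of the highest weight vectors for P_2, P_4 and
   P_3.  The factor piU commutes with A5 x A1 but not with G. *)
Definition adjoint_orbit g : 'M[K]_27 := g *m theta_e K *m \adj g.

(** The signed sum over the permutations of u, v, w of u C(v, piU w, -). Without [piU] the terms
    would cancel in pairs, C being symmetric; the same holds for [pair_form]. *)
Definition alt3 (u v w : 'cV[K]_27) : 'M[K]_27 :=
  u *m cross v (piU K *m w) + v *m cross w (piU K *m u) + w *m cross u (piU K *m v)
  - v *m cross u (piU K *m w) - u *m cross w (piU K *m v) - w *m cross v (piU K *m u).

Definition triple_orbit g : 'M[K]_27 := alt3 (ycol 0 g) (ycol 1 g) (ycol 2 g).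

Definition pair_orbit n g : 'M[K]_27 :=
  ycol 0 g *m cross (ycol 1 g) n - ycol 1 g *m cross (ycol 0 g) n.

Definition pair_form g : 'rV[K]_27 :=
  cross (ycol 0 g) (piU K *m ycol 1 g) - cross (ycol 1 g) (piU K *m ycol 0 g).

Lemma adjoint_orbit_fun : mxfun (@polyfun K 27) adjoint_orbit.
Proof.
have hQ := polyfun_alg K 27; apply: (mxfun_mul hQ); last first.
  by apply: (mxfun_adj hQ); apply: polyfun_id.
by apply: (mxfun_mul hQ); [apply: polyfun_id | apply: (mxfun_const hQ)].
Qed.

Let piU_fun (F : 'M[K]_27 -> 'cV[K]_27) : mxfun (@polyfun K 27) F ->
  mxfun (@polyfun K 27) (fun g => piU K *m F g).
Proof.
have hQ := polyfun_alg K 27.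
by move=> hF; apply: (mxfun_mul hQ) => //; apply: (mxfun_const hQ).
Qed.

Lemma triple_orbit_fun : mxfun (@polyfun K 27) triple_orbit.
Proof.
have hQ := polyfun_alg K 27.
have h i j k : mxfun (@polyfun K 27)
    (fun g => ycol i g *m cross (ycol j g) (piU K *m ycol k g)).
  apply: (mxfun_mul hQ); first exact: ycol_fun.
  by apply: (cross_fun hQ); [apply: ycol_fun | apply: piU_fun; apply: ycol_fun].
rewrite /triple_orbit /alt3.
by do ![apply: (mxfun_sub hQ) | apply: (mxfun_add hQ) | apply: h].
Qed.

Lemma pair_orbit_fun n : mxfun (@polyfun K 27) (pair_orbit n).
Proof.
have hQ := polyfun_alg K 27.
have h i j : mxfun (@polyfun K 27) (fun g => ycol i g *m cross (ycol j g) n).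
  apply: (mxfun_mul hQ); first exact: ycol_fun.
  by apply: (cross_fun hQ); [apply: ycol_fun | apply: (mxfun_const hQ)].
by apply: (mxfun_sub hQ); apply: h.
Qed.

Lemma pair_form_fun : mxfun (@polyfun K 27) pair_form.
Proof.
have hQ := polyfun_alg K 27.
by apply: (mxfun_sub hQ); apply: (cross_fun hQ); try exact: ycol_fun; apply: piU_fun;
  apply: ycol_fun.
Qed.

Lemma adjoint_orbit_conjr b g : H b -> G g ->
  adjoint_orbit (b *m g) = conjr b (adjoint_orbit g).
Proof.
move=> /A5A1_sub Gb Gg; have Gbg := subgroupM (E6_subgroup K) Gb Gg.
have uG := subgroup_unit (E6_subgroup K).
by rewrite /adjoint_orbit /conjr -!invmx_adj ?det_E6 // invmxM ?uG // !mulmxA.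
Qed.

Lemma triple_orbit_conjr b g : H b -> G g ->
  triple_orbit (b *m g) = conjr b (triple_orbit g).
Proof.
move=> Hb Gg; rewrite /triple_orbit !ycolM.
have h (u v w : 'cV[K]_27) : b *m u *m cross (b *m v) (piU K *m (b *m w)) =
    b *m (u *m cross v (piU K *m w)) *m invmx b.
  by rewrite piU_A5A1 // cross_E6 ?mulmxA //; apply: A5A1_sub.
by rewrite /alt3 /conjr !h !mulmxBr !mulmxDr !mulmxBl !mulmxDl.
Qed.

Lemma pair_orbit_conjr b n g : H b -> G g ->
  pair_orbit n (b *m g) = conjr b (pair_orbit (invmx b *m n) g).
Proof.
move=> Hb Gg; rewrite /pair_orbit !ycolM; have Gb := A5A1_sub Hb.
have ub := subgroup_unit (E6_subgroup K) Gb.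
have h (u v : 'cV[K]_27) : b *m u *m cross (b *m v) n = b *m (u *m cross v (invmx b *m n)) *m invmx b.
  by rewrite -{1}[n](mulKVmx ub) cross_E6 // !mulmxA.
by rewrite /conjr !h mulmxBr mulmxBl.
Qed.

Lemma pair_form_mul b g : H b -> G g -> pair_form (b *m g) = pair_form g *m invmx b.
Proof.
move=> Hb Gg; rewrite /pair_form !ycolM !(piU_A5A1 _ Hb).
by rewrite !(cross_E6 _ _ (A5A1_sub Hb)) mulmxBl.
Qed.

Lemma adjoint_orbit_parabolic p : parabolic 1 p ->
  exists c, forall g, G g -> adjoint_orbit (g *m p) = c *: adjoint_orbit g.
Proof.
move=> Pp; pose f p c := p *m theta_e K *m invmx p = c *: theta_e K.
pose I := [set p : 'M[K]_27 | [/\ p \in unitmx, exists c, f p c & exists c, f (invmx p) c]].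
have fM q r c d : q \in unitmx -> r \in unitmx -> f q c -> f r d -> f (q *m r) (d * c).
  rewrite /f => uq ur hq hr; rewrite invmxM // -scalerA -hq scalemxAl scalemxAr -hr.
  by rewrite !mulmxA.
have sI : subgroup I.
  split.
  - by move=> q [].
  - by split; rewrite ?unitmx1 ?invmx1 //; exists 1; rewrite /f invmx1 mul1mx mulmx1 scale1r.
  - move=> q r [uq [c hc] [c' hc']] [ur [d hd] [d' hd']]; split; first by rewrite unitmx_mul uq.
      by exists (d * c); apply: fM.
    by exists (c' * d'); rewrite invmxM //; apply: fM; rewrite ?unitmx_inv.
  - by move=> q [uq hc hd]; split; rewrite ?unitmx_inv ?invmxK.
have [up [c hc] _] : I p.
  apply: (parabolic_ind (i := 1) sI) Pp => [q [t t0 <-]|k s hk].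
    have ft (u : 'I_6 -> K) : nonzero_fun u -> f (torus_elt u) (root_char (rcoef 35) u).
      by move=> u0; rewrite /f torus_rvect // -scalemxAl mulmxK // torus_elt_unit.
    have t0' : nonzero_fun (fun j => (t j)^-1) by move=> j; rewrite invr_eq0.
    split; first exact: torus_elt_unit.
      by eexists; apply: ft.
    by eexists; rewrite torus_elt_inv //; apply: ft.
  have := imx_szero K 27 27 (allP check_theta_parabolic k hk); rewrite imx_commutator.
  move/eqP; rewrite subr_eq0 => /eqP ek.
  have fx u : f (rootx k u) 1.
    rewrite /f scale1r (_ : rootx k u *m _ = theta_e K *m rootx k u) ?mulmxK ?rootx_unit //.
    by rewrite /rootx mulmxDl mulmxDr mul1mx mulmx1 -scalemxAl -scalemxAr -ek.
  by split; [apply: rootx_unit | exists 1 | exists 1; rewrite invx].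
exists c => g Gg; have Gp := parabolic_sub Pp; have Ggp := subgroupM (E6_subgroup K) Gg Gp.
have ug := subgroup_unit (E6_subgroup K) Gg.
rewrite /adjoint_orbit -!invmx_adj ?det_E6 // invmxM // scalemxAl scalemxAr -hc.
by rewrite !mulmxA.
Qed.

Lemma pair_parabolic p : parabolic 2 p -> exists d, forall g,
  (forall n, pair_orbit n (g *m p) = d *: pair_orbit n g) /\
  pair_form (g *m p) = d *: pair_form g.
Proof.
move=> /(parabolic_block check_block2) bp.
have yE j : (j < 2)%N -> exists c d, forall g, ycol j (g *m p) = c *: ycol 0 g + d *: ycol 1 g.
  move=> j2; exists (p (inord 0) (inord j)), (p (inord 1) (inord j)) => h.
  by rewrite (block_col h _ bp) // !big_ord_recr big_ord0 /= add0r.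
have [c0 [d0 e0]] := yE 0 isT; have [c1 [d1 e1]] := yE 1 isT.
(* The determinant of the leading 2 by 2 block of p, since both maps are alternating in the first
   two columns of g. *)
exists (c0 * d1 - d0 * c1) => g; split=> [n|].
  rewrite /pair_orbit e0 e1 !crossDl !crossZl; move: (cross _ n) (cross _ n) => r r'.
  apply/matrixP => i j; move: (ycol 0 g) (ycol 1 g) => u v.
  have sB (M N : 'M[K]_27) : (M - N) i j = M i j - N i j by rewrite !mxE.
  have sZ a (M : 'M[K]_27) : (a *: M) i j = a * M i j by rewrite mxE.
  by rewrite sZ !sB !outerE !mxE; ring.
rewrite /pair_form e0 e1 !mulmxDr -!scalemxAr !(crossDl, crossDr) !(crossZl, crossZr).
move: (cross _ _) (cross _ _) (cross _ _) (cross _ _) => q r s t.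
by apply/matrixP => i j; rewrite !mxE; ring.
Qed.

Lemma triple_parabolic p : parabolic 3 p -> exists d, forall g, G g ->
  triple_orbit (g *m p) = d *: triple_orbit g.
Proof.
move=> /(parabolic_block check_block3) bp.
have yE j : (j < 3)%N -> exists c d e, forall g,
    ycol j (g *m p) = c *: ycol 0 g + d *: ycol 1 g + e *: ycol 2 g.
  move=> j3; exists (p (inord 0) (inord j)), (p (inord 1) (inord j)), (p (inord 2) (inord j)) => h.
  by rewrite (block_col h _ bp) // !big_ord_recr big_ord0 /= add0r.
have [a0 [b0 [c0 e0]]] := yE 0 isT; have [a1 [b1 [c1 e1]]] := yE 1 isT.
have [a2 [b2 [c2 e2]]] := yE 2 isT.
(* The determinant of the leading 3 by 3 block of p. *)
exists (a0 * (b1 * c2 - b2 * c1) - b0 * (a1 * c2 - a2 * c1) + c0 * (a1 * b2 - a2 * b1)) => g _.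
rewrite /triple_orbit e0 e1 e2; move: (ycol 0 g) (ycol 1 g) (ycol 2 g) => u v w.
apply/matrixP => i j; pose q x y := cross x (piU K *m y) 0 j.
have sB (M N : 'M[K]_27) : (M - N) i j = M i j - N i j by rewrite !mxE.
have sD (M N : 'M[K]_27) : (M + N) i j = M i j + N i j by rewrite !mxE.
have sZ a (M : 'M[K]_27) : (a *: M) i j = a * M i j by rewrite mxE.
have altE x y z : alt3 x y z i j = x i 0 * q y z + y i 0 * q z x + z i 0 * q x y
    - y i 0 * q x z - x i 0 * q z y - z i 0 * q y x.
  by rewrite /alt3 3!sB 2!sD !outerE.
rewrite sZ !altE.
have qE (a b c a' b' c' : K) : q (a *: u + b *: v + c *: w) (a' *: u + b' *: v + c' *: w) =
    a * (a' * q u u + b' * q u v + c' * q u w) + b * (a' * q v u + b' * q v v + c' * q v w)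
    + c * (a' * q w u + b' * q w v + c' * q w w).
  rewrite /q !mulmxDr -!scalemxAr !(crossDl, crossDr) !(crossZl, crossZr).
  by move: (piU K *m _) (piU K *m _) (piU K *m _) => *; rewrite !mxE; ring.
have vE (a b c : K) : (a *: u + b *: v + c *: w) i 0 = a * u i 0 + b * v i 0 + c * w i 0.
  by rewrite !mxE.
rewrite !qE !vE.
move: (q u u) (q u v) (q u w) (q v u) (q v v) (q v w) (q w u) (q w v) (q w w) => *.
by ring.
Qed.

End Equivariants.

(** * The relation for P_3 *)

Section PairRelation.
Variable K : numClosedFieldType.
Local Notation G := (@E6_group K).
Local Notation H := (@A5A1_group K).
Implicit Types (b g : 'M[K]_27) (P : set 'M[K]_27) (n m : 'cV[K]_27).

(** Meant for n in (15, 1) and m in (6, 2). The rank one matrix m [pair_form g] replaces the bracket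
    with a root vector, and its trace replaces L(m); both terms have degree 2 in n and in m. *)
Definition pair_casimir (a1 a2 : K) n m g : K :=
  casimir_form a1 a2 (pair_orbit n g) (m *m pair_form g) ((pair_form g *m m) 0 0).

Lemma pair_orbitZ c n g : pair_orbit (c *: n) g = c *: pair_orbit n g.
Proof. by rewrite /pair_orbit !crossZr -!scalemxAr -scalerBr. Qed.

Lemma pair_casimirZ a1 a2 c d n m g :
  pair_casimir a1 a2 (c *: n) (d *: m) g = (c * d) ^+ 2 * pair_casimir a1 a2 n m g.
Proof.
by rewrite /pair_casimir pair_orbitZ -scalemxAl -scalemxAr [(d *: (_ : 'M_1)) 0 0]mxE casimir_formZ.
Qed.

Lemma pair_casimir_mul a1 a2 n m b g : H b -> G g ->
  pair_casimir a1 a2 n m (b *m g) = pair_casimir a1 a2 (invmx b *m n) (invmx b *m m) g.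
Proof.
move=> Hb Gg; rewrite /pair_casimir pair_orbit_conjr // pair_form_mul //.
have ub := subgroup_unit (@A5A1_subgroup K) Hb.
have -> : m *m (pair_form g *m invmx b) = conjr b (invmx b *m m *m pair_form g).
  by rewrite /conjr !mulmxA mulmxV // mul1mx.
by rewrite casimir_form_conjr // -[pair_form g *m invmx b *m m]mulmxA.
Qed.

Let limit (o : bool) (x : 'cV[K]_27) : x != 0 ->
  (forall a : 'I_27, oddw a != o -> x a 0 = 0) ->
  exists (a : 'I_27) c d (u : K -> 'cV[K]_27), [/\ oddw a = o, c != 0, mxfun (@poly_fun K) u,
    forall s, s != 0 -> u s = s ^ d *: (torus_elt (torus_curve s) *m x) &
    u 0 = c *: delta_mx a 0].
Proof.
move=> x0 hx; have [k1 xk1] : exists k, x k 0 != 0.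
  by have /cV0Pn := x0.
have inj (k l : 'I_27) : x k 0 != 0 -> x l 0 != 0 -> wdeg k = wdeg l -> k = l.
  move=> xk xl e; apply: val_inj; apply: (wdeg_inj _ _ _ e) => //.
  have odd_of (j : 'I_27) : x j 0 != 0 -> oddw j = o.
    by move=> xj; apply/eqP; apply: contraNT xj => /hx ->; rewrite eqxx.
  by rewrite !odd_of.
have [k0 [u [v0 pu us u0]]] := degeneration (v := fun k => x k 0)
  (w := fun k : 'I_27 => wdeg k) xk1 inj.
exists k0, (x k0 0), (- wdeg k0), (fun s => \col_k u k s); split=> //.
- by apply/eqP; apply: contraNT v0 => /hx ->; rewrite eqxx.
- by move=> a j; apply: (fa_ext (pu a)) => s; rewrite mxE.
- by move=> s s0; apply/colP => a; rewrite mxE us // [RHS]mxE torus_mull torus_curve_wt.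
- by apply/colP => a; rewrite !mxE u0 eqxx andbT mulrC.
Qed.

(** The two eigenvectors of B are moved by the same torus curve, each rescaled by its own power of
    s, and tend simultaneously to single weight vectors. *)
Lemma pair_relation P : subgroup P -> P `<=` G -> A5A1_spherical P ->
  (forall p, P p -> exists d, forall g,
    (forall n, pair_orbit n (g *m p) = d *: pair_orbit n g) /\
    pair_form (g *m p) = d *: pair_form g) ->
  exists (i j : 'I_27) a1 a2, [/\ oddw i = false, oddw j = true, (a1 != 0) || (a2 != 0) &
    forall g, G g -> pair_casimir a1 a2 (delta_mx i 0) (delta_mx j 0) g = 0].
Proof.
move=> sP PG /(sphericalE (E6_subgroup K) (@A5A1_sub K) PG sP) [B [g0 [[cB _] Gg0 op]]] rP.
have hQ := polyfun_alg K 27.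
have [n [n0 nU en]] := parity_eigen cB false; have [m [m0 mW em]] := parity_eigen cB true.
have [sB [Z _ eB] _ _] := cB; have BH : B `<=` H by rewrite eB => b [].
have uH b : H b -> b \in unitmx by apply: subgroup_unit (@A5A1_subgroup K).
have [|||b Bb|p Pp|a1 [a2 [nz rel]]] := @casimir_relation K B P g0 (pair_orbit n)
    (fun g => m *m pair_form g) (fun g => (pair_form g *m m) 0 0)
    BH (subgroup1 sB) PG (subgroup1 sP) Gg0 op.
- exact: pair_orbit_fun.
- by apply: (mxfun_mul hQ); [apply: (mxfun_const hQ) | apply: pair_form_fun].
- suff : mxfun (@polyfun K 27) (fun g => pair_form g *m m) by [].
  by apply: (mxfun_mul hQ); [apply: pair_form_fun | apply: (mxfun_const hQ)].
- have [x ex] := en b Bb; have [y ey] := em b Bb; exists x, y => g Gg; have Hb := BH b Bb.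
  rewrite pair_orbit_conjr // pair_form_mul // ex pair_orbitZ.
  rewrite -mulmxA ey -scalemxAr [(_ *: (_ : 'M_1)) 0 0]mxE; split=> //.
    by rewrite /conjr -scalemxAr -scalemxAl.
  have e : y *: (b *m m) = m by rewrite scalemxAr -ey mulKVmx ?uH.
  have -> : y *: conjr b (m *m pair_form g) = y *: (b *m m) *m pair_form g *m invmx b.
    by rewrite /conjr -!scalemxAl !mulmxA.
  by rewrite e mulmxA.
- have [d hd] := rP p Pp; exists d, d => g _; have [h1 h2] := hd g.
  by rewrite h1 h2 -scalemxAr -scalemxAl [(_ *: (_ : 'M_1)) 0 0]mxE.
have [i [c [d [u [oi c0 pu us u0]]]]] := limit n0 nU.
have [j [c' [d' [v [oj c0' pv vs v0]]]]] := limit m0 mW.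
exists i, j, a1, a2; split=> // g Gg.
pose F s := pair_casimir a1 a2 (u s) (v s) g.
have hq := poly_fun_alg K.
have cst p q (M : 'M[K]_(p, q)) : mxfun (@poly_fun K) (fun=> M) by apply: (mxfun_const hq).
have pF : poly_fun F.
  apply: (casimir_form_fun _ _ hq).
  - by apply: (mxfun_sub hq); apply: (mxfun_mul hq) => //; apply: (cross_fun hq).
  - exact: (mxfun_mul hq).
  - have : mxfun (@poly_fun K) (fun s => pair_form g *m v s) by apply: (mxfun_mul hq).
    exact.
have Fs s : s != 0 -> F s = 0.
  move=> s0; rewrite /F us // vs // pair_casimirZ.
  set t := torus_elt _; have Ht : H t.
    rewrite A5A1_groupE; apply: sub_generated; left.
    by exists (torus_curve s) => //; apply: torus_curve_nonzero.
  have Ht' := subgroupV (@A5A1_subgroup K) Ht.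
  have := pair_casimir_mul a1 a2 n m Ht' Gg; rewrite invmxK => <-.
  have Gt : G (invmx t *m g) := subgroupM (E6_subgroup K) (A5A1_sub Ht') Gg.
  by rewrite /pair_casimir (rel _ Gt) mulr0.
have := poly_fun_vanish pF Fs; rewrite /F u0 v0 pair_casimirZ => /eqP.
by rewrite mulf_eq0 expf_eq0 mulf_eq0 (negPf c0) (negPf c0') => /eqP.
Qed.

End PairRelation.

(** * Exact evaluation at two points of G *)

Definition scross (x y : spmx) : spmx :=
  foldr (fun e l => smerge l (sscale e.2 (smul 27 (str y) (cmat e.1.1)))) [::]
    [seq e <- x | (e.1.1 < 27)%N && (e.1.2 == 0)%N].

Definition seven (l : spmx) : spmx := [seq e <- l | ~~ oddw e.1.1].

(** The inverse transpose of a word. Inversion and transposition both reverse the order, so the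
    letters stay in place. *)
Definition word_inv_tr (w : seq (nat * BinNums.Z)) : seq (nat * BinNums.Z) :=
  [seq (ropp ks.1, BinInt.Z.opp ks.2) | ks <- w].

(* A list of pairs (u, r) stands for the sum of the rank one matrices u *m r;
   [outer_trace] evaluates X |-> tr (X A) on such a sum A. *)
Definition outer_trace (o : seq (spmx * spmx)) (X : spmx) : BinNums.Z :=
  foldr (fun ur z => BinInt.Z.add (scoef (smul 27 ur.2 (smul 27 X ur.1)) 0 0) z)
    BinNums.Z0 o.

Definition sl2_values (L : spmx -> BinNums.Z) : BinNums.Z * BinNums.Z * BinNums.Z :=
  (L (rmat 35), L (rmat 71), L (commutator (rmat 35) (rmat 71))).

Definition zcasimir (u v : BinNums.Z * BinNums.Z * BinNums.Z) : BinNums.Z :=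
  let two := BinNums.Zpos (BinNums.xO BinNums.xH) in
  BinInt.Z.add (BinInt.Z.add
    (BinInt.Z.mul (BinInt.Z.mul two u.1.1) v.1.2)
    (BinInt.Z.mul (BinInt.Z.mul two u.1.2) v.1.1)) (BinInt.Z.mul u.2 v.2).

Definition zform (u v : BinNums.Z * BinNums.Z * BinNums.Z) (r : BinNums.Z) :
    BinNums.Z * BinNums.Z :=
  let c := zcasimir u v in
  (BinInt.Z.mul c c, BinInt.Z.mul (zcasimir u u) (BinInt.Z.mul r r)).

Definition zindep (p q : BinNums.Z * BinNums.Z) : bool :=
  ~~ BinInt.Z.eqb (BinInt.Z.mul p.1 q.2) (BinInt.Z.mul p.2 q.1).

Section SparseEvaluation.
Variable K : numClosedFieldType.
Local Notation imx := (imx K).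
Local Notation zr := (zr K).

Lemma imx_even n l : imx 27 n (seven l) = piU K *m imx 27 n l.
Proof.
apply/matrixP => i j; rewrite piU_entry !mxE.
have -> : scoef (seven l) i j = if oddw i then BinNums.Z0 else scoef l i j.
  elim: l => [|[[a b] z] l IH] /=; first by case: ifP.
  case oa: (oddw a) => /=; rewrite IH; last by case: andP => [[/eqP <- _]|]; rewrite ?oa.
  by case: ifP => // oi; case: andP => // -[/eqP ea]; rewrite ea oi in oa.
by case: ifP.
Qed.

Lemma imx_cross x y : imx 1 27 (scross x y) = cross (imx 27 1 x) (imx 27 1 y).
Proof.
elim: x => [|[[a b] z] x IH]; first by rewrite !imx_nil cross0l.
rewrite imx_cons crossDl -IH /scross /=; case: ifP => [/andP [a27 /eqP ->]|nab].
  rewrite /= imx_merge imx_scale imx_mul imx_tr -cubmE addrC; congr (_ + _).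
  rewrite (_ : (\matrix_(_, _) _ : 'cV_27) = zr z *: delta_mx (Ordinal a27) 0).
    by rewrite crossZl cross_delta_l.
  apply/matrixP => i j; rewrite !mxE ord1 !andbT eq_sym -(inj_eq val_inj) /=.
  by case: eqP; rewrite ?mulr1 ?mulr0.
rewrite (_ : \matrix_(_, _) _ = 0) ?cross0l ?add0r //.
apply/matrixP => i j; rewrite !mxE ord1; case: ifP => // /andP [/eqP ea /eqP eb].
by rewrite ea eb ltn_ord in nab.
Qed.

(** A enters the relations only through the linear form X -> tr(X A), so integer values of this form
    replace the dense matrix. *)
Definition represents (L : spmx -> BinNums.Z) (A : 'M[K]_27) : Prop :=
  forall X, \tr (imx 27 27 X *m A) = zr (L X).

Lemma represents_outer o A :
  A = \sum_(ur <- o) imx 27 1 ur.1 *m imx 1 27 ur.2 -> represents (outer_trace o) A.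
Proof.
move=> -> X; elim: o => [|[u r] o IH] /=; first by rewrite big_nil mulmx0 mxtrace0.
rewrite big_cons mulmxDr mxtraceD IH zrD /= mulmxA mxtrace_mulC trace_mx11.
by rewrite -!imx_mul mxE.
Qed.

(** Cyclicity of the trace: tr(X [m, A]) = tr([X, m] A). *)
Lemma represents_bracket L A m : represents L A ->
  represents (fun X => L (commutator X m)) (bracket (imx 27 27 m) A).
Proof.
move=> h X; rewrite -h imx_cat imx_neg !imx_mul /bracket mulmxBr mulmxBl !raddfB /=.
congr (_ - _); first by rewrite mulmxA.
by rewrite mulmxA mxtrace_mulC mulmxA.
Qed.

Lemma represents_casimir L L' A A' : represents L A -> represents L' A' ->
  casimir A A' = zr (zcasimir (sl2_values L) (sl2_values L')).
Proof.
move=> h h'; have e2 : zr (BinNums.Zpos (BinNums.xO BinNums.xH)) = 2 by [].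
have eh : theta_h K = imx 27 27 (commutator (rmat 35) (rmat 71)).
  by rewrite imx_commutator.
have ee : theta_e K = imx 27 27 (rmat 35) by rewrite -rvectE.
have ef : theta_f K = imx 27 27 (rmat 71) by rewrite -rvectE.
by rewrite /casimir eh ee ef !h !h' /zcasimir !zrD !zrM e2.
Qed.

Lemma zr_inj : injective zr.
Proof. by move=> x y /intr_inj /(can_inj ssrZ.int_of_ZK). Qed.

Lemma represents_casimir_form a1 a2 L L' A A' r (p := zform (sl2_values L) (sl2_values L') r) :
  represents L A -> represents L' A' ->
  casimir_form a1 a2 A A' (zr r) = a1 * zr p.1 + a2 * zr p.2.
Proof.
move=> h h'; rewrite /casimir_form (represents_casimir h h') (represents_casimir h h).
by rewrite /p /zform !zrM !expr2.
Qed.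

Lemma independent a1 a2 p q : a1 * zr p.1 + a2 * zr p.2 = 0 ->
  a1 * zr q.1 + a2 * zr q.2 = 0 -> zindep p q -> (a1 != 0) || (a2 != 0) -> False.
Proof.
case: p q => [p1 p2] [q1 q2] /= ep eq; rewrite /zindep /= => nz.
have d : zr p1 * zr q2 - zr p2 * zr q1 != 0.
  rewrite -!zrM subr_eq0; apply: contraNneq nz => /zr_inj ->.
  by apply/(BinInt.Z.eqb_spec _ _).
have d1 : a1 * (zr p1 * zr q2 - zr p2 * zr q1) = 0.
  transitivity (zr q2 * (a1 * zr p1 + a2 * zr p2) - zr p2 * (a1 * zr q1 + a2 * zr q2)).
    by ring.
  by rewrite ep eq !mulr0 subrr.
have d2 : a2 * (zr p1 * zr q2 - zr p2 * zr q1) = 0.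
  transitivity (zr p1 * (a1 * zr q1 + a2 * zr q2) - zr q1 * (a1 * zr p1 + a2 * zr p2)).
    by ring.
  by rewrite ep eq !mulr0 subrr.
move/eqP: d1; move/eqP: d2; rewrite !mulf_eq0 (negPf d) !orbF => /eqP -> /eqP ->.
by rewrite eqxx.
Qed.

End SparseEvaluation.

(* [word1] and [word2], found by random search, are two elements of G where the
   two semi-invariants are not proportional. *)
Definition pattern_word (pos : seq (nat * int)) (pat : seq int) : seq (nat * BinNums.Z) :=
  [seq (kz.1, ssrZ.Z_of_int kz.2) | kz <- pos ++
    [seq (k, pat`_(k %% size pat)) | k <- iota 36 36]].

Definition word1 : seq (nat * BinNums.Z) := Eval vm_compute in pattern_word
  [:: (7%N, 1); (23%N, 1); (30%N, 1); (15%N, 1); (24%N, -1); (17%N, -1)] [:: 1; 1; 2; -1; 1].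

Definition word2 : seq (nat * BinNums.Z) := Eval vm_compute in pattern_word
  [:: (8%N, 1); (35%N, 1); (0%N, 1); (33%N, -1); (13%N, -1); (24%N, 1); (6%N, -1); (5%N, -1);
      (27%N, 1); (28%N, 1); (9%N, -1); (10%N, 1); (29%N, -1); (17%N, -1); (21%N, 1)]
  [:: 2; -1; 1; -1].

Definition outer_adjoint (w : seq (nat * BinNums.Z)) : seq (spmx * spmx) :=
  [seq (word_vec w [:: (e.1.1, 0%N, e.2)],
        str (word_vec (word_inv_tr w) (sunit e.1.2 0))) | e <- rmat 35].

Definition scol (j : nat) (w : seq (nat * BinNums.Z)) : spmx := word_vec w (sunit j 0).

Definition outer_triple (w : seq (nat * BinNums.Z)) : seq (spmx * spmx) :=
  let u := scol 0 w in let v := scol 1 w in let x := scol 2 w in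
  let alt a b := smerge (scross a (seven b)) (sneg (scross b (seven a))) in
  [:: (u, alt v x); (v, alt x u); (x, alt u v)].

Definition outer_pair (i : nat) (u v : spmx) : seq (spmx * spmx) :=
  [:: (u, scross v (sunit i 0)); (v, sneg (scross u (sunit i 0)))].

Definition spair_form (u v : spmx) : spmx :=
  smerge (scross u (seven v)) (sneg (scross v (seven u))).

(** The root vector reached in the limit depends on the unknown B, so every odd root is tested;
    [pair_check] tests all pairs of weights for the same reason. *)
Definition odd_check (o1 o2 : seq (spmx * spmx)) : bool :=
  let L1 := outer_trace o1 in let L2 := outer_trace o2 in
  let s1 := sl2_values L1 in let s2 := sl2_values L2 in
  all (fun k => oddroot k ==> let m := rmat k in
    zindep (zform s1 (sl2_values (fun X => L1 (commutator X m))) (L1 m))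
           (zform s2 (sl2_values (fun X => L2 (commutator X m))) (L2 m))) (iota 0 72).

Definition pair_check (u1 v1 u2 v2 : spmx) : bool :=
  let z1 := spair_form u1 v1 in let z2 := spair_form u2 v2 in
  all (fun i => oddw i ||
    let s1 := sl2_values (outer_trace (outer_pair i u1 v1)) in
    let s2 := sl2_values (outer_trace (outer_pair i u2 v2)) in
    all (fun j => oddw j ==> let m := sunit j 0 in
      zindep (zform s1 (sl2_values (outer_trace [:: (m, z1)])) (scoef z1 0 j))
             (zform s2 (sl2_values (outer_trace [:: (m, z2)])) (scoef z2 0 j))) (iota 0 27))
    (iota 0 27).

Lemma check_adjoint : odd_check (outer_adjoint word1) (outer_adjoint word2).
Proof. by vm_compute. Qed.

Lemma check_triple : odd_check (outer_triple word1) (outer_triple word2).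
Proof. by vm_compute. Qed.

Lemma check_pair : pair_check (scol 0 word1) (scol 1 word1) (scol 0 word2) (scol 1 word2).
Proof. by vm_compute. Qed.

(** * Conclusion for the six maximal parabolic subgroups *)

Section NotSpherical.
Variable K : numClosedFieldType.
Local Notation G := (@E6_group K).
Local Notation imx := (imx K).
Local Notation zr := (zr K).

Lemma gword_inv_tr w : (invmx (gword K w))^T = gword K (word_inv_tr w).
Proof.
elim: w => [|[k s] w IH] /=; first by rewrite invmx1 trmx1.
have uG : gword K w \in unitmx.
  elim: w {IH} => [|[l t] w IH] /=; first exact: unitmx1.
  by rewrite unitmx_mul rootx_unit.
rewrite invmxM ?rootx_unit // trmx_mul IH zrN -rootx_tr.
by rewrite (rd_invx (root_datumG K)).
Qed.

Lemma imx_outer l : imx 27 27 l =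
  \sum_(e <- l) imx 27 1 [:: (e.1.1, 0%N, e.2)] *m imx 1 27 (str (sunit e.1.2 0)).
Proof.
elim: l => [|[[a b] z] l IH]; first by rewrite big_nil imx_nil.
rewrite -cat1s imx_cat IH big_cons -imx_mul; congr (imx 27 27 _ + _).
by rewrite -[in LHS](BinInt.Z.mul_1_r z).
Qed.

Lemma outer_adjointE w : \det (gword K w) = 1 ->
  adjoint_orbit (gword K w) =
  \sum_(ur <- outer_adjoint w) imx 27 1 ur.1 *m imx 1 27 ur.2.
Proof.
move=> d1; rewrite /outer_adjoint big_map /adjoint_orbit /theta_e rvectE imx_outer.
rewrite mulmx_sumr mulmx_suml; apply: eq_bigr => e _ /=.
rewrite word_vecE imx_tr word_vecE -gword_inv_tr invmx_adj // trmx_mul trmxK.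
by rewrite -imx_tr !mulmxA.
Qed.

Lemma scolE j w : (j < 27)%N -> imx 27 1 (scol j w) = ycol j (gword K w).
Proof.
move=> j27; rewrite /scol word_vecE /ycol; congr (_ *m _).
by rewrite -(imx_unit K (inord j) 0) inordK.
Qed.

Lemma outer_tripleE w : triple_orbit (gword K w) =
  \sum_(ur <- outer_triple w) imx 27 1 ur.1 *m imx 1 27 ur.2.
Proof.
rewrite /outer_triple !big_cons big_nil addr0 /= !imx_merge !imx_neg !imx_cross !imx_even.
rewrite !scolE // /triple_orbit /alt3 !mulmxBr.
do 6!move: (_ *m cross _ _) => ?; apply/matrixP => i j.
by rewrite !mxE; ring.
Qed.

Lemma outer_pairE (i : 'I_27) w : pair_orbit (delta_mx i 0) (gword K w) =
  \sum_(ur <- outer_pair i (scol 0 w) (scol 1 w)) imx 27 1 ur.1 *m imx 1 27 ur.2.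
Proof.
rewrite /outer_pair !big_cons big_nil addr0 /= imx_neg !imx_cross !scolE //.
by rewrite (imx_unit K i (0 : 'I_1)) mulmxN.
Qed.

Lemma spair_formE w : imx 1 27 (spair_form (scol 0 w) (scol 1 w)) = pair_form (gword K w).
Proof. by rewrite /spair_form imx_merge imx_neg !imx_cross !imx_even !scolE. Qed.

Let G1 : G (gword K word1). Proof. by apply: gword_E6; vm_compute. Qed.
Let G2 : G (gword K word2). Proof. by apply: gword_E6; vm_compute. Qed.

Lemma odd_not_spherical P (A : 'M[K]_27 -> 'M[K]_27) o1 o2 :
  subgroup P -> P `<=` G -> mxfun (@polyfun K 27) A ->
  (forall b g, @A5A1_group K b -> G g -> A (b *m g) = conjr b (A g)) ->
  (forall p, P p -> exists c, forall g, G g -> A (g *m p) = c *: A g) ->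
  A (gword K word1) = \sum_(ur <- o1) imx 27 1 ur.1 *m imx 1 27 ur.2 ->
  A (gword K word2) = \sum_(ur <- o2) imx 27 1 ur.1 *m imx 1 27 ur.2 ->
  odd_check o1 o2 -> ~ A5A1_spherical P.
Proof.
move=> sP PG pA lA rA /represents_outer e1 /represents_outer e2 chk sph.
have [k [a1 [a2 [k72 ok nz rel]]]] := odd_relation sP PG sph pA lA rA.
have eR L B : represents L B -> casimir_form a1 a2 B (bracket (rvect K k) B)
    (\tr (rvect K k *m B)) = let p := zform (sl2_values L)
      (sl2_values (fun X => L (commutator X (rmat k)))) (L (rmat k)) in
    a1 * zr p.1 + a2 * zr p.2.
  move=> h; rewrite rvectE h; apply: represents_casimir_form => //.
  exact: represents_bracket.
have h1 := etrans (esym (eR _ _ e1)) (rel _ G1).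
have h2 := etrans (esym (eR _ _ e2)) (rel _ G2).
have /implyP/(_ ok) ind := all_iota0P chk k72.
exact: (independent h1 h2 ind nz).
Qed.

Lemma parabolic1_not_spherical : ~ A5A1_spherical (@parabolic K 1).
Proof.
have d w : all (fun ks => (ks.1 < 72)%N) w -> \det (gword K w) = 1.
  by move=> h; apply: det_E6; apply: gword_E6.
apply: (odd_not_spherical _ _ (@adjoint_orbit_fun K) (@adjoint_orbit_conjr K)
  (@adjoint_orbit_parabolic K) (outer_adjointE (d _ _)) (outer_adjointE (d _ _)) check_adjoint).
- exact: parabolic_subgroup.
- exact: parabolic_sub.
- by vm_compute.
- by vm_compute.
Qed.

Lemma parabolic3_not_spherical : ~ A5A1_spherical (@parabolic K 3).
Proof.
apply: (odd_not_spherical _ _ (@triple_orbit_fun K) (@triple_orbit_conjr K)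
  (@triple_parabolic K) (outer_tripleE _) (outer_tripleE _) check_triple).
- exact: parabolic_subgroup.
- exact: parabolic_sub.
Qed.

Lemma parabolic2_not_spherical : ~ A5A1_spherical (@parabolic K 2).
Proof.
move=> sph; have [i [j [a1 [a2 [oi oj nz rel]]]]] :=
  pair_relation (@parabolic_subgroup K 2) (@parabolic_sub K 2) sph (@pair_parabolic K).
have eR w : pair_casimir a1 a2 (delta_mx i 0) (delta_mx j 0) (gword K w) =
    let u := scol 0 w in let v := scol 1 w in let z := spair_form u v in
    let p := zform (sl2_values (outer_trace (outer_pair i u v)))
      (sl2_values (outer_trace [:: (sunit j 0, z)])) (scoef z 0 j) in
    a1 * zr p.1 + a2 * zr p.2.
  rewrite /= -(represents_casimir_form _ _ _ (represents_outer (outer_pairE i w))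
    (represents_outer (erefl _))) /pair_casimir.
  rewrite big_seq1 spair_formE (imx_unit K j (0 : 'I_1)).
  by rewrite -colE [in LHS]mxE -spair_formE [in LHS]mxE.
have h1 := etrans (esym (eR word1)) (rel _ G1).
have h2 := etrans (esym (eR word2)) (rel _ G2).
have /orP [|/allP h] := all_iota0P check_pair (ltn_ord i); first by rewrite oi.
have j27 : (j : nat) \in iota 0 27 by rewrite mem_iota /= add0n.
have ind := implyP (h _ j27) oj.
exact: (independent h1 h2 ind nz).
Qed.

Lemma parabolic4_not_spherical : ~ A5A1_spherical (@parabolic K 4).
Proof.
move=> /(spherical_flips (@parabolic_subgroup K 4) (@parabolic_sub K 4)).
by rewrite flips_parabolic //; apply: parabolic2_not_spherical.
Qed.

Lemma parabolic5_spherical : A5A1_spherical (@parabolic K 5).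
Proof.
rewrite -(flips_parabolic K (i := 0)) //; apply: spherical_flips (parabolic0_spherical K).
  exact: parabolic_subgroup.
exact: parabolic_sub.
Qed.

End NotSpherical.

Theorem theorem14 (R : realType) (P : 'I_6 -> set 'M[R[i]]_27)
    (hP : forall i : 'I_6, is_max_parabolic i (P i)) :
  (A5A1_spherical (P (node 1)) /\ A5A1_spherical (P (node 6))) /\
  [/\ ~ A5A1_spherical (P (node 2)), ~ A5A1_spherical (P (node 3)),
      ~ A5A1_spherical (P (node 4)) & ~ A5A1_spherical (P (node 5))].
Proof.
have pE k : P (node k.+1) = parabolic (node k.+1) by apply: max_parabolicE.
(* Bourbaki's label k + 1 is the index k by which [parabolic] is numbered. *)
have nE k : (k < 6)%N -> node k.+1 = k :> nat by move=> k6; rewrite inordK.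
rewrite !pE !nE //; split.
  by split; [apply: parabolic0_spherical | apply: parabolic5_spherical].
split.
- exact: parabolic1_not_spherical.
- exact: parabolic2_not_spherical.
- exact: parabolic3_not_spherical.
- exact: parabolic4_not_spherical.
Qed.
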